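(* Let $A\subset\mathbb R^n$ be arbitrary. The map $y\mapsto\varepsilon_y^A$ from $\mathbb R^n$ into $\mathfrak M^+$ (with the vague topology) is continuous at every point $z\notin A^i$; that is, for every $f\in C_0(\mathbb R^n)$, $$\lim_{y\to z}\varepsilon_y^A(f)=\varepsilon_z^A(f)\quad\text{for all }z\notin A^i.$$ In particular, $\lim_{y\to z}\varepsilon_y^A(f)=f(z)$ for all $z\in A^r$ and all $f\in C_0(\mathbb R^n)$.
   Context: Standing assumptions: $n\ge3$, $\alpha\in(0,2]$, and $\kappa_\alpha(x,y)=|x-y|^{\alpha-n}$ is the Riesz kernel on $\mathbb R^n$. $\mathfrak M^+$ denotes the cone of positive Radon measures $\mu$ on $\mathbb R^n$ whose potential $\kappa_\alpha\mu(x)=\int|x-z|^{\alpha-n}d\mu(z)$ is not identically $+\infty$. The vague topology is that of pointwise convergence on $C_0(\mathbb R^n)$ (continuous functions with compact support); $\mu(f):=\int f\,d\mu$. The energy of $\mu$ is $\|\mu\|_\alpha^2=\iint\kappa_\alpha\,d\mu\,d\mu$; $\mathcal E^+_\alpha(A)$ is the set of positive measures of finite energy concentrated on $A$. The inner capacity of $A\subset\mathbb R^n$ is defined by $1/c_\alpha(A)=\inf\{\|\mu\|_\alpha^2:\ \mu\in\mathcal E^+_\alpha(A),\ \mu(\mathbb R^n)=1\}$. ''n.e. on $A$'' means: for all points of $A$ except a subset of inner capacity zero. Inner balayage: for $\mu\in\mathfrak M^+$ and arbitrary $A$, $\mu^A$ is the unique measure in $\mathfrak M^+$ with $\kappa_\alpha\mu^A=\inf\{\kappa_\alpha\nu:\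 \nu\in\mathfrak M^+,\ \kappa_\alpha\nu\ge\kappa_\alpha\mu \text{ n.e. on }A\}$ pointwise. $\varepsilon_y$ is the Dirac measure at $y$ and $\varepsilon_y^A:=(\varepsilon_y)^A$. $A^r:=\{y:\ \varepsilon_y^A=\varepsilon_y\}$ (inner $\alpha$-regular points), $A^i:=\overline A\setminus A^r$ (inner $\alpha$-irregular points). *)

(* Defs.v *)
(* Radon measures on R^n are treated in the
   Bourbaki sense: positive linear functionals on C_0(R^n) (continuous
   functions with compact support).  Integrals of nonnegative l.s.c.
   (extended-valued) functions are upper integrals
   sup { mu(f) : f in C_0, 0 <= f <= g }. *)
From HB Require Import structures.
From mathcomp Require Import all_boot all_order all_algebra.
From mathcomp Require Import all_classical all_reals all_analysis.
Set Implicit Arguments. Unset Strict Implicit. Unset Printing Implicit Defensive.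
Import Order.TTheory GRing.Theory Num.Theory.
Import numFieldNormedType.Exports.
Local Open Scope classical_set_scope.
Local Open Scope ring_scope.

Section Riesz.
Variables (R : realType) (n : nat).
Notation V := 'rV[R]_n.

(* Euclidean distance on R^n = 'rV[R]_n (the topology of 'rV is the product
   topology, i.e. the Euclidean one). *)
Definition edist (x y : V) : R := Num.sqrt (\sum_(i < n) (x ord0 i - y ord0 i) ^+ 2).

Definition riesz_kernel (alpha : R) (x y : V) : \bar R :=
  if x == y then +oo%E else (powR (edist x y) (alpha - n%:R))%:E.

Definition Cc (f : V -> R) : Prop :=
  continuous f /\ compact (closure [set x | f x != 0]).

(* Radon measures as functionals; only their values on C_0 matter. *)
Definition pos_radon (mu : (V -> R) -> R) : Prop :=
  [/\ forall f g, Cc f -> Cc g -> mu (f \+ g) = mu f + mu g,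
      forall (c : R) f, Cc f -> mu (fun x => c * f x) = c * mu f &
      forall f, Cc f -> (forall x, 0 <= f x) -> 0 <= mu f].

Definition meq (mu nu : (V -> R) -> R) : Prop := forall f, Cc f -> mu f = nu f.

Definition dirac_m (y : V) : (V -> R) -> R := fun f => f y.

Definition uint (mu : (V -> R) -> R) (g : V -> \bar R) : \bar R :=
  ereal_sup [set (mu f)%:E | f in [set f | Cc f /\
     (forall x, 0 <= f x) /\ (forall x, ((f x)%:E <= g x)%E)]].

Definition potential (alpha : R) (mu : (V -> R) -> R) (x : V) : \bar R :=
  uint mu (riesz_kernel alpha x).

Definition energy (alpha : R) (mu : (V -> R) -> R) : \bar R :=
  uint mu (potential alpha mu).

Definition total_mass (mu : (V -> R) -> R) : \bar R := uint mu (cst 1%:E).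

Definition outer_measure (mu : (V -> R) -> R) (E : set V) : \bar R :=
  ereal_inf [set uint mu (fun x => if `[< U x >] then 1%E else 0%E)
            | U in [set U : set V | open U /\ E `<=` U]].

Definition concentrated (mu : (V -> R) -> R) (A : set V) : Prop :=
  outer_measure mu (~` A) = 0%E.

Definition inv_inner_cap (alpha : R) (A : set V) : \bar R :=
  ereal_inf [set energy alpha mu | mu in [set mu | pos_radon mu /\
     concentrated mu A /\ energy alpha mu < +oo /\ total_mass mu = 1]%E].

Definition inner_cap (alpha : R) (A : set V) : \bar R :=
  match inv_inner_cap alpha A with
  | +oo%E => 0%E
  | r%:E => if r == 0 then +oo%E else (r^-1)%:E
  | -oo%E => +oo%E
  end.

Definition ne_on (alpha : R) (A : set V) (P : V -> Prop) : Prop :=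
  exists E, E `<=` A /\ inner_cap alpha E = 0%E /\ forall x, A x -> ~ E x -> P x.

Definition Mplus (alpha : R) (mu : (V -> R) -> R) : Prop :=
  pos_radon mu /\ exists x, potential alpha mu x != +oo%E.

Definition is_balayage (alpha : R) (mu : (V -> R) -> R) (A : set V)
    (nu : (V -> R) -> R) : Prop :=
  Mplus alpha nu /\ forall x, potential alpha nu x =
    ereal_inf [set potential alpha lam x | lam in [set lam | Mplus alpha lam /\
       ne_on alpha A (fun y => (potential alpha mu y <= potential alpha lam y)%E)]].

(* given the family y |-> eps_y^A, the inner regular / irregular points *)
Definition regular_pts (bal : V -> (V -> R) -> R) : set V :=
  [set y | meq (bal y) (dirac_m y)].
Definition irregular_pts (A : set V) (bal : V -> (V -> R) -> R) : set V :=
  closure A `\` regular_pts bal.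

End Riesz.

(* Main.v *)
Require Import Defs.
From HB Require Import structures.
From mathcomp Require Import all_boot all_order all_algebra.
From mathcomp Require Import all_classical all_reals all_analysis.
From mathcomp Require Import ring lra.
Set Implicit Arguments. Unset Strict Implicit. Unset Printing Implicit Defensive.
Import Order.TTheory GRing.Theory Num.Theory.
Import numFieldNormedType.Exports.
Local Open Scope classical_set_scope.
Local Open Scope ring_scope.

(* Write q = (n - alpha)/2 and let P_w be the potential of bal w, so that P_w is at most the kernel of w.  If z is regular,
   then P_w >= f - d for w near z whenever f in C_c lies below the kernel of z: otherwise a limit of competitors violating
   this along w -> z is, up to a Dirac mass at infinity, a competitor for z whose potential is somewhere below that of z.
   If z is not in the closure of A, then P_w and P_z are comparable with constants tending to 1.  In both cases
   theta(P_w) -> theta(P_z) for every compactly supported measure theta with continuous potential.  Let nu be the limit of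
   the bal w along an ultrafilter converging to z; as the masses are bounded, nu and bal z give the same integral to the
   potential of each such theta.  If A has positive capacity, such a theta <> 0 exists.  Convolve nu and bal z with a
   small copy of theta: the functions L (|. - y|^2 + s)^(-q) of the two convolutions L have asymptotically the same values,
   uniformly in y, as s -> 0.  As functions of (y, sqrt s) they solve the Caffarelli-Silvestre extension equation and vanish
   at infinity, so they coincide.  Letting s and the number of s-derivatives grow together, one gets equality on Gaussians,
   which determine a functional.  Hence nu = bal z. *)

(** * Distance and cutoff functions *)

(** Measures are only functionals on [Cc], so restriction to a set, Fubini and Lusin have to be
    rebuilt. Restrictions become limits of [mu (f * w_j)] for monotone continuous weights [w_j].
    Fubini rests on a Harnack inequality for [(|x - y|^2 + s)^(-q)] that every positive functional
    preserves; the same inequality makes regularized potentials equicontinuous and so handles base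
    points that move along an ultrafilter. The main obstacle is that vague limits make potentials
    only lower semicontinuous and let mass escape to infinity. Measures [theta] with continuous
    potential are tested against because this removes the first defect. As for the second, escaping
    mass adds to the potential, on bounded sets, at most about the amount of potential lost at one
    point, and a constant can be carried by a distant Dirac mass. The convolution with [theta] is
    what makes boundary values at [s = 0] uniform in the base point. The extension equation is used
    in discretized form, with nonnegative weights, so that no derivative is ever taken under a
    functional. *)

Section ContinuousReal.
Variables (R : realType) (T : topologicalType).
Implicit Types f g : T -> R.

Lemma continuous_cst (c : R) : continuous (fun _ : T => c).
Proof. by move=> x; apply: cvg_cst. Qed.

Lemma continuous_add f g : continuous f -> continuous g -> continuous (fun x => f x + g x).
Proof. by move=> cf cg x; apply: cvgD; [apply: cf|apply: cg]. Qed.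

Lemma continuous_opp f : continuous f -> continuous (fun x => - f x).
Proof. by move=> cf x; apply: cvgN; apply: cf. Qed.

Lemma continuous_sub f g : continuous f -> continuous g -> continuous (fun x => f x - g x).
Proof. by move=> cf cg x; apply: cvgB; [apply: cf|apply: cg]. Qed.

Lemma continuous_mul f g : continuous f -> continuous g -> continuous (fun x => f x * g x).
Proof. by move=> cf cg x; apply: cvgM; [apply: cf|apply: cg]. Qed.

Lemma continuous_scale (c : R) f : continuous f -> continuous (fun x => c * f x).
Proof. by move=> cf; apply: continuous_mul => //; apply: continuous_cst. Qed.

Lemma continuous_maxr f g : continuous f -> continuous g ->
  continuous (fun x => Num.max (f x) (g x)).
Proof. by move=> cf cg x; apply: (@continuous_max R T f g x); [apply: cf|apply: cg]. Qed.

Lemma continuous_minr f g : continuous f -> continuous g ->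
  continuous (fun x => Num.min (f x) (g x)).
Proof. by move=> cf cg x; apply: (@continuous_min R T f g x); [apply: cf|apply: cg]. Qed.

Lemma continuous_normr f : continuous f -> continuous (fun x => `|f x|).
Proof. by move=> cf x; apply: cvg_norm; apply: cf. Qed.

Lemma continuous_near f :
  (forall x (e : R), 0 < e -> \forall x' \near x, `|f x - f x'| <= e) -> continuous f.
Proof. by move=> h x; apply/cvgrPdist_le => e e0; exact: h. Qed.

Lemma near_continuous f x (e : R) : continuous f -> 0 < e -> \forall x' \near x, `|f x - f x'| <= e.
Proof. by move=> /(_ x)/cvgrPdist_le h e0; exact: h. Qed.

Lemma continuous_sum (I : Type) (s : seq I) (F : I -> T -> R) :
  (forall i, continuous (F i)) -> continuous (fun x => \sum_(i <- s) F i x).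
Proof.
move=> cF; elim: s => [|i s IH].
  by under eq_fun do rewrite big_nil; apply: continuous_cst.
by under eq_fun do rewrite big_cons; apply: continuous_add.
Qed.

Lemma open_ltf f g : continuous f -> continuous g -> open [set x | f x < g x].
Proof.
move=> cf cg; have -> : [set x | f x < g x] = (fun x => g x - f x) @^-1` [set y | 0 < y].
  by apply/seteqP; split=> x /=; rewrite subr_gt0.
apply: open_comp; last exact: open_gt.
by move=> x _; apply: continuous_sub.
Qed.

Lemma closed_lef f g : continuous f -> continuous g -> closed [set x | f x <= g x].
Proof.
move=> cf cg; have -> : [set x | f x <= g x] = ~` [set x | g x < f x].
  by apply/seteqP; split=> x /=; rewrite leNgt => /negP.
by apply: open_closedC; apply: open_ltf.
Qed.

End ContinuousReal.

Section Distance.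
Variables (R : realType) (n : nat).
Notation V := 'rV[R]_n.
Implicit Types x y z : V.

Definition dist2 x y : R := \sum_(i < n) (x ord0 i - y ord0 i) ^+ 2.

Lemma dist2C x y : dist2 x y = dist2 y x.
Proof. by apply: eq_bigr => i _; rewrite -sqrrN opprB. Qed.

Lemma dist2_ge0 x y : 0 <= dist2 x y.
Proof. by apply: sumr_ge0 => i _; apply: sqr_ge0. Qed.

Lemma dist2xx x : dist2 x x = 0.
Proof. by apply: big1 => i _; rewrite subrr expr0n. Qed.

Lemma dist2_eq0 x y : (dist2 x y == 0) = (x == y).
Proof.
apply/idP/idP=> [|/eqP->]; last by rewrite dist2xx.
rewrite psumr_eq0; last by move=> i _; apply: sqr_ge0.
move=> /allP h; apply/eqP/rowP => i; apply/eqP.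
by have := h i (mem_index_enum _); rewrite sqrf_eq0 subr_eq0.
Qed.

Lemma dist2_coord x y i : (x ord0 i - y ord0 i) ^+ 2 <= dist2 x y.
Proof.
rewrite /dist2 (bigD1 i) //= lerDl.
by apply: sumr_ge0 => j _; apply: sqr_ge0.
Qed.

Lemma sqr_split (e u v : R) : 0 < e -> (u + v) ^+ 2 <= (1 + e) * u ^+ 2 + (1 + e^-1) * v ^+ 2.
Proof.
move=> e0; rewrite -subr_ge0.
have -> : (1 + e) * u ^+ 2 + (1 + e^-1) * v ^+ 2 - (u + v) ^+ 2 = e^-1 * (e * u - v) ^+ 2.
  by field; rewrite gt_eqF.
by apply: mulr_ge0; [rewrite invr_ge0 ltW|apply: sqr_ge0].
Qed.

(** Squared distances are used throughout. The weight keeps the triangle inequality nearly sharp: if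
    [z] is close to [y], the factor of [dist2 x z] can be taken near 1. *)
Lemma dist2_split (e : R) z x y : 0 < e ->
  dist2 x y <= (1 + e) * dist2 x z + (1 + e^-1) * dist2 z y.
Proof.
move=> e0; rewrite /dist2 !mulr_sumr -big_split /=; apply: ler_sum => i _.
have -> : x ord0 i - y ord0 i = (x ord0 i - z ord0 i) + (z ord0 i - y ord0 i) by ring.
exact: sqr_split.
Qed.

Lemma dist2_split2 z x y : dist2 x y <= 2 * dist2 x z + 2 * dist2 z y.
Proof. by have := @dist2_split 1 z x y ltr01; rewrite invr1; apply: le_trans; lra. Qed.

Lemma continuous_dist2r x : continuous (dist2 x).
Proof.
apply: continuous_sum => i; have cu : continuous (fun y : V => x ord0 i - y ord0 i).
  apply: continuous_sub; first exact: continuous_cst.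
  exact: coord_continuous.
by apply: continuous_mul.
Qed.

Lemma near_dist2 x (e : R) : 0 < e -> \forall y \near x, dist2 x y < e.
Proof.
move=> e0; have := @continuous_dist2r x x.
by move/cvgr_lt; apply; rewrite dist2xx.
Qed.

Lemma compact_dist2 x (r : R) : compact [set y | dist2 x y <= r].
Proof.
apply: bounded_closed_compact; last first.
  by apply: closed_lef; [apply: continuous_dist2r|apply: continuous_cst].
have r1 : 0 <= 1 + `|r| by rewrite addr_ge0.
exists (1 + `|r| + `|x|); split; first by rewrite realE !addr_ge0.
move=> M hM y /= hy; apply: le_trans (ltW hM).
have -> : y = (y - x) + x by rewrite subrK.
apply: le_trans (ler_normD _ _) _; rewrite lerD2r.
rewrite [leLHS]/Num.norm /= mx_normrE; apply/bigmax_leP; split=> // -[i j] _ /=.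
rewrite [i]ord1 !mxE.
have h : (y ord0 j - x ord0 j) ^+ 2 <= `|r|.
  by apply: le_trans (dist2_coord _ _ _) _; rewrite dist2C; apply: le_trans hy _; exact: ler_norm.
rewrite -ler_sqr ?nnegrE // real_normK ?num_real //.
by apply: le_trans h _; have := normr_ge0 r; nra.
Qed.

Lemma dist2_nbhs x (P : set V) : nbhs x P -> exists2 e : R, 0 < e & forall y, dist2 x y < e -> P y.
Proof.
move=> /nbhs_ballP[e /= e0 h]; exists (e ^+ 2); first by rewrite exprn_gt0.
move=> y hy; apply: h; split=> // i j; rewrite [i]ord1 /ball /=.
rewrite -ltr_sqr ?nnegrE ?(ltW e0)//  real_normK ?num_real //.
exact: le_lt_trans (dist2_coord _ _ _) hy.
Qed.

End Distance.

Section Cutoff.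
Variables (R : realType) (n : nat).
Notation V := 'rV[R]_n.
Implicit Types f g : V -> R.

Lemma CcP f : Cc f <-> continuous f /\ exists r : R, forall x, r < dist2 0 x -> f x = 0.
Proof.
split=> -[cf].
  move=> cpt; split=> //.
  have [e0|ne] := eqVneq [set x | f x != 0] set0.
    exists 0 => x _; apply: contrapT => /eqP fx.
    by have : [set x | f x != 0] x by []; rewrite e0.
  move: cpt; set K := closure _ => cpt.
  have K0 : K !=set0.
    by case/set0P: ne => x fx; exists x; apply: subset_closure.
  have cd : {within K, continuous (@dist2 R n 0)}.
    by apply: continuous_subspaceT; apply: continuous_dist2r.
  have [c _ hc] := compact_EVT_max K0 cpt cd.
  exists (dist2 0 c) => x; apply: contraTeq => fx; rewrite -leNgt; apply: hc.
  by rewrite inE; apply: subset_closure.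
move=> [r hr]; split=> //.
apply: (@subclosed_compact _ _ [set y | dist2 0 y <= r]).
- exact: closed_closure.
- exact: compact_dist2.
- have cl : closed [set y : V | dist2 0 y <= r].
    by apply: closed_lef; [apply: continuous_dist2r|apply: continuous_cst].
  move: cl => /closure_id {1}->; apply: closure_subset => x /= fx.
  by rewrite leNgt; apply/negP => /hr fx0; rewrite fx0 eqxx in fx.
Qed.

Definition cutoff (j : R) : V -> R := fun x => Num.min 1 (Num.max 0 (j + 1 - dist2 0 x)).

Lemma cutoff_ge0 j x : 0 <= cutoff j x.
Proof. by rewrite /cutoff le_min ler01 le_max lexx. Qed.

Lemma cutoff_le1 j x : cutoff j x <= 1.
Proof. by rewrite /cutoff ge_min lexx. Qed.

Lemma cutoff1 j x : dist2 0 x <= j -> cutoff j x = 1.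
Proof. by move=> h; rewrite /cutoff min_l // le_max; apply/orP; right; lra. Qed.

Lemma cutoff0 j x : j + 1 <= dist2 0 x -> cutoff j x = 0.
Proof. by move=> h; rewrite /cutoff (@max_l _ _ 0) ?min_r //; lra. Qed.

Lemma le_cutoff i j x : i <= j -> cutoff i x <= cutoff j x.
Proof.
move=> ij; rewrite /cutoff le_min ge_min lexx /= ge_min; apply/orP; right.
by rewrite ge_max !le_max lexx /=; apply/orP; right; lra.
Qed.

Lemma continuous_cutoff j : continuous (cutoff j).
Proof.
apply: continuous_minr; first exact: continuous_cst.
apply: continuous_maxr; first exact: continuous_cst.
by apply: continuous_sub; [apply: continuous_cst|apply: continuous_dist2r].
Qed.

Lemma Cc_mull f g : Cc f -> continuous g -> Cc (fun x => f x * g x).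
Proof.
move=> /CcP[cf [r hr]] cg; apply/CcP; split; first exact: continuous_mul.
by exists r => x /hr ->; rewrite mul0r.
Qed.

Lemma Cc_mulr f g : Cc f -> continuous g -> Cc (fun x => g x * f x).
Proof. by move=> cf cg; under eq_fun do rewrite mulrC; apply: Cc_mull. Qed.

Lemma Cc_cutoff j : Cc (cutoff j).
Proof.
apply/CcP; split; first exact: continuous_cutoff.
by exists (j + 1) => x /ltW; exact: cutoff0.
Qed.

Lemma Cc_add f g : Cc f -> Cc g -> Cc (fun x => f x + g x).
Proof.
move=> /CcP[cf [r hr]] /CcP[cg [s hs]]; apply/CcP; split; first exact: continuous_add.
by exists (Num.max r s) => x; rewrite gt_max => /andP[/hr-> /hs->]; rewrite addr0.
Qed.

Lemma Cc_scale (c : R) f : Cc f -> Cc (fun x => c * f x).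
Proof. by move=> cf; apply: Cc_mulr => //; apply: continuous_cst. Qed.

Lemma Cc_sub f g : Cc f -> Cc g -> Cc (fun x => f x - g x).
Proof.
move=> cf cg; apply: Cc_add => //; have -> : (fun x => - g x) = (fun x => (-1) * g x).
  by apply/funext => x; rewrite mulN1r.
exact: Cc_scale.
Qed.

Lemma Cc_max0 f : Cc f -> Cc (fun x => Num.max 0 (f x)).
Proof.
move=> /CcP[cf [r hr]]; apply/CcP; split.
  by apply: continuous_maxr => //; apply: continuous_cst.
by exists r => x /hr ->; rewrite maxxx.
Qed.

Lemma Cc_cutoff_eq f : Cc f -> exists r : R, 0 <= r /\ forall j, r <= j -> forall x, f x = cutoff j x * f x.
Proof.
move=> /CcP[cf [r hr]]; exists (Num.max 0 r); split; first by rewrite le_max lexx.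
move=> j; rewrite ge_max => /andP[_ rj] x.
have [h|h] := leP (dist2 0 x) r; first by rewrite cutoff1 ?mul1r // (le_trans h).
by rewrite hr // mulr0.
Qed.

Lemma Cc_bounded f : Cc f -> exists M : R, 0 < M /\ forall x, `|f x| <= M.
Proof.
move=> /CcP[cf [r hr]].
have K0 : [set y : V | dist2 0 y <= `|r|] !=set0 by exists 0; rewrite /= dist2xx.
have cd : {within [set y : V | dist2 0 y <= `|r|], continuous (fun x => `|f x|)}.
  by apply: continuous_subspaceT; apply: continuous_normr.
have [c _ hc] := compact_EVT_max K0 (@compact_dist2 _ _ _ _) cd.
exists (`|f c| + 1); split; first by rewrite ltr_wpDl.
move=> x; have [h|h] := leP (dist2 0 x) `|r|.
  by apply: le_trans (hc x _) _; [rewrite inE|rewrite lerDl].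
by rewrite hr ?normr0 ?addr_ge0 //; apply: le_lt_trans h; exact: ler_norm.
Qed.

End Cutoff.

(** * Regularized Riesz kernels and positive functionals *)

Section RieszPower.
Variables (R : realType) (q : R).
Hypothesis q0 : 0 < q.

Lemma powRN_le (a b : R) : 0 < a -> a <= b -> b `^ (- q) <= a `^ (- q).
Proof.
move=> a0 ab; have b0 := lt_le_trans a0 ab.
rewrite !powRN lef_pV2 ?posrE ?powR_gt0 //.
by apply: ge0_ler_powR => //; rewrite ?nnegrE; exact: ltW.
Qed.

Lemma powRN_scale (c a b : R) : 0 < a -> 0 < b -> 0 < c -> b <= c * a -> a `^ (- q) <= c `^ q * b `^ (- q).
Proof.
move=> a0 b0 c0 h.
have -> : c `^ q * b `^ (- q) = (c^-1 * b) `^ (- q).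
  rewrite powRM ?invr_ge0 ?(ltW c0) ?(ltW b0) //; congr (_ * _).
  by rewrite -[c^-1]powR_inv1 ?(ltW c0) // -powRrM mulN1r opprK.
by apply: powRN_le; rewrite ?mulr_gt0 ?invr_gt0 // ler_pdivrMl.
Qed.

(** Translates a relative error [eta] in squared distances into a relative error [e] in kernels;
    most constants below are obtained through it. *)
Lemma powR_1D_le (e : R) : 0 < e -> exists2 eta, 0 < eta & forall eta', 0 <= eta' <= eta -> (1 + eta') `^ q <= 1 + e.
Proof.
move=> e0; have l0 : 0 < ln (1 + e) by rewrite ln_gt0 // ltrDl.
exists (ln (1 + e) / q); first by rewrite divr_gt0.
move=> h /andP[h0 hh]; rewrite /powR; case: ifP => [|_].
  by rewrite gt_eqF // ltr_wpDr.
have e1 : 0 < 1 + e by rewrite addr_gt0.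
rewrite -[leRHS]lnK ?posrE // ler_expR.
have : q * ln (1 + h) <= q * h.
  by rewrite ler_pM2l // le_ln1Dx // (lt_le_trans _ h0) // ltrN10.
by move=> /le_trans; apply; rewrite mulrC -ler_pdivlMr.
Qed.

Lemma powRN_large (M : R) : exists2 e, 0 < e & forall s, 0 < s <= e -> M <= s `^ (- q).
Proof.
pose N : R := 1 + `|M|; have N0 : 0 < N by rewrite ltr_pwDl.
exists (N `^ (- q^-1)); first by rewrite powR_gt0.
move=> s /andP[s0 sh]; apply: (@le_trans _ _ N).
  by rewrite (le_trans (ler_norm M)) // lerDr.
have -> : N = (N `^ (- q^-1)) `^ (- q).
  by rewrite -powRrM mulrNN mulVf ?gt_eqF // powRr1 // ltW.
exact: powRN_le.
Qed.

Lemma powRN_small (e : R) : 0 < e -> exists2 M, 0 < M & forall s, M <= s -> s `^ (- q) <= e.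
Proof.
move=> e0; exists (e `^ (- q^-1)); first by rewrite powR_gt0.
move=> s hs; have -> : e = (e `^ (- q^-1)) `^ (- q).
  by rewrite -powRrM mulrNN mulVf ?gt_eqF // powRr1 // ltW.
by apply: powRN_le; rewrite ?powR_gt0.
Qed.

End RieszPower.

Section Kernel.
Variables (R : realType) (n : nat) (q : R).
Hypothesis q0 : 0 < q.
Notation V := 'rV[R]_n.
Implicit Types x y : V.

Definition rker (s : R) x y : R := (dist2 x y + s) `^ (- q).
Notation ker := rker.

Lemma dist2D_gt0 (s : R) x y : 0 < s -> 0 < dist2 x y + s.
Proof. by move=> s0; rewrite ltr_wpDl // dist2_ge0. Qed.

Lemma kerC s x y : ker s x y = ker s y x.
Proof. by rewrite /ker dist2C. Qed.

Lemma ker_ge0 s x y : 0 <= ker s x y. Proof. exact: powR_ge0. Qed.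

Lemma ker_gt0 s x y : 0 < s -> 0 < ker s x y.
Proof. by move=> s0; rewrite powR_gt0 // dist2D_gt0. Qed.

Lemma ker_decr s t x y : 0 < s -> s <= t -> ker t x y <= ker s x y.
Proof. by move=> s0 st; apply: powRN_le => //; rewrite ?dist2D_gt0 // lerD2l. Qed.

Lemma ker_le s x y : 0 < s -> ker s x y <= s `^ (- q).
Proof. by move=> s0; apply: powRN_le => //; rewrite lerDr dist2_ge0. Qed.

(** A Harnack inequality at scale [c]. It is linear in [g], so positive functionals pass it from the
    kernel to potentials with the same [c], whatever the measure: potentials are equicontinuous in
    the relative sense. *)
Definition harnack (c : R) (g : V -> R) := forall x x' (eta : R), 0 < eta ->
  (1 + eta^-1) * dist2 x x' <= eta * c -> g x' <= (1 + eta) `^ q * g x.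

Lemma harnack_ker s y : 0 < s -> harnack s (ker s ^~ y).
Proof.
move=> s0 x x' eta e0 h; apply: powRN_scale => //; rewrite ?dist2D_gt0 ?addr_gt0 //.
have := dist2_split x' y x e0; move: h; rewrite !(dist2C _ x) (dist2C y x').
set c := (1 + eta^-1) * _; set b := dist2 x' y.
by move=> h1 h2; rewrite mulrDr (mulrDl _ _ s) mul1r; lra.
Qed.

Lemma harnack_near (c : R) x (e : R) : 0 < c -> 0 < e ->
  \forall x' \near x, forall g, harnack c g -> g x' <= (1 + e) * `|g x| /\ g x <= (1 + e) * `|g x'|.
Proof.
move=> c0 e0; have [eta eta0 he] := powR_1D_le q0 e0.
have d0 : 0 < eta * c / (1 + eta^-1).
  by rewrite divr_gt0 ?mulr_gt0 // addr_gt0 // invr_gt0.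
have hp : (1 + eta) `^ q <= 1 + e by apply: he; rewrite ltW //=.
near=> x' => g hg.
have hd : (1 + eta^-1) * dist2 x x' <= eta * c.
  rewrite mulrC -ler_pdivlMr ?addr_gt0 ?invr_gt0 //; apply: ltW.
  by near: x'; apply: near_dist2.
split.
  apply: le_trans (hg x x' eta eta0 hd) _.
  apply: le_trans (ler_wpM2l (powR_ge0 _ _) (ler_norm _)) _.
  exact: ler_wpM2r.
apply: le_trans (hg x' x eta eta0 _) _; first by rewrite dist2C.
apply: le_trans (ler_wpM2l (powR_ge0 _ _) (ler_norm _)) _.
exact: ler_wpM2r.
Unshelve. all: end_near. Qed.

Lemma ler_dist_mul (a b d e : R) : 0 < d -> d * a <= e -> b <= (1 + d) * a -> a <= (1 + d) * b -> `|a - b| <= e.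
Proof.
move=> d0 de h1 h2; rewrite ler_norml; apply/andP; split; first by lra.
by have [|gg] := leP a b; [lra|have : d * b <= d * a by rewrite ler_pM2l // ltW]; lra.
Qed.

Lemma harnack_continuous (c : R) (g : V -> R) : 0 < c -> (forall x, 0 <= g x) -> harnack c g -> continuous g.
Proof.
move=> c0 g0 hg; apply: continuous_near => x e e0.
pose d := e / (g x + 1).
have d0 : 0 < d by rewrite divr_gt0 // ltr_wpDl.
have de : d * g x <= e.
  rewrite /d mulrAC -mulrA -[leRHS]mulr1 ler_pM2l // ler_pdivrMr ?mul1r ?lerDl ?ler01 //.
  by rewrite ltr_wpDl.
near=> x'.
have [h1 h2] : g x' <= (1 + d) * g x /\ g x <= (1 + d) * g x'.
  rewrite -[X in _ * X](ger0_norm (g0 x)) -[X in _ /\ _ <= _ * X](ger0_norm (g0 x')).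
  near: x'; have := harnack_near x c0 d0.
  by apply: filterS => x' /(_ g hg).
exact: ler_dist_mul h1 h2.
Unshelve. all: end_near. Qed.

Lemma continuous_ker s y : 0 < s -> continuous (ker s ^~ y).
Proof. by move=> s0; apply: (@harnack_continuous s) => // [x|]; [exact: ker_ge0|exact: harnack_ker]. Qed.

Lemma continuous_kerr s x : 0 < s -> continuous (ker s x).
Proof.
move=> s0; have -> : ker s x = ker s ^~ x by apply/funext => z; rewrite kerC.
exact: continuous_ker.
Qed.

End Kernel.

Section PositiveFunctional.
Variables (R : realType) (n : nat).
Notation V := 'rV[R]_n.
Implicit Types (P : (V -> R) -> Prop) (L : (V -> R) -> R) (f g : V -> R).

Definition linclass P := (forall f g, P f -> P g -> P (fun x => f x + g x)) /\
  (forall c f, P f -> P (fun x => c * f x)).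

(** The class [P] sets the kind of measure: [Cc] for Radon measures, [Cont] for compactly supported
    ones, [Cb] for finite ones (where tightness is a separate condition). *)
Definition poslin P L :=
  [/\ forall f g, P f -> P g -> L (fun x => f x + g x) = L f + L g,
      forall c f, P f -> L (fun x => c * f x) = c * L f &
      forall f, P f -> (forall x, 0 <= f x) -> 0 <= L f].

Variables (P : (V -> R) -> Prop) (L : (V -> R) -> R).
Hypotheses (cP : linclass P) (pL : poslin P L).

Lemma linclassB f g : P f -> P g -> P (fun x => f x - g x).
Proof.
case: cP => ca cs Pf Pg; have -> : (fun x => f x - g x) = (fun x => f x + (-1) * g x).
  by apply/funext => x; rewrite mulN1r.
by apply: ca => //; apply: cs.
Qed.

Lemma poslinD f g : P f -> P g -> L (fun x => f x + g x) = L f + L g.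
Proof. by case: pL => h _ _; exact: h. Qed.

Lemma poslinZ c f : P f -> L (fun x => c * f x) = c * L f.
Proof. by case: pL => _ h _; exact: h. Qed.

Lemma poslin_ge0 f : P f -> (forall x, 0 <= f x) -> 0 <= L f.
Proof. by case: pL => _ _; apply. Qed.

Lemma poslinB f g : P f -> P g -> L (fun x => f x - g x) = L f - L g.
Proof.
case: (cP) => ca cs Pf Pg; have -> : (fun x => f x - g x) = (fun x => f x + (-1) * g x).
  by apply/funext => x; rewrite mulN1r.
by rewrite poslinD ?poslinZ ?mulN1r //; apply: cs.
Qed.

Lemma poslin_le f g : P f -> P g -> (forall x, f x <= g x) -> L f <= L g.
Proof.
move=> Pf Pg h; rewrite -subr_ge0 -poslinB //; apply: poslin_ge0; first exact: linclassB.
by move=> x; rewrite subr_ge0.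
Qed.

Lemma linclass_sum (I : Type) (s : seq I) (F : I -> V -> R) : P (fun=> 0) ->
  (forall i, P (F i)) -> P (fun x => \sum_(i <- s) F i x).
Proof.
move=> P0 PF; elim: s => [|i s IH]; first by under eq_fun do rewrite big_nil.
by under eq_fun do rewrite big_cons; apply cP.
Qed.

Lemma poslin_sum (I : Type) (s : seq I) (F : I -> V -> R) : P (fun=> 0) ->
  (forall i, P (F i)) -> L (fun x => \sum_(i <- s) F i x) = \sum_(i <- s) L (F i).
Proof.
move=> P0 PF; elim: s => [|i s IH].
  rewrite big_nil -[RHS](mul0r (L (fun=> 0))) -poslinZ //; congr L.
  by apply/funext => x; rewrite big_nil mul0r.
have -> : (fun x => \sum_(j <- i :: s) F j x) = (fun x => F i x + \sum_(j <- s) F j x).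
  by apply/funext => x; rewrite big_cons.
rewrite big_cons.
by rewrite poslinD // ?IH //; exact: linclass_sum.
Qed.

End PositiveFunctional.

Section Classes.
Variables (R : realType) (n : nat).
Notation V := 'rV[R]_n.
Implicit Types f g : V -> R.

Lemma linclass_Cc : linclass (@Cc R n).
Proof. by split; [exact: Cc_add|exact: Cc_scale]. Qed.

Definition Cont f := continuous f.

Lemma linclass_Cont : linclass Cont.
Proof. by split; [exact: continuous_add|exact: continuous_scale]. Qed.

Definition Cb f := continuous f /\ exists M : R, forall x, `|f x| <= M.

Lemma linclass_Cb : linclass Cb.
Proof.
split=> [f g [cf [M hM]] [cg [N hN]]|c f [cf [M hM]]].
  split; first exact: continuous_add.
  by exists (M + N) => x; apply: le_trans (ler_normD _ _) _; exact: lerD.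
split; first exact: continuous_scale.
by exists (`|c| * M) => x; rewrite normrM; apply: ler_wpM2l.
Qed.

Lemma Cc_Cont f : Cc f -> Cont f. Proof. by case. Qed.

Lemma Cc_Cb f : Cc f -> Cb f.
Proof. by move=> cf; split; [case: cf|have [M [_ hM]] := Cc_bounded cf; exists M]. Qed.

Lemma Cb_Cont f : Cb f -> Cont f. Proof. by case. Qed.

Lemma Cc0 : Cc (fun _ : V => 0 : R).
Proof. by apply/CcP; split; [exact: continuous_cst|exists 0]. Qed.

Lemma Cb_cst (c : R) : Cb (fun _ : V => c).
Proof. by split; [exact: continuous_cst|exists `|c|]. Qed.

Lemma poslin_sub (P Q : (V -> R) -> Prop) L : (forall f, Q f -> P f) -> poslin P L -> poslin Q L.
Proof.
by move=> QP [a s p]; split=> [f g /QP Pf /QP Pg|c f /QP Pf|f /QP Pf]; [apply: a|apply: s|apply: p].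
Qed.

(** Used for sequences, where densities are constructed, and along ultrafilters, where vague limits
    are taken. *)
Lemma poslin_lim (I : Type) (F : set_system I) (P : (V -> R) -> Prop) (Ls : I -> (V -> R) -> R) L :
  ProperFilter F -> linclass P -> (forall i, poslin P (Ls i)) ->
  (forall f, P f -> (Ls i f @[i --> F]) --> (L f : R)) -> poslin P L.
Proof.
move=> FF [ca cs] hl hc; split.
- move=> f g Pf Pg; apply: (@cvg_unique _ _ (Ls i (fun x => f x + g x) @[i --> F])) => //.
    by apply: hc; apply: ca.
  have -> : (fun i => Ls i (fun x => f x + g x)) = (fun i => Ls i f + Ls i g).
    by apply/funext => i; rewrite (poslinD (hl i) Pf Pg).
  by apply: cvgD; apply: hc.
- move=> c f Pf; apply: (@cvg_unique _ _ (Ls i (fun x => c * f x) @[i --> F])) => //.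
    by apply: hc; apply: cs.
  have -> : (fun i => Ls i (fun x => c * f x)) = (fun i => c * Ls i f).
    by apply/funext => i; rewrite (poslinZ (hl i) c Pf).
  by apply: cvgM; [exact: cvg_cst|exact: hc].
- move=> f Pf f0; apply: (cvgr_to_ge (hc f Pf)).
  by near=> i; apply: (poslin_ge0 (hl i)).
Unshelve. all: end_near. Qed.

End Classes.

(** * Upper integrals *)

Section UpperIntegral.
Variables (R : realType) (n : nat).
Notation V := 'rV[R]_n.
Implicit Types (mu : (V -> R) -> R) (f : V -> R) (g : V -> \bar R).

Lemma compact_nondecreasing (K : set V) (G : nat -> set V) : compact K ->
  (forall j, open (G j)) -> (forall i j, (i <= j)%N -> G i `<=` G j) ->
  (forall x, K x -> exists j, G j x) -> exists j, forall i, (j <= i)%N -> K `<=` G i.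
Proof.
move=> cK oG mG hG.
have [j _ hj] : \forall j \near \oo, K `<=` G j.
  have /compact_near_coveringP cov := cK; apply: (cov nat \oo (fun j x => G j x)).
  move=> x /hG[j Gjx]; exists (G j, [set i | (j <= i)%N]) => /=.
    by split; [apply: open_nbhs_nbhs|exists j].
  by move=> [y i] /= [Gy ji]; apply: (mG j).
by exists j => i ji; apply: hj.
Qed.

Lemma uint_ge mu f g : Cc f -> (forall x, 0 <= f x) -> (forall x, ((f x)%:E <= g x)%E) ->
  ((mu f)%:E <= uint mu g)%E.
Proof. by move=> cf f0 fg; apply: ereal_sup_ubound; exists f. Qed.

Lemma uint_le mu g M : (forall f, Cc f -> (forall x, 0 <= f x) -> (forall x, ((f x)%:E <= g x)%E) -> ((mu f)%:E <= M)%E) ->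
  (uint mu g <= M)%E.
Proof. by move=> h; apply: ge_ereal_sup => _ [f [cf [f0 fg]] <-]; apply: h. Qed.

Lemma le_uint mu g g' : (forall x, (g x <= g' x)%E) -> (uint mu g <= uint mu g')%E.
Proof. by move=> h; apply: uint_le => f cf f0 fg; apply: uint_ge => // x; apply: le_trans (h x). Qed.

Lemma uint_gt mu g (M : R) : (M%:E < uint mu g)%E ->
  exists f, [/\ Cc f, forall x, 0 <= f x, forall x, ((f x)%:E <= g x)%E & M < mu f].
Proof. by move=> /ereal_sup_gt[_ [f [cf [f0 fg]] <-]]; rewrite lte_fin => h; exists f. Qed.

Definition esup (h : nat -> V -> R) x : \bar R := ereal_sup (range (fun j => (h j x)%:E)).

Lemma esup_ge h j x : ((h j x)%:E <= esup h x)%E.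
Proof. by apply: ereal_sup_ubound; exists j. Qed.

Lemma esup_le h x M : (forall j, ((h j x)%:E <= M)%E) -> (esup h x <= M)%E.
Proof. by move=> H; apply: ge_ereal_sup => _ [j _ <-]. Qed.

Lemma esup_gt h x (M : R) : (M%:E < esup h x)%E -> exists j, M < h j x.
Proof. by move=> /ereal_sup_gt[_ [j _ <-]]; rewrite lte_fin => H; exists j. Qed.

Definition incr (h : nat -> V -> R) := [/\ forall j, Cc (h j), forall j x, 0 <= h j x &
  forall i j x, (i <= j)%N -> h i x <= h j x].

(** Dini's argument on a ball minus [U], which is compact because [U] is open; beyond the ball [f]
    vanishes. The set [U] leaves room for an exceptional set of small mass. *)
Lemma dini h (U : set V) f (e : R) : incr h -> Cc f -> open U ->
  (forall x, ~ U x -> ((f x)%:E <= esup h x)%E) -> 0 < e ->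
  exists j, forall i, (j <= i)%N -> forall x, ~ U x -> f x < h i x + e.
Proof.
move=> [ch h0 mh] /CcP[cf [r hr]] oU fh e0.
have cK : compact ([set y | dist2 0 y <= r] `&` ~` U).
  by apply: compact_closedI; [exact: compact_dist2|exact: open_closedC].
have [||x|j hj] := compact_nondecreasing (G := fun j => [set x | f x < h j x + e]) cK.
- move=> j; apply: open_ltf => //; apply: continuous_add; first by case: (ch j).
  exact: continuous_cst.
- by move=> i j ij x /= /lt_le_trans; apply; rewrite lerD2r mh.
- move=> [_ /fh fx]; have [] := @esup_gt h x (f x - e).
    by apply: lt_le_trans fx; rewrite lte_fin ltrBlDr ltrDl.
  by move=> j hj; exists j => /=; lra.
exists j => i ji x Ux; have [xr|xr] := leP (dist2 0 x) r; first by apply: hj.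
by rewrite hr // ltr_wpDl.
Qed.

Lemma dini_all h f (e : R) : incr h -> Cc f -> 
  (forall x, ((f x)%:E <= esup h x)%E) -> 0 < e ->
  exists j, forall i, (j <= i)%N -> forall x, f x < h i x + e.
Proof.
move=> ih cf fh e0; have [//|j hj] := @dini h set0 f e ih cf open0 _ e0.
by exists j => i ji x; apply: hj.
Qed.

(** A constant error [d] is not integrable in general; it is charged to a cutoff that equals 1 on
    the support of [f]. *)
Lemma radon_le_eps mu f (e : R) : pos_radon mu -> Cc f -> 0 < e ->
  exists2 d : R, 0 < d & forall (g' : V -> R), Cc g' -> (forall x, 0 <= g' x) -> (forall x, f x <= g' x + d) -> mu f <= mu g' + e.
Proof.
move=> pm cf e0; have [r [r0 hr]] := Cc_cutoff_eq cf.
have m0 : 0 <= mu (cutoff r) by apply: (poslin_ge0 pm); [exact: Cc_cutoff|move=> x; exact: cutoff_ge0].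
exists (e / (mu (cutoff r) + 1)); first by rewrite divr_gt0 // ltr_wpDl.
set d := e / _ => g' cg' g'0 h; have d0 : 0 < d by rewrite divr_gt0 // ltr_wpDl.
have -> : f = fun x => cutoff r x * f x by apply/funext => x; apply: hr.
apply: (@le_trans _ _ (mu (fun x => g' x + d * cutoff r x))).
  apply: (poslin_le (@linclass_Cc _ _) pm).
  - by apply: Cc_mulr => //; exact: continuous_cutoff.
  - by apply: Cc_add => //; apply: Cc_scale; exact: Cc_cutoff.
  move=> x; have := cutoff_ge0 r x; have := cutoff_le1 r x; have := h x; have := g'0 x.
  by set c := cutoff r x => *; nra.
rewrite (poslinD pm) //; last by apply: Cc_scale; exact: Cc_cutoff.
rewrite (poslinZ pm); last exact: Cc_cutoff.
rewrite lerD2l /d mulrAC -mulrA -[leRHS]mulr1 ler_pM2l // ler_pdivrMr ?mul1r ?lerDl ?ler01 //.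
by rewrite ltr_wpDl.
Qed.

(** Monotone convergence for the upper integral. It reduces every integral of a potential to values
    of the functional on [Cc]. *)
Lemma uint_esup mu h : pos_radon mu -> incr h ->
  uint mu (esup h) = ereal_sup (range (fun j => (mu (h j))%:E)).
Proof.
move=> pm ih; have [ch h0 mh] := ih; apply/eqP; rewrite eq_le; apply/andP; split; last first.
  by apply: ge_ereal_sup => _ [j _ <-]; apply: uint_ge => // x; exact: esup_ge.
apply: uint_le => f cf f0 fh; apply/lee_addgt0Pr => e e0.
have [d d0 hd] := radon_le_eps pm cf e0.
have [j hj] := dini_all ih cf fh d0.
apply: (@le_trans _ _ ((mu (h j))%:E + e%:E)%E).
  by rewrite -EFinD lee_fin; apply: hd => // x; apply: ltW; apply: hj.
by apply: leeD2r; apply: ereal_sup_ubound; exists j.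
Qed.

Lemma uint_esup_ge mu h j : incr h -> ((mu (h j))%:E <= uint mu (esup h))%E.
Proof. by move=> [ch h0 mh]; apply: uint_ge => // x; exact: esup_ge. Qed.

Lemma concentrated_open mu E : concentrated mu E -> forall e : R, 0 < e ->
  exists U, [/\ open U, ~` E `<=` U & forall f, Cc f -> (forall x, 0 <= f x <= 1) -> (forall x, ~ U x -> f x = 0) -> mu f <= e].
Proof.
move=> cE e e0; have : (Defs.outer_measure mu (~` E) < e%:E)%E by rewrite cE lte_fin.
move=> /ereal_inf_lt[_ [U [oU EU] <-]] hU; exists U; split=> // f cf f01 fU.
rewrite -lee_fin; apply: le_trans (ltW hU); apply: uint_ge => // x; first by case/andP: (f01 x).
case: asboolP => Ux; last by rewrite fU.
by rewrite lee_fin; case/andP: (f01 x).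
Qed.

Lemma Cc_max_sub f (g : V -> R) : Cc f -> continuous g -> (forall x, 0 <= g x) -> Cc (fun x => Num.max 0 (f x - g x)).
Proof.
move=> /CcP[cf [r hr]] cg g0; apply/CcP; split.
  by apply: continuous_maxr; [exact: continuous_cst|exact: continuous_sub].
by exists r => x /hr ->; rewrite max_l // sub0r oppr_le0.
Qed.

(** Integration sees only [E]: the complement of [E] lies in an open [U] of small mass, Dini's
    argument applies off [U], and the remainder [w] is bounded by [M] and vanishes off [U]. *)
Lemma concentrated_le mu E h f : pos_radon mu -> concentrated mu E -> incr h -> Cc f -> 
  (forall x, E x -> ((f x)%:E <= esup h x)%E) -> ((mu f)%:E <= uint mu (esup h))%E.
Proof.
move=> pm cE ih cf fh; have [ch h0 mh] := ih; apply/lee_addgt0Pr => e e0.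
have [M [M0 hM]] := Cc_bounded cf.
have e20 : 0 < e / 2 by rewrite divr_gt0.
have [U [oU EU hU]] := concentrated_open cE (divr_gt0 e20 M0).
have [d d0 hd] := radon_le_eps pm cf e20.
have [x Ux|j /(_ j (leqnn j)) hj] := dini ih cf oU _ d0.
  by apply: fh; apply: contrapT => Ex; apply: Ux; exact: EU.
pose w x := Num.max 0 (f x - (h j x + d)).
have hjd x : 0 <= h j x + d by rewrite addr_ge0 // ltW.
have cw : Cc w.
  apply: Cc_max_sub => //; apply: continuous_add; [by case: (ch j)|exact: continuous_cst].
have w0 x : 0 <= w x by rewrite le_max lexx.
have wM x : w x <= M.
  rewrite ge_max (ltW M0) /=; have := hM x; have := hjd x; rewrite ler_norml => ? /andP[_].
  by move=> ?; lra.
have mw : mu w <= e / 2.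
  have : mu (fun x => M^-1 * w x) <= (e / 2) / M.
    apply: hU; first exact: Cc_scale.
      by move=> x; rewrite mulr_ge0 ?invr_ge0 ?(ltW M0) //= mulrC ler_pdivrMr ?mul1r.
    by move=> x /hj hx; rewrite /w max_l ?mulr0 //; lra.
  by rewrite (poslinZ pm) // mulrC ler_pM2r ?invr_gt0.
have : mu f <= mu (fun x => h j x + w x) + e / 2.
  apply: hd => [|x|x]; [exact: Cc_add|exact: addr_ge0|].
  have : f x - (h j x + d) <= w x by rewrite le_max lexx orbT.
  by lra.
rewrite (poslinD pm) // => H.
apply: (@le_trans _ _ ((mu (h j))%:E + e%:E)%E); first by rewrite -EFinD lee_fin; lra.
by apply: leeD2r; apply: uint_esup_ge.
Qed.

End UpperIntegral.

(** * Potentials *)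

Section Partition.
Variables (R : realType) (n : nat).
Notation V := 'rV[R]_n.

(** A partition of unity built from bumps with products and differences only. Avoiding division lets
    it be reused for Gaussian bumps, whose span is closed under products but not under quotients. *)
Definition peel (u : nat -> R) i := u i * \prod_(j < i) (1 - u j).

Lemma sum_peel (u : nat -> R) N : \sum_(i < N) peel u i = 1 - \prod_(j < N) (1 - u j).
Proof.
elim: N => [|N IH]; first by rewrite !big_ord0 subrr.
rewrite big_ord_recr /= IH big_ord_recr /= /peel; ring.
Qed.

Lemma peel_ge0 (u : nat -> R) i : (forall j, 0 <= u j <= 1) -> 0 <= peel u i.
Proof.
move=> h; apply: mulr_ge0; first by case/andP: (h i).
by apply: prodr_ge0 => j _; rewrite subr_ge0; case/andP: (h j).
Qed.

Lemma peel_le (u : nat -> R) i : (forall j, 0 <= u j <= 1) -> peel u i <= u i.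
Proof.
move=> h; rewrite -[leRHS]mulr1; apply: ler_wpM2l; first by case/andP: (h i).
apply: prodr_ile1 => j _; rewrite subr_ge0; case/andP: (h j) => uj0 uj1.
by rewrite uj1 lerBlDr lerDl.
Qed.

Lemma finite_net (r d : R) : 0 < d -> exists N (c : nat -> V),
  forall x, dist2 0 x <= r -> exists2 i, (i < N)%N & dist2 (c i) x < d.
Proof.
move=> d0; have := @compact_dist2 R n 0 r; rewrite compact_cover.
move=> /(_ V setT (fun c => [set x | dist2 c x < d])) [].
- by move=> c _; apply: open_ltf; [exact: continuous_dist2r|exact: continuous_cst].
- by move=> x _; exists x => //=; rewrite dist2xx.
move=> D _ hD; pose l : seq V := finmap.enum_fset D; exists (size l), (nth 0 l) => x /hD[c /= cD cx].
by exists (index c l); rewrite ?index_mem ?nth_index.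
Qed.

Lemma continuous_prod (N : nat) (F : nat -> V -> R) : (forall i, continuous (F i)) ->
  continuous (fun x => \prod_(i < N) F i x).
Proof.
move=> cF; elim: N => [|N IH].
  by under eq_fun do rewrite big_ord0; apply: continuous_cst.
by under eq_fun do rewrite big_ord_recr /=; apply: continuous_mul.
Qed.

Lemma partition_of_unity (r d : R) : 0 < d -> exists N (c : nat -> V) (phi : nat -> V -> R),
  [/\ forall i, continuous (phi i), forall i x, 0 <= phi i x,
      forall x, dist2 0 x <= r -> \sum_(i < N) phi i x = 1 &
      forall i x, d <= dist2 (c i) x -> phi i x = 0].
Proof.
move=> d0; have d20 : 0 < d / 2 by rewrite divr_gt0.
have [N [c hc]] := finite_net r d20.
pose u i x : R := Num.max 0 (Num.min 1 (2 - dist2 (c i) x / (d / 2))).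
have u01 i x : 0 <= u i x <= 1 by rewrite /u le_max lexx ge_max ler01 ge_min lexx.
have cu i : continuous (u i).
  apply: continuous_maxr; first exact: continuous_cst.
  apply: continuous_minr; first exact: continuous_cst.
  apply: continuous_sub; first exact: continuous_cst.
  by apply: continuous_mul; [exact: continuous_dist2r|exact: continuous_cst].
exists N, c, (fun i x => peel (u^~ x) i); split.
- move=> i; apply: continuous_mul => //.
  by apply: (@continuous_prod i (fun j x => 1 - u j x)) => j; apply: continuous_sub => //; exact: continuous_cst.
- by move=> i x; apply: peel_ge0.
- move=> x /hc[i iN hx]; rewrite sum_peel (bigD1 (Ordinal iN)) //=.
  suff -> : u i x = 1 by rewrite subrr mul0r subr0.
  rewrite /u min_l ?max_r ?ler01 // lerBrDr -lerBrDl.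
  have -> : 2 - 1 = 1 :> R by ring.
  by rewrite ler_pdivrMr // mul1r ltW.
- move=> i x hx; rewrite /peel; suff -> : u i x = 0 by rewrite mul0r.
  rewrite /u max_l // ge_min; apply/orP; right.
  by rewrite subr_le0 ler_pdivlMr // mulrC divfK // pnatr_eq0.
Qed.

End Partition.

Lemma lee_real_lt (R : realType) (a b : \bar R) : (0 <= b)%E ->
  (forall r : R, (r%:E < a)%E -> (r%:E <= b)%E) -> (a <= b)%E.
Proof.
case: b => [b||] //= _ h; last by rewrite leey.
rewrite leNgt; apply/negP => ba.
have [r br ra] : exists2 r, b < r & (r%:E < a)%E.
  case: a {h} ba => [a||] // ba; last by exists (b + 1); rewrite ?ltrDl // ltey.
  by exists ((a + b) / 2); rewrite ?lte_fin; move: ba; rewrite lte_fin; lra.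
by have := h r ra; rewrite lee_fin leNgt br.
Qed.

Section Potential.
Variables (R : realType) (n : nat) (alpha q : R).
Hypotheses (qE : q = (n%:R - alpha) / 2) (q0 : 0 < q).
Notation V := 'rV[R]_n.
Notation ker := (rker q).
Implicit Types (x y : V) (mu lam : (V -> R) -> R).

Lemma riesz_kernelE x y :
  riesz_kernel alpha x y = if x == y then +oo%E else ((dist2 x y) `^ (- q))%:E.
Proof.
rewrite /riesz_kernel; case: ifP => // _; rewrite /Defs.edist -/(dist2 x y).
rewrite -powR12_sqrt ?dist2_ge0 // -powRrM; congr ((_ `^ _)%:E).
by rewrite qE; field.
Qed.

Lemma riesz_kernelC x y : riesz_kernel alpha x y = riesz_kernel alpha y x.
Proof. by rewrite !riesz_kernelE eq_sym dist2C. Qed.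

Lemma dist2_gt0 x y : x != y -> 0 < dist2 x y.
Proof. by move=> xy; rewrite lt_def dist2_eq0 xy dist2_ge0. Qed.

Lemma ker_le_riesz s x y : 0 < s -> ((ker s x y)%:E <= riesz_kernel alpha x y)%E.
Proof.
move=> s0; rewrite riesz_kernelE; case: eqVneq => [_|xy]; first by rewrite leey.
by rewrite lee_fin; apply: powRN_le => //; rewrite ?dist2_gt0 // lerDl ltW.
Qed.

(** The regularized kernels increase to the Riesz kernel as [s] decreases to 0, on the diagonal
    because [s^(-q)] blows up, elsewhere because [s] is small relative to [dist2 x y]. *)
Lemma lt_riesz_ker (M : R) x y : (M%:E < riesz_kernel alpha x y)%E ->
  exists2 e : R, 0 < e & forall s, 0 < s <= e -> M < ker s x y.
Proof.
rewrite riesz_kernelE; case: eqVneq => [<- _|xy].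
  have [e e0 he] := powRN_large q0 (M + 1); exists e => // s /he.
  by rewrite /rker dist2xx add0r; apply: lt_le_trans; rewrite ltrDl.
rewrite lte_fin => h; have dp := dist2_gt0 xy.
have [M0|M0] := ltP M 0.
  by exists 1 => // s /andP[s0 _]; apply: lt_le_trans M0 _; exact: ker_ge0.
have [->|Mn0] := eqVneq M 0.
  by exists 1 => // s /andP[s0 _]; apply: ker_gt0.
have {Mn0}M0 : 0 < M by rewrite lt_def Mn0.
set D := dist2 x y `^ (- q) in h.
have e0 : 0 < D / M - 1 by rewrite subr_gt0 ltr_pdivlMr // mul1r.
have e20 : 0 < (D / M - 1) / 2 by rewrite divr_gt0.
have [eta eta0 he] := powR_1D_le q0 e20.
exists (eta * dist2 x y); first by rewrite mulr_gt0.
move=> s /andP[s0 hs].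
have h1 : D <= (1 + eta) `^ q * ker s x y.
  by apply: powRN_scale; rewrite ?dist2D_gt0 ?addr_gt0 // mulrDl mul1r lerD2l.
have h2 : (1 + eta) `^ q <= 1 + (D / M - 1) / 2 by apply: he; rewrite lexx ltW.
have k0 := ker_ge0 q s x y.
rewrite ltNge; apply/negP => kM.
have : D <= (1 + (D / M - 1) / 2) * M.
  apply: le_trans h1 _; apply: le_trans (ler_wpM2r k0 h2) _; apply: ler_wpM2l kM.
  by rewrite addr_ge0 // ltW.
have -> : (1 + (D / M - 1) / 2) * M = (D + M) / 2 by field; rewrite gt_eqF.
by lra.
Qed.

Definition tr (j : nat) : R := j.+1%:R^-1.

Lemma tr_gt0 j : 0 < tr j. Proof. by rewrite invr_gt0. Qed.

Lemma tr_le i j : (i <= j)%N -> tr j <= tr i.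
Proof. by move=> ij; rewrite lef_pV2 ?posrE // ler_nat. Qed.

Lemma tr_small (e : R) : 0 < e -> exists j0, forall j, (j0 <= j)%N -> tr j <= e.
Proof.
move=> e0; have [j0 h] := ltr_add_invr e0.
by exists j0 => j /tr_le; move/le_trans; apply; rewrite ltW // -[tr j0]add0r.
Qed.

Lemma nat_large (M : R) : exists j0, forall j, (j0 <= j)%N -> M <= j%:R.
Proof.
exists (Num.truncn `|M|).+1 => j hj.
have : `|M| < (Num.truncn `|M|).+1%:R by exact: truncnS_gt.
move=> /ltW h; apply: le_trans (ler_norm M) _; apply: le_trans h _.
by rewrite ler_nat.
Qed.

(** An increasing sequence with supremum the Riesz kernel. The cutoff in [y] lets a Radon functional
    be applied; the cutoff in [x] puts the resulting function back in [Cc], so that a second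
    functional can be applied. *)
Definition cker (j : nat) x y : R := cutoff j%:R x * (cutoff j%:R y * ker (tr j) x y).

Notation kk := cker.

Lemma kk_ge0 j x y : 0 <= kk j x y.
Proof. by rewrite !mulr_ge0 ?cutoff_ge0 ?ker_ge0. Qed.

Lemma kk_le_ker j x y : kk j x y <= ker (tr j) x y.
Proof.
rewrite /kk mulrA -[leRHS]mul1r; apply: ler_wpM2r; first exact: ker_ge0.
by rewrite -[leRHS]mulr1; apply: ler_pM; rewrite ?cutoff_ge0 ?cutoff_le1.
Qed.

Lemma Cc_cutker j s x : 0 < s -> Cc (fun y => cutoff j y * ker s x y).
Proof. by move=> s0; apply: Cc_mull; [exact: Cc_cutoff|exact: continuous_kerr]. Qed.

Lemma Cc_kk j x : Cc (kk j x).
Proof. by apply: Cc_scale; apply: Cc_cutker; exact: tr_gt0. Qed.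

Lemma kk_mono i j x y : (i <= j)%N -> kk i x y <= kk j x y.
Proof.
move=> ij; have ijR : i%:R <= j%:R :> R by rewrite ler_nat.
rewrite /kk; apply: ler_pM; rewrite ?mulr_ge0 ?cutoff_ge0 ?ker_ge0 ?le_cutoff //.
apply: ler_pM; rewrite ?cutoff_ge0 ?ker_ge0 ?le_cutoff //.
by apply: ker_decr; rewrite ?tr_gt0 ?tr_le.
Qed.

Lemma incr_kk x : incr (fun j => kk j x).
Proof. by split=> [j|j y|i j y ij]; [exact: Cc_kk|exact: kk_ge0|exact: kk_mono]. Qed.

Lemma esup_kk x : riesz_kernel alpha x = esup (fun j => kk j x).
Proof.
apply/funext => y; apply/eqP; rewrite eq_le; apply/andP; split; last first.
  apply: esup_le => j; apply: le_trans (ker_le_riesz x y (tr_gt0 j)).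
  by rewrite lee_fin kk_le_ker.
apply: lee_real_lt => [|r hr].
  by apply: le_trans (esup_ge _ 0%N y); rewrite lee_fin kk_ge0.
have [e e0 he] := lt_riesz_ker hr.
have [j1 hj1] := tr_small e0.
have [j2 hj2] := nat_large (dist2 0 x); have [j3 hj3] := nat_large (dist2 0 y).
pose j := maxn j1 (maxn j2 j3).
apply: le_trans (esup_ge _ j y); rewrite lee_fin /kk !cutoff1 ?mul1r ?hj2 ?hj3 ?leq_max ?leqnn ?orbT //.
by apply/ltW/he; rewrite tr_gt0 hj1 // leq_max leqnn.
Qed.

Lemma potentialE lam x : pos_radon lam ->
  potential alpha lam x = esup (fun j x => lam (kk j x)) x.
Proof.
by move=> pl; rewrite /potential esup_kk uint_esup //; exact: incr_kk.
Qed.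

Lemma harnack_poslin (P : (V -> R) -> Prop) (L : (V -> R) -> R) (c : V -> R) s :
  linclass P -> poslin P L -> 0 < s -> (forall x, P (fun y => c y * ker s x y)) -> (forall y, 0 <= c y) ->
  harnack q s (fun x => L (fun y => c y * ker s x y)).
Proof.
move=> lP pL s0 Pk c0 x x' eta e0 h; rewrite -(poslinZ pL) //.
apply: (poslin_le lP pL) => //; first by apply lP.
by move=> y; rewrite mulrCA; apply: ler_wpM2l => //; apply: harnack_ker.
Qed.

Lemma continuous_cutpot lam (b : V -> R) s : pos_radon lam -> Cc b -> (forall y, 0 <= b y) -> 0 < s ->
  continuous (fun x => lam (fun y => b y * ker s x y)).
Proof.
move=> pl cb b0 s0; have Pk x : Cc (fun y => b y * ker s x y).
  by apply: Cc_mull => //; exact: continuous_kerr.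
apply: (@harnack_continuous _ _ q q0 s) => //.
  by move=> x; apply: (poslin_ge0 pl) => // y; rewrite mulr_ge0 // ker_ge0.
exact: harnack_poslin (@linclass_Cc _ _) pl s0 Pk b0.
Qed.

Lemma pot_kkE lam j x : pos_radon lam -> 
  lam (kk j x) = cutoff j%:R x * lam (fun y => cutoff j%:R y * ker (tr j) x y).
Proof. by move=> pl; rewrite -(poslinZ pl) //; apply: Cc_cutker; exact: tr_gt0. Qed.

Lemma Cc_pot lam j : pos_radon lam -> Cc (fun x => lam (kk j x)).
Proof.
move=> pl; have -> : (fun x => lam (kk j x)) = (fun x => cutoff j%:R x * lam (fun y => cutoff j%:R y * ker (tr j) x y)).
  by apply/funext => x; rewrite pot_kkE.
apply: Cc_mull; first exact: Cc_cutoff.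
apply: continuous_cutpot => //; [exact: Cc_cutoff|move=> y; exact: cutoff_ge0|exact: tr_gt0].
Qed.

Lemma incr_pot lam : pos_radon lam -> incr (fun j x => lam (kk j x)).
Proof.
move=> pl; split=> [j|j x|i j x ij]; first exact: Cc_pot.
  by apply: (poslin_ge0 pl) => [|y]; [exact: Cc_kk|exact: kk_ge0].
by apply: (poslin_le (@linclass_Cc _ _) pl) => [||y]; [exact: Cc_kk|exact: Cc_kk|exact: kk_mono].
Qed.

Lemma potential_ge0 lam x : pos_radon lam -> (0 <= potential alpha lam x)%E.
Proof.
move=> pl; rewrite potentialE //; apply: le_trans (esup_ge _ 0%N x); rewrite lee_fin.
by case: (incr_pot pl) => _ + _; apply.
Qed.

(** On a fine partition of unity [phi] with centres [c i], the kernel is a finite sum of products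
    [phi i x * ker s (c i) y] up to a Harnack factor. Passing to the sum and back costs
    [(1 + eta) ^ q] twice, and [eta] is arbitrary. *)
Lemma fubini_ker_le lam mu (a b : V -> R) s : pos_radon lam -> pos_radon mu ->
  Cc a -> Cc b -> (forall x, 0 <= a x) -> (forall x, 0 <= b x) -> 0 < s ->
  lam (fun x => a x * mu (fun y => b y * ker s x y)) <= mu (fun y => b y * lam (fun x => a x * ker s y x)).
Proof.
move=> pl pm ca cb a0 b0 s0.
have lC := @linclass_Cc R n.
have cbk x : Cc (fun y => b y * ker s x y) by apply: Cc_mull => //; exact: continuous_kerr.
have cak x : Cc (fun y => a y * ker s x y) by apply: Cc_mull => //; exact: continuous_kerr.
have cM := continuous_cutpot pm cb b0 s0.
have cL := continuous_cutpot pl ca a0 s0.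
set A := lam _; set B := mu _.
have B0 : 0 <= B.
  apply: (poslin_ge0 pm); first by apply: Cc_mull.
  move=> y; rewrite mulr_ge0 //; apply: (poslin_ge0 pl) => // x; rewrite mulr_ge0 ?ker_ge0 //.
have [r [r0 hr]] := Cc_cutoff_eq ca.
suff key (eta : R) : 0 < eta -> A <= (1 + eta) `^ q * ((1 + eta) `^ q * B).
  apply/ler_addgt0Pl => e e0.
  (* Chosen so that [e1 <= 1] and [3 * e1 * B <= e]; then [(1 + e1)^2 * B <= B + 3 * e1 * B <= B +
     e]. *)
  have e10 : 0 < e / (3 * (B + 1) + e) by rewrite divr_gt0 // addr_gt0 // mulr_gt0 // ltr_wpDl.
  set e1 := e / _ in e10.
  have e11 : e1 <= 1 by rewrite ler_pdivrMr ?mul1r ?lerDr ?mulr_ge0 ?addr_ge0 // addr_gt0 // mulr_gt0 // ltr_wpDl.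
  have e1B : 3 * e1 * B <= e.
    rewrite /e1 mulrAC mulrA ler_pdivrMr ?addr_gt0 // ?mulr_gt0 // ?ltr_wpDl //.
    by have := e0; have := B0; nra.
  have [eta eta0 he] := powR_1D_le q0 e10.
  have h : (1 + eta) `^ q <= 1 + e1 by apply: he; rewrite lexx ltW.
  apply: le_trans (key _ eta0) _; have p0 := powR_ge0 (1 + eta) q.
  have : (1 + eta) `^ q * ((1 + eta) `^ q * B) <= (1 + e1) * ((1 + e1) * B).
    apply: ler_pM => //; first by rewrite mulr_ge0.
    exact: ler_wpM2r.
  by move=> /le_trans; apply; nra.
move=> eta0; pose d := eta * s / (1 + eta^-1).
have ei0 : 0 < 1 + eta^-1 by rewrite addr_gt0 // invr_gt0.
have d0 : 0 < d by rewrite divr_gt0 ?mulr_gt0.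
have [N [c [phi [cphi phi0 phi1 phid]]]] := partition_of_unity n (r + 1) d0.
have hphi i x : phi i x != 0 -> (1 + eta^-1) * dist2 x (c i) <= eta * s.
  move=> nz; rewrite mulrC -ler_pdivlMr // dist2C leNgt; apply: contraNN nz => /ltW /phid ->; exact: eqxx.
have phia x : a x = \sum_(i < N) (phi i x * a x).
  have [h|h] := leP (dist2 0 x) (r + 1); first by rewrite -mulr_suml phi1 // mul1r.
  have -> : a x = 0 by rewrite (hr r) // cutoff0 ?mul0r // ltW.
  by rewrite big1 // => i _; rewrite mulr0.
pose w i := lam (fun x => phi i x * a x); pose m i := mu (fun y => b y * ker s (c i) y).
have cpa i : Cc (fun x => phi i x * a x) by apply: Cc_mulr.
apply: (@le_trans _ _ ((1 + eta) `^ q * \sum_(i < N) w i * m i)).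
  have -> : (1 + eta) `^ q * \sum_(i < N) w i * m i =
      lam (fun x => \sum_(i < N) (1 + eta) `^ q * m i * (phi i x * a x)).
    rewrite (poslin_sum lC pl) ?mulr_sumr; [|exact: Cc0|by move=> i; apply: Cc_scale].
    by apply: eq_bigr => i _; rewrite (poslinZ pl) // /w; ring.
  apply: (poslin_le lC pl); first exact: Cc_mull.
    by apply: (linclass_sum lC); [exact: Cc0|move=> i; apply: Cc_scale].
  move=> x; rewrite [X in X * _]phia mulr_suml; apply: ler_sum => i _.
  rewrite [leRHS]mulrC; have [->|/hphi nz] := eqVneq (phi i x) 0; first by rewrite !mul0r.
  apply: ler_wpM2l; first by rewrite mulr_ge0.
  by apply: (harnack_poslin lC pm s0 cbk b0) => //; rewrite dist2C.
apply: ler_wpM2l; first exact: powR_ge0.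
have -> : \sum_(i < N) w i * m i = mu (fun y => \sum_(i < N) w i * (b y * ker s (c i) y)).
  rewrite (poslin_sum lC pm); [|exact: Cc0|by move=> i; apply: Cc_scale].
  by apply: eq_bigr => i _; rewrite (poslinZ pm).
rewrite -(poslinZ pm); last exact: Cc_mull.
apply: (poslin_le lC pm).
- by apply: (linclass_sum lC); [exact: Cc0|move=> i; apply: Cc_scale].
- by apply: Cc_scale; apply: Cc_mull.
move=> y; rewrite mulrCA -(poslinZ pl) //.
have -> : \sum_(i < N) w i * (b y * ker s (c i) y) = b y * lam (fun x => \sum_(i < N) ker s (c i) y * (phi i x * a x)).
  rewrite (poslin_sum lC pl); [|exact: Cc0|by move=> i; apply: Cc_scale].
  rewrite mulr_sumr; apply: eq_bigr => i _; rewrite (poslinZ pl) // /w; ring.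
apply: ler_wpM2l => //; apply: (poslin_le lC pl).
- by apply: (linclass_sum lC); [exact: Cc0|move=> i; apply: Cc_scale].
- exact: Cc_scale.
move=> x; have -> : (1 + eta) `^ q * (a x * ker s y x) = \sum_(i < N) ((1 + eta) `^ q * (phi i x * a x * ker s x y)).
  by rewrite -mulr_sumr -mulr_suml -phia kerC.
apply: ler_sum => i _; rewrite mulrC mulrCA; have [->|/hphi nz] := eqVneq (phi i x) 0; first by rewrite !mul0r.
by apply: ler_wpM2l; [rewrite mulr_ge0|exact: harnack_ker].
Qed.

Lemma fubini_kk lam mu j : pos_radon lam -> pos_radon mu ->
  lam (fun x => mu (kk j x)) = mu (fun x => lam (kk j x)).
Proof.
move=> pl pm; have H (la m : (V -> R) -> R) : pos_radon m -> (fun x => m (kk j x)) =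
    (fun x => cutoff j%:R x * m (fun y => cutoff j%:R y * ker (tr j) x y)).
  by move=> p; apply/funext => x; rewrite pot_kkE.
rewrite (H lam mu pm) (H mu lam pl); apply/eqP; rewrite eq_le.
have cc := @Cc_cutoff R n j%:R; have c0 := @cutoff_ge0 R n j%:R; have t0 := tr_gt0 j.
by apply/andP; split; [exact: (fubini_ker_le pl pm)|exact: (fubini_ker_le pm pl)].
Qed.

Lemma uint_potential lam mu : pos_radon lam -> pos_radon mu ->
  uint mu (potential alpha lam) = ereal_sup (range (fun j => (mu (fun x => lam (kk j x)))%:E)).
Proof.
move=> pl pm; rewrite -uint_esup //; last exact: incr_pot.
by congr uint; apply/funext => x; exact: (potentialE x pl).
Qed.

Lemma fubini_potential lam mu : pos_radon lam -> pos_radon mu ->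
  uint mu (potential alpha lam) = uint lam (potential alpha mu).
Proof.
move=> pl pm; rewrite !uint_potential //; congr ereal_sup; congr image.
by apply/funext => j; rewrite (fubini_kk j pm pl).
Qed.

Lemma potential_ge lam f x : pos_radon lam -> Cc f -> (forall y, 0 <= f y) ->
  (forall y, ((f y)%:E <= riesz_kernel alpha x y)%E) -> ((lam f)%:E <= potential alpha lam x)%E.
Proof. by move=> pl cf f0 h; apply: uint_ge. Qed.

Lemma pos_radon_dirac z : pos_radon (@dirac_m R n z).
Proof. by split=> // f _ f0; exact: f0. Qed.

Lemma potential_dirac z x : potential alpha (dirac_m z) x = riesz_kernel alpha x z.
Proof. by rewrite potentialE; [rewrite esup_kk|exact: pos_radon_dirac]. Qed.

Lemma potential_meq lam mu x : meq lam mu -> potential alpha lam x = potential alpha mu x.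
Proof.
move=> h; rewrite /potential /uint; congr ereal_sup; apply/seteqP; split=> _ [f [cf hf] <-];
  by exists f => //; rewrite h.
Qed.

Lemma uint_scale mu g (c : R) : 0 < c -> uint (fun f => c * mu f) g = (c%:E * uint mu g)%E.
Proof.
move=> c0; rewrite /uint -ereal_sup_pZl //; congr ereal_sup.
apply/seteqP; split=> [_ [f hf <-]|_ [_ [f hf <-] <-]]; last by exists f.
by exists (mu f)%:E => //; exists f.
Qed.

End Potential.

(** * Measures of finite energy *)

Section Density.
Variables (R : realType) (n : nat).
Notation V := 'rV[R]_n.
Implicit Types (f : V -> R) (mu rho : (V -> R) -> R).

(** Constructs the measure with density [lim w j] with respect to [L]. The class [P'] may exceed
    [P]: compactly supported weights turn a Radon functional into one on all continuous functions.
    Closure under [Num.max 0] reduces convergence to nonnegative [f]. *)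
Lemma density_lim (P P' : (V -> R) -> Prop) (L : (V -> R) -> R) (w : nat -> V -> R) :
  linclass P -> linclass P' -> poslin P L -> (forall f, P' f -> P' (fun x => Num.max 0 (f x))) ->
  (forall j x, 0 <= w j x) -> (forall f j, P' f -> P (fun x => f x * w j x)) ->
  (forall f, P' f -> (forall x, 0 <= f x) -> cvgn (fun j => L (fun x => f x * w j x))) ->
  exists L', poslin P' L' /\ forall f, P' f -> L (fun x => f x * w j x) @[j --> \oo] --> (L' f : R).
Proof.
move=> lP lP' pL Pmax w0 Pw cw.
exists (fun f => limn (fun j => L (fun x => f x * w j x))).
have cv f : P' f -> cvgn (fun j => L (fun x => f x * w j x)).
  move=> Pf; have Pf1 := Pmax f Pf.
  have Pf2 : P' (fun x => Num.max 0 (f x) - f x) by apply: linclassB.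
  have -> : (fun j => L (fun x => f x * w j x)) =
     (fun j => L (fun x => Num.max 0 (f x) * w j x) - L (fun x => (Num.max 0 (f x) - f x) * w j x)).
    apply/funext => j; rewrite -(poslinB lP pL); [congr L|exact: Pw|exact: Pw].
    by apply/funext => x; rewrite -mulrBl; congr (_ * _); ring.
  apply: is_cvgB; apply: cw => // x; first by rewrite le_max lexx.
  by rewrite subr_ge0 le_max lexx orbT.
split; last by move=> f /cv.
apply: (@poslin_lim _ _ nat \oo P' (fun j f => L (fun x => f x * w j x))) => // j.
split=> [f g Pf Pg|c f Pf|f Pf f0].
- rewrite -(poslinD pL); [|exact: Pw|exact: Pw]; congr L; apply/funext => x; ring.
- rewrite -(poslinZ pL); [|exact: Pw]; congr L; apply/funext => x; ring.
- by apply: (poslin_ge0 pL) => [|x]; [exact: Pw|rewrite mulr_ge0].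
Qed.

Lemma density_decr (P P' : (V -> R) -> Prop) (L : (V -> R) -> R) (w : nat -> V -> R) :
  linclass P -> linclass P' -> poslin P L -> (forall f, P' f -> P' (fun x => Num.max 0 (f x))) ->
  (forall j x, 0 <= w j x) -> (forall f j, P' f -> P (fun x => f x * w j x)) ->
  (forall i j x, (i <= j)%N -> w j x <= w i x) ->
  exists L', [/\ poslin P' L', forall f, P' f -> L (fun x => f x * w j x) @[j --> \oo] --> (L' f : R) &
     forall f j, P' f -> (forall x, 0 <= f x) -> L' f <= L (fun x => f x * w j x)].
Proof.
move=> lP lP' pL Pmax w0 Pw mw.
have mL f i j : P' f -> (forall x, 0 <= f x) -> (i <= j)%N ->
    L (fun x => f x * w j x) <= L (fun x => f x * w i x).
  by move=> Pf f0 ij; apply: (poslin_le lP pL) => [||x]; [exact: Pw|exact: Pw|apply: ler_wpM2l => //; exact: mw].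
have [|L' [pL' hL']] := density_lim lP lP' pL Pmax w0 Pw.
  move=> f Pf f0; apply: nonincreasing_is_cvgn; first by move=> i j ij; exact: mL.
  by exists 0 => _ [j _ <-]; apply: (poslin_ge0 pL) => [|x]; [exact: Pw|rewrite mulr_ge0].
exists L'; split=> // f j Pf f0; apply: (cvgr_to_le (hL' f Pf)).
by exists j => // i /= ji; exact: mL.
Qed.

Lemma pos_radon_scale (c : R) mu : 0 <= c -> pos_radon mu -> pos_radon (fun f => c * mu f).
Proof.
move=> c0 [a s p]; split=> [f g cf cg|d f cf|f cf f0]; first by rewrite a // mulrDr.
  by rewrite s // mulrCA.
by rewrite mulr_ge0 // p.
Qed.

Lemma uint_ge0 mu (g : V -> \bar R) : pos_radon mu -> (forall x, (0 <= g x)%E) -> (0 <= uint mu g)%E.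
Proof.
move=> pm g0; have c0 := @Cc0 R n; apply: (@le_trans _ _ (mu (fun=> 0))%:E); last exact: uint_ge.
by rewrite lee_fin; apply: (poslin_ge0 pm).
Qed.

Lemma uint_le_scale mu rho (M : R) (g : V -> \bar R) : 0 < M ->
  (forall f, Cc f -> (forall x, 0 <= f x) -> rho f <= M * mu f) -> (uint rho g <= M%:E * uint mu g)%E.
Proof.
move=> M0 h; rewrite -uint_scale //; apply: uint_le => f cf f0 fg.
by apply: le_trans (uint_ge _ cf f0 fg); rewrite lee_fin h.
Qed.

Lemma concentrated_intro rho (E : set V) : pos_radon rho ->
  (forall e : R, 0 < e -> exists U, [/\ open U, ~` E `<=` U &
     forall f, Cc f -> (forall x, 0 <= f x <= 1) -> (forall x, ~ U x -> f x = 0) -> rho f <= e]) ->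
  concentrated rho E.
Proof.
move=> pr h; apply/eqP; rewrite eq_le; apply/andP; split; last first.
  apply: le_ereal_inf_tmp => _ [U _ <-]; apply: uint_ge0 => // x.
  by case: asboolP.
apply/lee_addgt0Pr => e /h[U [oU EU hU]]; rewrite add0e.
apply: (@le_trans _ _ (uint rho (fun x => if `[< U x >] then 1%E else 0%E))).
  by apply: ereal_inf_lbound; exists U.
apply: uint_le => f cf f0 fU; rewrite lee_fin; apply: hU => // x.
  rewrite f0 /=; have := fU x; case: asboolP => _; rewrite lee_fin //.
  by move=> /le_trans; apply.
move=> Ux; have := fU x; case: asboolP => // _; rewrite lee_fin => fx.
by apply/eqP; rewrite eq_le fx f0.
Qed.

Lemma concentrated_scale mu rho (M : R) E : pos_radon rho -> 0 < M ->
  (forall f, Cc f -> (forall x, 0 <= f x) -> rho f <= M * mu f) -> concentrated mu E -> concentrated rho E.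
Proof.
move=> pr M0 h cE; apply: concentrated_intro => // e e0.
have [U [oU EU hU]] := concentrated_open cE (divr_gt0 e0 M0).
exists U; split=> // f cf f01 fU; apply: le_trans (h f cf _) _.
  by move=> x; case/andP: (f01 x).
by rewrite mulrC -ler_pdivlMr // hU.
Qed.

Lemma inner_cap0_absurd alpha rho (E : set V) : inner_cap alpha E = 0%E -> pos_radon rho ->
  concentrated rho E -> (energy alpha rho < +oo)%E -> total_mass rho = 1%E -> False.
Proof.
move=> c0 pr cE er mr.
have : (inv_inner_cap alpha E <= energy alpha rho)%E by apply: ereal_inf_lbound; exists rho.
move: c0; rewrite /inner_cap; case: inv_inner_cap => [r| |] //; last first.
  by move=> _; rewrite leye_eq => /eqP e; rewrite e ltxx in er.
by case: eqVneq => // r0 [] /eqP; rewrite invr_eq0 (negbTE r0).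
Qed.

Lemma inner_cap_neq0 alpha (E : set V) : inner_cap alpha E <> 0%E ->
  exists mu, [/\ pos_radon mu, concentrated mu E, (energy alpha mu < +oo)%E & total_mass mu = 1%E].
Proof.
rewrite /inner_cap => h; have : (inv_inner_cap alpha E < +oo)%E.
  by rewrite ltey; apply/eqP => e; apply: h; rewrite e.
by move=> /ereal_inf_lt[_ [mu [pm [cm [em mm]]] <-] _]; exists mu.
Qed.

End Density.

(** * Integrating inequalities that hold nearly everywhere *)

Section NearlyEverywhere.
Variables (R : realType) (n : nat) (alpha q : R).
Hypotheses (qE : q = (n%:R - alpha) / 2) (q0 : 0 < q).
Notation V := 'rV[R]_n.
Notation kk := (cker q).
Implicit Types (x y z : V) (mu lam rho : (V -> R) -> R) (f : V -> R).

Lemma le_potential_scale mu rho (M : R) x : 0 < M ->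
  (forall f, Cc f -> (forall x, 0 <= f x) -> rho f <= M * mu f) ->
  (potential alpha rho x <= M%:E * potential alpha mu x)%E.
Proof. by move=> M0 h; exact: uint_le_scale. Qed.

Lemma uint_scaler mu (g : V -> \bar R) (c : R) : pos_radon mu -> 0 < c ->
  uint mu (fun x => c%:E * g x)%E = (c%:E * uint mu g)%E.
Proof.
move=> pm c0; apply/eqP; rewrite eq_le; apply/andP; split.
  apply: uint_le => f cf f0 fg.
  have -> : mu f = c * mu (fun x => c^-1 * f x).
    rewrite (poslinZ pm) // mulrA divff ?mul1r //; exact: lt0r_neq0.
  rewrite EFinM; apply: lee_wpmul2l; first by rewrite lee_fin ltW.
  apply: uint_ge; first exact: Cc_scale.
    by move=> x; rewrite mulr_ge0 // invr_ge0 ltW.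
  by move=> x; rewrite EFinM lee_pdivrMl.
rewrite -uint_scale //; apply: uint_le => f cf f0 fg.
rewrite -(poslinZ pm) //; apply: uint_ge; first exact: Cc_scale.
  by move=> x; rewrite mulr_ge0 // ltW.
by move=> x; rewrite EFinM; apply: lee_wpmul2l => //; rewrite lee_fin ltW.
Qed.

Lemma energy_scale mu rho (M : R) : pos_radon rho -> 0 < M ->
  (forall f, Cc f -> (forall x, 0 <= f x) -> rho f <= M * mu f) ->
  (energy alpha mu < +oo)%E -> (energy alpha rho < +oo)%E.
Proof.
move=> pr M0 h em; apply: (@le_lt_trans _ _ (M%:E * (M%:E * energy alpha mu))%E); last first.
  by rewrite !lte_mul_pinfty // ?lee_fin ?(ltW M0).
rewrite /energy; apply: (@le_trans _ _ (uint rho (fun x => M%:E * potential alpha mu x)%E)).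
  by apply: le_uint => x; exact: le_potential_scale.
rewrite uint_scaler //; apply: lee_wpmul2l; first by rewrite lee_fin ltW.
exact: uint_le_scale.
Qed.

(** A measure of finite energy does not charge the exceptional set. With [w j] the positive part of
    [f - h j], suppose [mu (w j)] stays above some [e > 0]. Then [mu] with density [lim w j] is a
    nonzero measure; its density is bounded, so its energy is finite, and it lives where [f] exceeds
    the potential of [lam], hence on [E]. This contradicts the zero capacity of [E]. *)
Lemma ne_potential_le mu lam A z : pos_radon mu -> pos_radon lam -> (energy alpha mu < +oo)%E ->
  concentrated mu A ->
  ne_on alpha A (fun y => (potential alpha (dirac_m z) y <= potential alpha lam y)%E) ->
  (potential alpha mu z <= uint mu (potential alpha lam))%E.
Proof.
move=> pm pl em cA [E [EA [E0 hE]]].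
have lC := @linclass_Cc R n.
apply: uint_le => f cf f0 fz; pose h j x := lam (kk j x).
have ih : incr h := incr_pot q0 pl.
have [ch h0 mh] := ih.
pose w j x := Num.max 0 (f x - h j x).
have cw j : Cc (w j) by apply: Cc_max_sub cf _ (h0 j); case: (ch j).
have w0 j x : 0 <= w j x by rewrite le_max lexx.
have mw i j x : (i <= j)%N -> w j x <= w i x.
  move=> ij; have := mh i j x ij; rewrite /w ge_max !le_max lexx /= => ?.
  by apply/orP; right; lra.
have [M [M0 hM]] := Cc_bounded cf.
have wM j x : w j x <= M.
  rewrite ge_max (ltW M0) /=; have := hM x; have := h0 j x; rewrite ler_norml => ? /andP[_ ?].
  by lra.
have [_ [r hr]] := (CcP f).1 cf.
pose chi := @cutoff R n r.
have wchi j x : w j x = chi x * w j x.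
  have [xr|xr] := leP (dist2 0 x) r; first by rewrite /chi cutoff1 // mul1r.
  by rewrite /w hr // max_l ?mulr0 // sub0r oppr_le0.
have cchi : Cc chi := Cc_cutoff _ _.
have chi0 x : 0 <= chi x := cutoff_ge0 _ _.
have mu0 g : Cc g -> (forall x, 0 <= g x) -> 0 <= mu g by exact: (poslin_ge0 pm).
have small (e : R) : 0 < e -> exists j, mu (w j) <= e.
  move=> e0; apply: contrapT => /forallNP ne.
  have Pmax g : Cc g -> Cc (fun x => Num.max 0 (g x)) by exact: Cc_max0.
  have Pw g j : Cc g -> Cc (fun x => g x * w j x) by move=> cg; apply: Cc_mull => //; case: (cw j).
  have [rho [pr hrho lerho]] := density_decr lC lC pm Pmax w0 Pw mw.
  pose m := rho chi.
  have me : e <= m.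
    apply: (cvgr_to_ge (hrho _ cchi)); exists 0%N => // j _ /=.
    have -> : (fun x => chi x * w j x) = w j by apply/funext => x; rewrite -wchi.
    by apply/ltW; rewrite ltNge; apply/negP; exact: ne.
  have m0 : 0 < m := lt_le_trans e0 me.
  have rhoM g : Cc g -> (forall x, 0 <= g x) -> rho g <= M * mu g.
    move=> cg g0; apply: le_trans (lerho g 0%N cg g0) _; rewrite -(poslinZ pm) //.
    by apply: (poslin_le lC pm) => [||x]; [exact: Pw|exact: Cc_scale|rewrite mulrC; apply: ler_wpM2r].
  pose rho1 g := m^-1 * rho g.
  have mi0 : 0 <= m^-1 by rewrite invr_ge0 ltW.
  have pr1 : pos_radon rho1 by exact: pos_radon_scale.
  have mM0 : 0 < m^-1 * M by rewrite mulr_gt0 // invr_gt0.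
  have rho1M g : Cc g -> (forall x, 0 <= g x) -> rho1 g <= m^-1 * M * mu g.
    by move=> cg g0; rewrite /rho1 -mulrA; apply: ler_wpM2l => //; exact: rhoM.
  apply: (inner_cap0_absurd E0 pr1).
  - apply: concentrated_intro => // d d0.
    (* [M'] collects the factors of [e1] in the estimate [key] below, divided by the mass [m], with
       some slack; [e1 = d / M'] then bounds the total by [d]. *)
    have [M' M'E] : exists M', M' = m^-1 * (M + 2 * mu chi + mu (w 0%N)) + 1 by eexists.
    have M'0 : 0 < M'.
      rewrite M'E ltr_wpDl // mulr_ge0 // !addr_ge0 ?mulr_ge0 ?mu0 ?(ltW M0) //; exact: cw.
    pose e1 := d / M'; have e10 : 0 < e1 by rewrite divr_gt0.
    have [U1 [oU1 AU1 hU1]] := concentrated_open cA e10.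
    pose U := U1 `|` \bigcup_j [set x | f x < h j x + e1]; exists U; split.
    + apply: openU => //; apply: bigcup_open => j _; apply: open_ltf; first by case: cf.
      by apply: continuous_add; [case: (ch j)|exact: continuous_cst].
    + move=> x Ex; have [Ax|Ax] := pselect (A x); last by left; exact: AU1.
      right; have := hE x Ax Ex; rewrite (potential_dirac qE q0) (riesz_kernelC qE) => H.
      have := le_trans (fz x) H; rewrite (potentialE qE q0) // => H1.
      have [|j hj] := @esup_gt _ _ h x (f x - e1).
        by apply: lt_le_trans H1; rewrite lte_fin ltrBlDr ltrDl.
      by exists j => //=; lra.
    move=> phi cphi phi01 phiU.
    have phi0 x : 0 <= phi x by case/andP: (phi01 x).
    have phi1 x : phi x <= 1 by case/andP: (phi01 x).
    (* [phi] vanishes off [U], so points with [e1 <= phi] lie in [U]; off [U1] they are reached by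
       some [[set x | f x < h j x + e1]], and by compactness one [j] serves all of [K]. *)
    pose K := [set x | dist2 0 x <= r] `&` ([set x | e1 <= phi x] `&` ~` U1).
    have cK : compact K.
      apply: compact_closedI; first exact: compact_dist2.
      apply: closedI; last exact: open_closedC.
      by apply: closed_lef; [exact: continuous_cst|case: cphi].
    have [|i j ij x /=|x [_ [/= ephi nU1]]|j /(_ j (leqnn j)) hj] :=
        compact_nondecreasing (G := fun j => [set x | f x < h j x + e1]) cK.
    - move=> j; apply: open_ltf; first by case: cf.
      by apply: continuous_add; [case: (ch j)|exact: continuous_cst].
    - by move=> /lt_le_trans; apply; rewrite lerD2r mh.
    - have [[//|[j _ hj]]|nU] := pselect (U x); first by exists j.
      by move: ephi; rewrite phiU // leNgt e10.
    pose W' x := Num.max 0 (f x - (h j x + e1)).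
    have he1 x : 0 <= h j x + e1 by rewrite addr_ge0 // ltW.
    have cW' : Cc W'.
      apply: Cc_max_sub => //; apply: continuous_add; [by case: (ch j)|exact: continuous_cst].
    pose P' x := Num.max 0 (phi x - e1).
    have cP' : Cc P' by apply: Cc_max_sub => //; [exact: continuous_cst|move=> ?; exact: ltW].
    have P'0 x : 0 <= P' x by rewrite le_max lexx.
    have P'1 x : P' x <= 1 by rewrite ge_max ler01 /=; have := phi1 x; have := e10; lra.
    have W'0 x : 0 <= W' x by rewrite le_max lexx.
    have W'M x : W' x <= M.
      rewrite ge_max (ltW M0) /=; have := hM x; have := he1 x; rewrite ler_norml => ? /andP[_ ?].
      by lra.
    (* Lowering both factors of [phi * w j] by [e1] gives a function that vanishes off [U1], hence
       has small integral; the loss is bounded by multiples of [e1]. *)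
    pose zeta x := P' x * W' x.
    have cz : Cc zeta by apply: Cc_mull => //; case: cW'.
    have mz : mu zeta <= M * e1.
      have : mu (fun x => M^-1 * zeta x) <= e1.
        apply: hU1; first exact: Cc_scale.
          move=> x; rewrite mulr_ge0 ?invr_ge0 ?(ltW M0) ?mulr_ge0 //=.
          rewrite ler_pdivrMl // mulr1 /zeta -[leRHS]mul1r; exact: ler_pM.
        move=> x nU1; rewrite /zeta; have [xr|xr] := leP (dist2 0 x) r; last first.
          by rewrite /W' hr // (@max_l _ _ 0 (0 - _)) ?mulr0 // sub0r oppr_le0.
        have [pe|pe] := leP e1 (phi x); last by rewrite /P' max_l ?mul0r ?mulr0 // subr_le0 ltW.
        have : f x < h j x + e1 by apply: hj.
        by move=> H; rewrite /W' (@max_l _ _ 0 (f x - _)) ?mulr0 // subr_le0 ltW.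
      by rewrite (poslinZ pm) // ler_pdivrMl.
    have key : mu (fun x => phi x * w j x) <= M * e1 + (e1 * mu chi + e1 * mu (w 0%N)).
      apply: (@le_trans _ _ (mu (fun x => zeta x + (e1 * chi x + e1 * w 0%N x)))).
        apply: (poslin_le lC pm) => [||x].
        - exact: Pw.
        - by apply: Cc_add => //; apply: Cc_add; exact: Cc_scale.
        have wj0 : w j x <= w 0%N x by exact: mw.
        have h1 : phi x <= P' x + e1 by rewrite -lerBlDr le_max lexx orbT.
        have h2 : phi x * w j x <= P' x * w j x + e1 * w 0%N x.
          apply: (@le_trans _ _ ((P' x + e1) * w j x)); first exact: ler_wpM2r.
          by rewrite mulrDl lerD2l; apply: ler_wpM2l => //; exact: ltW.
        have h3 : P' x * w j x <= zeta x + e1 * chi x.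
          have [xr|xr] := leP (dist2 0 x) r; last first.
            rewrite wchi /w hr // (@max_l _ _ 0 (0 - _)) ?sub0r ?oppr_le0 // !mulr0.
            by rewrite addr_ge0 // mulr_ge0 // ltW.
          rewrite /chi cutoff1 // mulr1.
          have h4 : w j x <= W' x + e1.
            rewrite {1}/w ge_max addr_ge0 ?(ltW e10) //=.
            have : f x - (h j x + e1) <= W' x by rewrite le_max lexx orbT.
            by lra.
          apply: (@le_trans _ _ (P' x * (W' x + e1))); first exact: ler_wpM2l.
          rewrite mulrDr lerD2l -[leRHS]mul1r; apply: ler_wpM2r => //; exact: ltW.
        by lra.
      rewrite (poslinD pm) //; last by apply: Cc_add; exact: Cc_scale.
      rewrite (poslinD pm); [|exact: Cc_scale|exact: Cc_scale].
      by rewrite !(poslinZ pm) // lerD2r.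
    rewrite /rho1; apply: (@le_trans _ _ (m^-1 * (M * e1 + (e1 * mu chi + e1 * mu (w 0%N))))).
      by apply: ler_wpM2l => //; apply: le_trans key; exact: lerho.
    have chim := mu0 _ cchi chi0.
    have -> : d = e1 * M' by rewrite /e1 divfK // lt0r_neq0.
    rewrite M'E; set k := m^-1 in mi0 *; set a := mu chi in chim *; set b := mu (w 0%N).
    have := mulr_ge0 (mulr_ge0 (ltW e10) mi0) chim; have := ltW e10.
    by move=> *; nra.
  - exact: energy_scale mM0 rho1M em.
  - apply/eqP; rewrite eq_le; apply/andP; split.
      apply: uint_le => g cg g0 g1; rewrite lee_fin /rho1 ler_pdivrMl // mulr1.
      apply: (cvgr_to_ge (hrho _ cchi)); exists 0%N => // j _ /=.
      apply: le_trans (lerho g j cg g0) _; apply: (poslin_le lC pm) => [||x]; [exact: Pw|exact: Pw|].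
      rewrite -wchi -[leRHS]mul1r; apply: ler_wpM2r => //.
      by have := g1 x; rewrite lee_fin.
    have -> : 1%E = (rho1 chi)%:E by rewrite /rho1 mulVf // lt0r_neq0.
    apply: uint_ge => // x; rewrite lee_fin; exact: cutoff_le1.
have hj j : ((mu (h j))%:E <= uint mu (potential alpha lam))%E.
  apply: uint_ge => // x.
  by rewrite (potentialE qE q0) //; exact: (@esup_ge _ _ h).
apply/lee_addgt0Pr => e /small[j hw].
apply: (@le_trans _ _ ((mu (h j))%:E + e%:E)%E); last exact: leeD2r.
rewrite -EFinD lee_fin; apply: (@le_trans _ _ (mu (fun x => h j x + w j x))).
  apply: (poslin_le lC pm) => //; first exact: Cc_add.
  by move=> x; rewrite -lerBlDl le_max lexx orbT.
by rewrite (poslinD pm) // lerD2l.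
Qed.

End NearlyEverywhere.

(** * Parts of a measure of finite energy with continuous potential *)

Section Continuity.
Variables (R : realType) (n : nat) (alpha q : R).
Hypotheses (qE : q = (n%:R - alpha) / 2) (q0 : 0 < q).
Notation V := 'rV[R]_n.
Notation ker := (rker q).
Implicit Types (x y z : V) (mu lam rho : (V -> R) -> R) (f : V -> R).

(** Convexity of the power, obtained without derivatives from the monotonicity of
    [(t1 + r) / (t2 + r)] in [r]. *)
Lemma powRN_diff_decr (t1 t2 s t : R) : 0 <= t1 -> t1 <= t2 -> 0 < s -> s <= t ->
  (t2 + s) `^ (- q) - (t2 + t) `^ (- q) <= (t1 + s) `^ (- q) - (t1 + t) `^ (- q).
Proof.
move=> t10 t12 s0 st; have t0 := lt_le_trans s0 st.
pose a := t1 + s; pose a' := t2 + s; pose b := t1 + t; pose b' := t2 + t.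
have a0 : 0 < a by rewrite ltr_wpDl.
have a'0 : 0 < a' by rewrite ltr_wpDl // (le_trans t10).
have b0 : 0 < b by rewrite ltr_wpDl.
have b'0 : 0 < b' by rewrite ltr_wpDl // (le_trans t10).
have E (u v : R) : 0 < u -> 0 < v -> v `^ (- q) = u `^ (- q) * (u / v) `^ q.
  move=> u0 v0; rewrite powRM ?invr_ge0 ?(ltW u0) ?(ltW v0) //.
  rewrite mulrA [u `^ (- q)]powRN mulVf ?mul1r; last by rewrite gt_eqF // powR_gt0.
  by rewrite -[v^-1]powR_inv1 ?(ltW v0) // -powRrM mulN1r.
have ab : a / a' <= b / b'.
  by rewrite ler_pdivrMr // mulrAC ler_pdivlMr // /a /a' /b /b'; nra.
have abq : (a / a') `^ q <= (b / b') `^ q.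
  by apply: ge0_ler_powR; rewrite ?nnegrE ?divr_ge0 ?(ltW q0) ?(ltW a0) ?(ltW a'0) ?(ltW b0) ?(ltW b'0).
have bb1 : (b / b') `^ q <= 1.
  rewrite -[leRHS](@powRr0 _ (b / b')) ; apply: ger_powR; last exact: ltW.
  by rewrite divr_gt0 //= ler_pdivrMr // mul1r /b /b' lerD2r.
have bab : b `^ (- q) <= a `^ (- q) by apply: powRN_le => //; rewrite /a /b lerD2l.
rewrite -/a -/a' -/b -/b' (E _ _ a0 a'0) (E _ _ b0 b'0).
have := powR_ge0 a (- q); have := powR_ge0 b (- q); move: bab abq bb1.
set A := a `^ _; set B := b `^ _; set X := (a / a') `^ _; set Y := (b / b') `^ _.
by move=> h1 h2 h3 h4 h5; nra.
Qed.

(** The continuity principle for potentials: with [c] a point of the support nearest to [x], every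
    [y] in the support satisfies [|c - y| <= 2 |x - y|], so uniform control on the support extends
    to the whole space with the factor [4 ^ q]. *)
Lemma ker_diff_closest (s t : R) x c y : dist2 x c <= dist2 x y -> 0 < s -> s <= t ->
  ker s x y - ker t x y <= 4 `^ q * (ker (4 * s) c y - ker (4 * t) c y).
Proof.
move=> h s0 st; have t0 := lt_le_trans s0 st.
have cy : dist2 c y / 4 <= dist2 x y.
  rewrite ler_pdivrMr //; apply: le_trans (dist2_split2 x c y) _.
  by rewrite (dist2C c x); lra.
have E (r : R) : 0 < r -> 4 `^ q * ker (4 * r) c y = (dist2 c y / 4 + r) `^ (- q).
  move=> r0; have -> : dist2 c y / 4 + r = 4^-1 * (dist2 c y + 4 * r) by field.
  rewrite powRM ?invr_ge0 ?addr_ge0 ?dist2_ge0 ?mulr_ge0 ?(ltW r0) //; congr (_ * _).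
  by rewrite -[4^-1]powR_inv1 // -powRrM mulN1r opprK.
rewrite mulrBr !E //; apply: powRN_diff_decr => //.
by rewrite divr_ge0 // dist2_ge0.
Qed.

(** The regularized potentials increase as [s] decreases, so this says that they converge uniformly,
    which makes the potential of [theta] finite and continuous. *)
Definition uniform_tail (theta : (V -> R) -> R) := forall e : R, 0 < e ->
  exists2 s0 : R, 0 < s0 & forall (s : R) x, 0 < s -> s <= s0 -> theta (ker s x) <= theta (ker s0 x) + e.

Lemma Cont_ker s x : 0 < s -> Cont (ker s x).
Proof. exact: continuous_kerr. Qed.

Lemma sum_half M : \sum_(m < M) (2^-1 : R) ^+ m <= 2.
Proof.
have -> : \sum_(m < M) (2^-1 : R) ^+ m = 2 - 2 * (2^-1) ^+ M.
  elim: M => [|M IH]; first by rewrite big_ord0 expr0; ring.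
  by rewrite big_ord_recr /= IH exprS; field.
by rewrite gerBl mulr_ge0 // exprn_ge0 // invr_ge0.
Qed.

(** A Lusin-Egorov argument. The regularized potentials [u j] converge in mean since the energies
    [a j] are bounded; a weighted sum [g] of the increments is integrable, and restricting to the
    compact set [S] where it stays below [T] makes the convergence uniform on [S]. Then
    [ker_diff_closest] makes it uniform everywhere. *)
Lemma continuous_energy_part mu phi : pos_radon mu -> (energy alpha mu < +oo)%E -> Cc phi ->
  (forall x, 0 <= phi x <= 1) -> 0 < mu phi ->
  exists theta, [/\ poslin (@Cont R n) theta, 
    forall f, Cont f -> (forall x, 0 <= f x) -> theta f <= mu (fun x => f x * phi x),
    0 < theta (fun=> 1) & uniform_tail theta].
Proof.
move=> pm em cphi phi01 mphi.
have lC := @linclass_Cc R n; have lK := @linclass_Cont R n.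
have phi0 x : 0 <= phi x by case/andP: (phi01 x).
have phi1 x : phi x <= 1 by case/andP: (phi01 x).
pose u j x := mu (fun y => phi y * ker (tr R j) x y).
have cu j : continuous (u j) by apply: (continuous_cutpot q0) => //; exact: tr_gt0.
have cphik j x : Cc (fun y => phi y * ker (tr R j) x y).
  by apply: Cc_mull => //; apply: continuous_kerr => //; exact: tr_gt0.
have u0 j x : 0 <= u j x by apply: (poslin_ge0 pm) => // y; rewrite mulr_ge0 // ker_ge0.
have mu_u i j x : (i <= j)%N -> u i x <= u j x.
  move=> ij; apply: (poslin_le lC pm) => // y; apply: ler_wpM2l => //.
  by apply: ker_decr => //; [exact: tr_gt0|exact: tr_le].
pose a j := mu (fun x => phi x * u j x).
have cphiu j : Cc (fun x => phi x * u j x) by apply: Cc_mull.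
have [C hC] : exists C : R, forall j, a j <= C.
  have e0 : (0 <= energy alpha mu)%E by apply: uint_ge0 => // x; exact: (potential_ge0 qE q0).
  exists (fine (energy alpha mu)) => j; rewrite -lee_fin fineK; last by rewrite ge0_fin_numE.
  apply: uint_ge => // [x|x]; first by rewrite mulr_ge0.
  apply: (@le_trans _ _ (u j x)%:E); first by rewrite lee_fin -[leRHS]mul1r; apply: ler_wpM2r.
  apply: potential_ge => // y; first by rewrite mulr_ge0 // ker_ge0.
  apply: le_trans (ker_le_riesz qE q0 x y (tr_gt0 R j)).
  by rewrite lee_fin -[leRHS]mul1r; apply: ler_wpM2r => //; exact: ker_ge0.
have hs : has_sup (range a) by split; [exists (a 0%N), 0%N|exists C => _ [j _ <-]].
pose s := sup (range a).
have as_ j : a j <= s by apply: sup_upper_bound => //; exists j.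
(* The rate [4^-m] beats the weights [2^m] in [g], so the integrals of [g M] are bounded by
   [sum 2^-m <= 2]. *)
have /choice[J hJ] : forall m, exists j, s - a j <= (4^-1) ^+ m.
  move=> m; have e0 : 0 < (4^-1 : R) ^+ m by rewrite exprn_gt0 // invr_gt0.
  have [_ [j _ <-] h] := sup_adherent e0 hs.
  by exists j; rewrite -/s in h; lra.
pose d m M x := Num.max 0 (u M x - u (J m) x).
pose g M x := \sum_(m < M) 2 ^+ m * d m M x.
have d0 m M x : 0 <= d m M x by rewrite le_max lexx.
have p2 m : 0 <= (2 : R) ^+ m by rewrite exprn_ge0.
have cd m M : continuous (d m M).
  by apply: continuous_maxr; [exact: continuous_cst|exact: continuous_sub].
have cg M : continuous (g M).
  by apply: continuous_sum => m; apply: continuous_scale.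
have g0 M x : 0 <= g M x by apply: sumr_ge0 => m _; rewrite mulr_ge0.
have gS M x : g M x <= g M.+1 x.
  rewrite /g big_ord_recr /= -[leLHS]addr0; apply: lerD; last by rewrite mulr_ge0.
  apply: ler_sum => m _; apply: ler_wpM2l => //.
  have := mu_u M M.+1 x (leqnSn M); rewrite /d ge_max !le_max lexx /= => ?.
  by apply/orP; right; lra.
have gm i j x : (i <= j)%N -> g i x <= g j x.
  by elim: j => [|j IH]; [rewrite leqn0 => /eqP->|rewrite leq_eqVlt => /predU1P[->//|/IH]; move=> /le_trans; apply].
have mg M : mu (fun x => phi x * g M x) <= 2.
  have -> : (fun x => phi x * g M x) = (fun x => \sum_(m < M) 2 ^+ m * (phi x * d m M x)).
    by apply/funext => x; rewrite mulr_sumr; apply: eq_bigr => m _; rewrite mulrCA.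
  have cpd m : Cc (fun x => phi x * d m M x) by apply: Cc_mull.
  rewrite (poslin_sum lC pm); [|exact: Cc0|by move=> m; apply: Cc_scale].
  apply: le_trans (sum_half M); apply: ler_sum => m _; rewrite (poslinZ pm) //.
  have -> : (2^-1 : R) ^+ m = 2 ^+ m * (4^-1) ^+ m.
    by rewrite -exprMn; congr (_ ^+ _); field.
  apply: ler_wpM2l => //; have [JM|MJ] := leqP (J m) M.
    have -> : (fun x => phi x * d m M x) = (fun x => phi x * u M x - phi x * u (J m) x).
      by apply/funext => x; rewrite -mulrBr /d max_r // subr_ge0 mu_u.
    rewrite (poslinB lC pm) //; have := hJ m; have := as_ M; rewrite /a; lra.
  have -> : (fun x => phi x * d m M x) = (fun x => 0 * phi x).
    by apply/funext => x; rewrite mul0r /d max_l ?mulr0 // subr_le0 mu_u // ltnW.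
  by rewrite (poslinZ pm) // mul0r exprn_ge0 // invr_ge0.
(* Chebyshev with the bound 2 on the integrals: the weights [w M] remove at most
   [2 / T = mu phi / 2], so half of the mass is left. *)
pose T := 4 / mu phi; have T0 : 0 < T by rewrite divr_gt0.
pose w M x := Num.max 0 (1 - g M x / T).
have w0 M x : 0 <= w M x by rewrite le_max lexx.
have w1 M x : w M x <= 1 by rewrite ge_max ler01 /= gerBl divr_ge0 // ltW.
have cw M : continuous (w M).
  apply: continuous_maxr; first exact: continuous_cst.
  apply: continuous_sub; first exact: continuous_cst.
  by apply: continuous_mul => //; exact: continuous_cst.
have Pw f j : Cont f -> Cc (fun x => f x * (phi x * w j x)).
  by move=> cf; apply: Cc_mulr => //; apply: Cc_mull.
have [|||theta [pt htheta letheta]] := density_decr (w := fun j x => phi x * w j x) lC lK pm _ _ Pw.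
- by move=> f cf; apply: continuous_maxr => //; exact: continuous_cst.
- by move=> j x; rewrite mulr_ge0.
- move=> i j x ij; apply: ler_wpM2l => //; rewrite /w ge_max !le_max lexx /=; apply/orP; right.
  by rewrite lerD2l lerN2 ler_pM2r ?invr_gt0 // gm.
have th f : Cont f -> (forall x, 0 <= f x) -> theta f <= mu (fun x => f x * phi x).
  move=> cf f0; apply: le_trans (letheta f 0%N cf f0) _.
  apply: (poslin_le lC pm) => [||x]; [exact: Pw|exact: Cc_mulr|].
  by apply: ler_wpM2l => //; rewrite -[leRHS]mulr1; apply: ler_wpM2l.
have c1 : Cont (fun _ : V => 1 : R) by exact: continuous_cst.
have theta1 : 0 < theta (fun=> 1).
  apply: (@lt_le_trans _ _ (mu phi / 2)); first by rewrite divr_gt0.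
  apply: (cvgr_to_ge (htheta _ c1)); exists 0%N => // M _ /=.
  apply: (@le_trans _ _ (mu (fun x => phi x - T^-1 * (phi x * g M x)))).
    rewrite (poslinB lC pm) //; last by apply: Cc_scale; apply: Cc_mull.
    rewrite (poslinZ pm); last by apply: Cc_mull.
    have : T^-1 * mu (fun x => phi x * g M x) <= T^-1 * 2 by rewrite ler_pM2l ?invr_gt0.
    have -> : T^-1 * 2 = mu phi / 2 by rewrite /T; field; exact: lt0r_neq0.
    by lra.
  apply: (poslin_le lC pm) => [||x]; [|exact: Pw|].
    by apply: Cc_sub => //; apply: Cc_scale; apply: Cc_mull.
  rewrite mul1r; have : phi x * (1 - g M x / T) <= phi x * w M x.
    by apply: ler_wpM2l => //; rewrite le_max lexx orbT.
  by apply: le_trans; rewrite mulrBr mulr1 lerD2l lerN2 le_eqVlt; apply/orP; left; apply/eqP; ring.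
have [_ [r hr]] := (CcP phi).1 cphi.
pose S := [set x | dist2 0 x <= r] `&` [set x | forall M, g M x <= T].
have cS : compact S.
  apply: compact_closedI; first exact: compact_dist2.
  have -> : [set x | forall M, g M x <= T] = \bigcap_M [set x | g M x <= T].
    by apply/seteqP; split=> x /= h M; [move=> _|]; exact: h.
  by apply: closed_bigI => M _; apply: closed_lef => //; exact: continuous_cst.
have onS f h : Cont f -> Cont h -> (forall x, S x -> f x <= h x) -> theta f <= theta h.
  move=> cf ch fh; pose k x := Num.max 0 (f x - h x).
  have ck : Cont k by apply: continuous_maxr; [exact: continuous_cst|exact: continuous_sub].
  have k0 x : 0 <= k x by rewrite le_max lexx.
  suff tk : theta k <= 0.
    have : theta f <= theta (fun x => h x + k x).
      apply: (poslin_le lK pt) => [||x] //; first exact: continuous_add.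
      by rewrite -lerBlDl le_max lexx orbT.
    by rewrite (poslinD pt) //; lra.
  apply/ler_addgt0Pr => e e0; rewrite add0r.
  pose e1 := e / mu phi; have e10 : 0 < e1 by rewrite divr_gt0.
  have cK : compact ([set x | dist2 0 x <= r] `&` [set x | e1 <= f x - h x]).
    apply: compact_closedI; first exact: compact_dist2.
    by apply: closed_lef; [exact: continuous_cst|exact: continuous_sub].
  have [|i j ij x /=|x [/= xr xe]|j /(_ j (leqnn j)) hj] :=
        compact_nondecreasing (G := fun j => [set x | T < g j x]) cK.
  - by move=> j; apply: open_ltf => //; exact: continuous_cst.
  - by move=> /lt_le_trans; apply; exact: gm.
  - have [/fh|] := pselect (S x); first by lra.
    by move=> /not_andP[//|/existsNP[j /negP]]; rewrite -ltNge => hj; exists j.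
  apply: le_trans (letheta _ j ck k0) _.
  have -> : e = mu (fun x => e1 * phi x) by rewrite (poslinZ pm) // /e1 divfK // lt0r_neq0.
  apply: (poslin_le lC pm) => [||x]; [exact: Pw|exact: Cc_scale|].
  have [xr|xr] := leP (dist2 0 x) r; last by rewrite hr // mul0r !mulr0.
  have [xe|xe] := leP e1 (f x - h x).
    have gj : T < g j x by apply: hj.
    have -> : w j x = 0.
      by apply: max_l; rewrite subr_le0 ler_pdivlMr // mul1r ltW.
    by rewrite !mulr0 mulr_ge0 // ltW.
  apply: ler_pM => //; first by rewrite mulr_ge0.
    by rewrite /k ge_max (ltW e10) ltW.
  by rewrite -[leRHS]mulr1; apply: ler_wpM2l.
have S0 : S !=set0.
  apply: contrapT => /forallNP nS; have c0 : Cont (fun _ : V => 0 : R) by exact: continuous_cst.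
  have : theta (fun=> 1) <= theta (fun=> 0 * 1).
    by apply: onS => //; [exact: continuous_cst|move=> x /nS].
  by rewrite (poslinZ pt) // mul0r leNgt theta1.
have tail m s' x : S x -> 0 < s' -> theta (ker s' x) <= theta (ker (tr R (J m)) x) + T / 2 ^+ m.
  move=> [_ /= xT] s'0; have [j1 hj1] := tr_small s'0.
  pose M := maxn m.+1 (maxn (J m) j1).
  have mM : (m < M)%N by rewrite leq_max leqnn.
  have JM : (J m <= M)%N by rewrite !leq_max leqnn orbT.
  have tM : tr R M <= s' by rewrite hj1 // !leq_max leqnn !orbT.
  have tM0 := tr_gt0 R M; have tJ0 := tr_gt0 R (J m).
  rewrite -lerBlDl -(poslinB lK pt); [|exact: Cont_ker|exact: Cont_ker].
  apply: (@le_trans _ _ (theta (fun y => ker (tr R M) x y - ker (tr R (J m)) x y))).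
    apply: (poslin_le lK pt) => [||y].
    - by apply: continuous_sub; exact: Cont_ker.
    - by apply: continuous_sub; exact: Cont_ker.
    - by rewrite lerD2r ker_decr.
  apply: le_trans (th _ _ _) _.
  - by apply: continuous_sub; exact: Cont_ker.
  - by move=> y; rewrite subr_ge0 ker_decr // tr_le.
  have -> : (fun y => (ker (tr R M) x y - ker (tr R (J m)) x y) * phi y) =
     (fun y => phi y * ker (tr R M) x y - phi y * ker (tr R (J m)) x y).
    by apply/funext => y; rewrite mulrC mulrBr.
  rewrite (poslinB lC pm) // ler_pdivlMr ?exprn_gt0 //; apply: le_trans (xT M).
  rewrite /g (bigD1 (Ordinal mM)) //= mulrC -[leLHS]addr0; apply: lerD.
    by apply: ler_wpM2l => //; rewrite le_max lexx orbT.
  by apply: sumr_ge0 => i _; rewrite mulr_ge0.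
exists theta; split=> // e e0.
have [m hm] : exists m, 4 `^ q * (T / 2 ^+ m) <= e.
  have [j hj] := nat_large (4 `^ q * T / e); exists j.
  have : 4 `^ q * T / e <= 2 ^+ j.
    apply: le_trans (hj j (leqnn j)) _; rewrite -natrX ler_nat ltnW //; exact: ltn_expl.
  by rewrite ler_pdivrMr // => H; rewrite mulrA ler_pdivrMr ?exprn_gt0 // [leRHS]mulrC.
have tJ0 := tr_gt0 R (J m).
(* The division by 4 compensates the factor 4 by which [ker_diff_closest] enlarges [s]. *)
exists (tr R (J m) / 4); first by rewrite divr_gt0.
set s0 := _ / 4 => s' x s'0 s's.
have s00 : 0 < s0 by rewrite divr_gt0.
have cd2 : {within S, continuous (dist2 x)}.
  by apply: continuous_subspaceT; exact: continuous_dist2r.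
have [c /set_mem Sc hc] := compact_EVT_min S0 cS cd2.
have c4s : Cont (ker (4 * s') c) by apply: Cont_ker; rewrite mulr_gt0.
have c4s0 : Cont (ker (4 * s0) c) by apply: Cont_ker; rewrite mulr_gt0.
rewrite -lerBlDl -(poslinB lK pt); [|exact: Cont_ker|exact: Cont_ker].
apply: (@le_trans _ _ (theta (fun y => 4 `^ q * (ker (4 * s') c y - ker (4 * s0) c y)))).
  apply: onS => [||y Sy]; first by apply: continuous_sub; exact: Cont_ker.
    by apply: continuous_scale; apply: continuous_sub.
  by apply: ker_diff_closest => //; apply: hc; exact: mem_set.
rewrite (poslinZ pt); last exact: continuous_sub.
rewrite (poslinB lK pt) //; apply: le_trans hm; apply: ler_wpM2l; first exact: powR_ge0.
rewrite lerBlDl; have -> : 4 * s0 = tr R (J m) by rewrite /s0 mulrC divfK.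
by apply: tail => //; rewrite mulr_gt0.
Qed.

End Continuity.

(** * Weak limits of measures with bounded potentials *)

Lemma ultra_fmap (T S : Type) (f : T -> S) (U : set_system T) : UltraFilter U -> UltraFilter (f @ U).
Proof.
move=> UU; have PU := @ultra_proper _ _ UU; split; first exact: fmap_proper_filter.
move=> G PG UG; apply/seteqP; split=> [A GA|]; last exact: UG.
have [//|nA] := @in_ultra_setVsetC _ U (f @^-1` A) UU.
have GnA : G (~` A) by apply: UG.
have : G set0 by rewrite -(setICr A); exact: filterI.
by move/(@filter_not_empty _ _ PG).
Qed.

Lemma ultra_cvg_bounded (R : realType) (T : Type) (U : set_system T) (f : T -> R) (M : R) :
  UltraFilter U -> (\forall t \near U, `|f t| <= M) -> exists l : R, f t @[t --> U] --> l.
Proof.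
move=> UU fM; have cS := @segment_compact R (- M) M; rewrite compact_ultra in cS.
have PU := @ultra_proper _ _ UU.
have UfU := ultra_fmap f UU.
have [|l [_ hl]] := cS (f @ U) UfU; last by exists l.
have : \forall t \near U, f t \in `[- M, M].
  by apply: filterS fM => t; rewrite ler_norml in_itv.
by [].
Qed.

Section Domination.
Variables (R : realType) (n : nat) (alpha q : R).
Hypotheses (qE : q = (n%:R - alpha) / 2) (q0 : 0 < q).
Notation V := 'rV[R]_n.
Notation ker := (rker q).
Implicit Types (x y z : V) (mu lam theta : (V -> R) -> R) (f : V -> R) (rho s p : R).

Lemma poslin_Cont_radon theta : poslin (@Cont R n) theta -> pos_radon theta.
Proof. by apply: poslin_sub => f; exact: Cc_Cont. Qed.

Lemma cut_ker_le_potential lam (chi : V -> R) s x : pos_radon lam -> Cc chi -> (forall y, 0 <= chi y <= 1) -> 0 < s ->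
  ((lam (fun y => chi y * ker s x y))%:E <= potential alpha lam x)%E.
Proof.
move=> pl cc c01 s0; apply: uint_ge => [|y|y].
- by apply: Cc_mull => //; exact: continuous_kerr.
- by rewrite mulr_ge0 ?ker_ge0 //; case/andP: (c01 y).
apply: le_trans (ker_le_riesz qE q0 x y s0); rewrite lee_fin -[leRHS]mul1r.
by apply: ler_wpM2r; [exact: ker_ge0|case/andP: (c01 y)].
Qed.

(** The kernel is bounded below on bounded sets, so a finite potential at one point controls the
    mass on every ball; this is the compactness used for families of competitors. *)
Lemma radon_local_bound (r j : R) : 0 <= r -> 0 <= j -> exists2 C : R, 0 < C & forall lam x, pos_radon lam -> dist2 0 x <= r ->
  ((lam (@cutoff R n j))%:E <= C%:E * potential alpha lam x)%E.
Proof.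
move=> r0 j0; pose D := 2 * r + 2 * (j + 1) + 1.
have D0 : 0 < D by rewrite /D; lra.
have c0 : 0 < D `^ (- q) by rewrite powR_gt0.
exists (D `^ (- q))^-1; first by rewrite invr_gt0.
move=> lam x pl xr; rewrite -lee_pdivrMl ?invr_gt0 // invrK -EFinM.
rewrite -(poslinZ pl); last exact: Cc_cutoff.
apply: le_trans (@cut_ker_le_potential lam (cutoff j) 1 x pl (Cc_cutoff _ _) _ ltr01); last first.
  by move=> y; rewrite cutoff_ge0 cutoff_le1.
rewrite lee_fin; apply: (poslin_le (@linclass_Cc _ _) pl) => [||y].
- by apply: Cc_scale; exact: Cc_cutoff.
- by apply: Cc_cutker.
have [yj|yj] := leP (dist2 0 y) (j + 1); last by rewrite cutoff0 ?mulr0 ?mul0r // ltW.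
rewrite mulrC; apply: ler_wpM2l; first exact: cutoff_ge0.
apply: powRN_le => //; first by rewrite dist2D_gt0.
by have := dist2_split2 0 x y; rewrite (dist2C x 0) /D; lra.
Qed.

(** Support in a ball is encoded through the order, which is the form in which estimates on the ball
    are integrated. *)
Definition supported (r : R) theta := forall f g, Cont f -> Cont g -> 
  (forall x, dist2 0 x <= r -> f x <= g x) -> theta f <= theta g.

Lemma supported_density theta mu phi : pos_radon mu -> Cc phi -> (forall x, 0 <= phi x) ->
  poslin (@Cont R n) theta -> (forall f, Cont f -> (forall x, 0 <= f x) -> theta f <= mu (fun x => f x * phi x)) ->
  exists2 r, 0 <= r & supported r theta.
Proof.
move=> pm cphi phi0 pt th; have [r [r0 hr]] := Cc_cutoff_eq cphi.
have phi_out x : r + 1 < dist2 0 x -> phi x = 0.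
  by move=> h; rewrite (hr r) // cutoff0 ?mul0r // ltW.
exists (r + 1); first by rewrite addr_ge0.
move=> f g cf cg fg; pose k x := Num.max 0 (f x - g x).
have ck : Cont k by apply: continuous_maxr; [exact: continuous_cst|exact: continuous_sub].
have k0 x : 0 <= k x by rewrite le_max lexx.
have tk : theta k <= 0.
  apply: le_trans (th k ck k0) _; have -> : (fun x => k x * phi x) = (fun x => 0 * phi x).
    apply/funext => x; have [h|/phi_out ->] := leP (dist2 0 x) (r + 1); last by rewrite !mulr0.
    by rewrite /k max_l // subr_le0 fg.
  by rewrite (poslinZ pm) // mul0r.
have : theta f <= theta (fun x => g x + k x).
  apply: (poslin_le (@linclass_Cont _ _) pt) => [||x] //; first exact: continuous_add.
  by rewrite -lerBlDl le_max lexx orbT.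
by rewrite (poslinD pt) //; lra.
Qed.

Lemma potential_le_tail theta s0 (e : R) y : poslin (@Cont R n) theta -> 0 < s0 ->
  (forall s x, 0 < s -> s <= s0 -> theta (ker s x) <= theta (ker s0 x) + e) -> 0 <= e ->
  (potential alpha theta y <= (theta (ker s0 y) + e)%:E)%E.
Proof.
move=> pt s00 he e0; rewrite (potentialE qE q0) //; last exact: poslin_Cont_radon.
apply: esup_le => j; rewrite lee_fin; have t0 := tr_gt0 R j.
have lK := @linclass_Cont R n.
apply: (@le_trans _ _ (theta (ker (tr R j) y))).
  apply: (poslin_le lK pt) => [||x]; [|exact: Cont_ker|exact: kk_le_ker].
  by apply: Cc_Cont; exact: Cc_kk.
have [h|h] := leP (tr R j) s0; first exact: he.
rewrite -[leLHS]addr0; apply: lerD => //; apply: (poslin_le lK pt) => [||x]; [exact: Cont_ker|exact: Cont_ker|].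
by apply: ker_decr => //; exact: ltW.
Qed.

(** Seen from far away, [theta] looks like a point mass placed at any [x] of a bounded set: the
    squared distances from [y] to [x] and to the support have ratio near 1. *)
Lemma potential_far theta (r r1 e : R) : poslin (@Cont R n) theta -> supported r1 theta -> 0 < e -> 0 <= r -> 0 <= r1 ->
  exists2 rho0, 0 < rho0 & forall x y, dist2 0 x <= r -> rho0 <= dist2 0 y ->
    (potential alpha theta y <= ((1 + e) * theta (fun=> 1))%:E * riesz_kernel alpha x y)%E.
Proof.
move=> pt st e0 r0 r10; have [eta eta0 he] := powR_1D_le q0 e0.
pose a := eta / 2; have a0 : 0 < a by rewrite divr_gt0.
have lK := @linclass_Cont R n.
have ai0 : 0 < 1 + a^-1 by rewrite addr_gt0 // invr_gt0.
pose Y := (1 + a^-1) * (2 * r + 2 * r1) / a.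
exists (2 * r1 + 2 * Y + 1).
  by rewrite ltr_wpDl // addr_ge0 // ?mulr_ge0 ?invr_ge0 ?(ltW a0) ?(ltW ai0) ?addr_ge0 ?mulr_ge0.
move=> x y xr yr; rewrite (potentialE qE q0) //; last exact: poslin_Cont_radon.
have m0 : 0 <= theta (fun=> 1) by apply: (poslin_ge0 pt) => //; exact: continuous_cst.
apply: esup_le => j; have t0 := tr_gt0 R j.
apply: (@le_trans _ _ (((1 + e) * theta (fun=> 1)) * ker (tr R j) x y)%:E); last first.
  rewrite EFinM; apply: lee_wpmul2l; last exact: ker_le_riesz.
  by rewrite lee_fin mulr_ge0 // addr_ge0 // ltW.
rewrite lee_fin mulrAC -(poslinZ pt); last exact: continuous_cst.
apply: st; [by apply: Cc_Cont; exact: Cc_kk|exact: continuous_cst|].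
move=> v vr; rewrite mulr1; apply: le_trans (kk_le_ker _ _ _ _) _.
have hh : (1 + eta) `^ q <= 1 + e by apply: he; rewrite lexx ltW.
apply: (@le_trans _ _ ((1 + eta) `^ q * ker (tr R j) x y)); last by apply: ler_wpM2r => //; exact: ker_ge0.
apply: powRN_scale; rewrite ?dist2D_gt0 ?addr_gt0 //.
have h1 := dist2_split v y x a0.
have h2 := dist2_split2 v 0 y; have h3 := dist2_split2 0 v x.
rewrite (dist2C v 0) in h3; rewrite (dist2C v y) in h2.
have aY : a * Y = (1 + a^-1) * (2 * r + 2 * r1) by rewrite /Y mulrC divfK // lt0r_neq0.
have h4 : (1 + a^-1) * dist2 v x <= a * dist2 y v.
  apply: (@le_trans _ _ (a * Y)).
    by rewrite aY; apply: ler_wpM2l; [exact: ltW|lra].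
  by apply: ler_wpM2l; [exact: ltW|lra].
rewrite (dist2C x y); have -> : eta = 2 * a by rewrite /a mulrC divfK.
by move: h1 h4; set P := (1 + a^-1) * _; set Q := dist2 y v => h1 h4; nra.
Qed.

(* Mass of [lam] escaping to infinity is measured by its contribution to the potential at [x]. *)
Lemma uint_potential_split theta (r r1 e : R) : poslin (@Cont R n) theta -> supported r1 theta ->
  uniform_tail q theta -> 0 < e -> 0 <= r -> 0 <= r1 ->
  exists2 rho0 : R, 0 < rho0 & forall e' : R, 0 < e' -> exists2 s0 : R, 0 < s0 &
     forall rho s x lam p, rho0 <= rho -> 0 < s -> dist2 0 x <= r ->
     pos_radon lam -> potential alpha lam x = p%:E ->
     (uint lam (potential alpha theta) <=
       (lam (fun y => cutoff rho y * (theta (ker s0 y) + e')) +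
       (1 + e) * theta (fun=> 1) * (p - lam (fun y => cutoff rho y * ker s x y)))%:E)%E.
Proof.
move=> pt st ut e0 r0 r10.
have [rho0 rho00 hfar] := potential_far pt st e0 r0 r10.
exists rho0 => // e' e'0; have [s0 s00 hs0] := ut e' e'0.
have lC := @linclass_Cc R n; have lK := @linclass_Cont R n.
have m0 : 0 <= theta (fun=> 1) by apply: (poslin_ge0 pt) => //; exact: continuous_cst.
exists s0 => // rho s x lam p rhoh s'0 xr pl pE.
pose m := (1 + e) * theta (fun=> 1).
have mm0 : 0 <= m by rewrite mulr_ge0 // addr_ge0 // ltW.
pose a y := theta (ker s0 y) + e'.
have ca : continuous a.
  apply: continuous_add; last exact: continuous_cst.
  apply: (@harnack_continuous _ _ q q0 s0) => //.
    by move=> y; apply: (poslin_ge0 pt) => [|v]; [exact: Cont_ker|exact: ker_ge0].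
  have -> : (fun y => theta (ker s0 y)) = (fun y => theta (fun v => 1 * ker s0 y v)).
    by apply/funext => y; congr theta; apply/funext => v; rewrite mul1r.
  apply: (harnack_poslin (c := fun=> 1) q0 lK pt s00 _ _) => // y.
  by apply: (linclass_Cont _ _).2; exact: Cont_ker.
have cca : Cc (fun y => cutoff rho y * a y) by apply: Cc_mull => //; exact: Cc_cutoff.
have a0 y : 0 <= a y.
  by rewrite addr_ge0 ?(ltW e'0) //; apply: (poslin_ge0 pt) => [|v]; [exact: Cont_ker|exact: ker_ge0].
apply: uint_le => f cf f0 fp; rewrite lee_fin -/m -/a.
have fa y : f y <= a y.
  by rewrite -lee_fin; apply: le_trans (fp y) _; exact: potential_le_tail (ltW e'0).
pose k1 y := Num.max 0 (f y - cutoff rho y * a y).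
have ca0 y : 0 <= cutoff rho y * a y by rewrite mulr_ge0 ?cutoff_ge0.
have ck1 : Cc k1 by apply: Cc_max_sub => //; case: cca.
have ckx : Cc (fun y => cutoff rho y * ker s x y) by exact: Cc_cutker.
have fk : lam f <= lam (fun y => cutoff rho y * a y) + lam k1.
  rewrite -(poslinD pl) //; apply: (poslin_le lC pl) => //; first exact: Cc_add.
  by move=> y; rewrite -lerBlDl le_max lexx orbT.
apply: le_trans fk _; rewrite lerD2l.
have cx0 y : 0 <= cutoff rho y * ker s x y by rewrite mulr_ge0 ?cutoff_ge0 ?ker_ge0.
(* [theta] may be zero, so the mass factor [m] is replaced by a positive [M]. The claim holds
   because [k1 / M] and the cut kernel together stay below the Riesz kernel at [x], whose integral
   is [p]. *)
suff H (M : R) : 0 < M -> m <= M -> lam k1 + M * lam (fun y => cutoff rho y * ker s x y) <= M * p.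
  have px : lam (fun y => cutoff rho y * ker s x y) <= p.
    rewrite -lee_fin -pE; apply: cut_ker_le_potential => //; first exact: Cc_cutoff.
    by move=> y; rewrite cutoff_ge0 cutoff_le1.
  set pr := lam (fun y => _ * ker s x y) in H px *.
  apply/ler_addgt0Pr => d d0; pose d1 := d / (p - pr + 1).
  have dp : 0 < p - pr + 1 by rewrite ltr_wpDl // subr_ge0.
  have d10 : 0 < d1 by rewrite divr_gt0.
  have d1E : d1 * (p - pr + 1) = d by rewrite /d1 divfK // lt0r_neq0.
  have := H (m + d1) (ltr_wpDl mm0 d10); rewrite lerDl ltW // => /(_ isT).
  by nra.
move=> M0 mM; rewrite -ler_pdivrMl // mulrDr mulKf ?lt0r_neq0 // -(poslinZ pl) // -(poslinD pl) //; last exact: Cc_scale.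
rewrite -lee_fin -pE; apply: uint_ge => [|y|y].
- by apply: Cc_add => //; exact: Cc_scale.
- by rewrite addr_ge0 // mulr_ge0 ?invr_ge0 ?(ltW M0) // le_max lexx.
have [rh|rh] := leP (dist2 0 y) rho.
  rewrite /k1 cutoff1 // !mul1r max_l ?subr_le0 // mulr0 add0r; exact: ker_le_riesz.
rewrite (riesz_kernelE qE); case: eqVneq => [_|xy]; first by rewrite leey.
have := fp y => /le_trans/(_ (hfar x y xr _)).
rewrite (le_trans rhoh (ltW rh)) => /(_ isT); rewrite (riesz_kernelE qE) (negbTE xy) -EFinM lee_fin.
set D := dist2 x y `^ (- q) => fD; rewrite lee_fin.
have kD : ker s x y <= D.
  by apply: powRN_le => //; rewrite ?dist2_gt0 // lerDl ltW.
have D0 : 0 <= D by apply: powR_ge0.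
have fMD : f y <= M * D by apply: le_trans fD _; apply: ler_wpM2r.
have c0 := cutoff_ge0 rho y; have c1 := cutoff_le1 rho y.
have k1M : k1 y <= (1 - cutoff rho y) * (M * D).
  rewrite /k1 ge_max; apply/andP; split.
    by rewrite mulr_ge0 ?subr_ge0 // mulr_ge0 // ltW.
  have := ler_wpM2l c0 (fa y); have : (1 - cutoff rho y) * f y <= (1 - cutoff rho y) * (M * D).
    by apply: ler_wpM2l => //; rewrite subr_ge0.
  by rewrite mulrBl mul1r; lra.
apply: (@le_trans _ _ ((1 - cutoff rho y) * D + cutoff rho y * D)).
  apply: lerD; last exact: ler_wpM2l.
  by rewrite ler_pdivrMl // mulrCA.
by rewrite -mulrDl subrK mul1r.
Qed.

Lemma le_ker_potential theta (r1 : R) s y : poslin (@Cont R n) theta -> supported r1 theta -> 0 < s ->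
  ((theta (ker s y))%:E <= potential alpha theta y)%E.
Proof.
move=> pt st s0.
apply: le_trans (_ : _ <= (theta (fun x => cutoff r1 x * ker s y x))%:E)%E _.
  rewrite lee_fin; apply: st => [||x xr]; [exact: Cont_ker|by apply: Cc_Cont; exact: Cc_cutker|].
  by rewrite cutoff1 ?mul1r.
apply: cut_ker_le_potential => //; [exact: poslin_Cont_radon|exact: Cc_cutoff|].
by move=> x; rewrite cutoff_ge0 cutoff_le1.
Qed.

End Domination.

(** * Replacing mass at infinity by a distant Dirac mass *)

Section Escape.
Variables (R : realType) (n : nat) (alpha q : R).
Hypotheses (n0 : (0 < n)%N) (qE : q = (n%:R - alpha) / 2) (q0 : 0 < q).
Notation V := 'rV[R]_n.
Notation ker := (rker q).
Notation kk := (cker q).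
Implicit Types (x y z v : V) (mu lam theta : (V -> R) -> R) (f : V -> R) (A E : set V).

Lemma exists_dist2 (T : R) : 0 <= T -> exists v, dist2 0 v = T.
Proof.
move=> T0; have nR : 0 < n%:R :> R by rewrite ltr0n.
exists (const_mx (Num.sqrt (T / n%:R))).
rewrite /dist2; under eq_bigr do rewrite !mxE sub0r sqrrN sqr_sqrtr ?divr_ge0 ?(ltW nR) //.
by rewrite sumr_const card_ord -[X in X = _]mulr_natr divfK // lt0r_neq0.
Qed.

(* A distant Dirac mass has nearly constant potential on bounded sets, and dominates the kernel of [z] far away. *)
Lemma far_dirac z x0 (c e : R) : 0 < c -> 0 < e -> exists (rE M : R) v, [/\ 0 < M,
  forall x, rE < dist2 x z -> (riesz_kernel alpha x z <= (M * c)%:E * riesz_kernel alpha x v)%E,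
  forall x, dist2 x z <= rE -> (1 <= ((1 + e) * M)%:E * riesz_kernel alpha x v)%E &
  (M%:E * riesz_kernel alpha x0 v <= (1 + e)%:E)%E].
Proof.
move=> c0 e0; have [eta eta0 he] := powR_1D_le q0 e0.
have hh : (1 + eta) `^ q <= 1 + e by apply: he; rewrite lexx ltW.
pose a := eta / 2; have a0 : 0 < a by rewrite divr_gt0.
have etaE : eta = 2 * a by rewrite /a mulrC divfK.
pose g := c `^ (q^-1); have g0 : 0 < g by rewrite powR_gt0.
have cE : c = g `^ q by rewrite /g -powRrM mulVf ?lt0r_neq0 // powRr1 // ltW.
pose Z := dist2 0 z; pose X := dist2 0 x0; have Z0 : 0 <= Z := dist2_ge0 _ _.
have X0 : 0 <= X := dist2_ge0 _ _.
have ai0 : 0 < 1 + a^-1 by rewrite addr_gt0 // invr_gt0.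
pose rE := 8 / g * (1 + Z); pose r2 := 2 * Z + 2 * rE.
have rE0 : 0 < rE by rewrite mulr_gt0 ?divr_gt0 // ltr_wpDr.
have r20 : 0 <= r2 by rewrite /r2; lra.
pose W := (1 + a^-1) * (r2 + X) * (1 + 2 * a) / a.
have W0 : 0 <= W.
  apply: divr_ge0; last exact: ltW.
  apply: mulr_ge0; last by lra.
  by apply: mulr_ge0; [exact: ltW|exact: addr_ge0].
have aW : a * W = (1 + a^-1) * (r2 + X) * (1 + 2 * a) by rewrite /W mulrC divfK // lt0r_neq0.
(* [4 / g] serves the estimate far from [z], where [g] is [c^(1/q)]; [W] serves the two estimates on
   bounded sets, [r2] being a bound for [dist2 0 x] when [dist2 x z <= rE]. *)
pose T := 1 + 4 / g + W.
have T1 : 1 <= T by have : 0 < 4 / g by [rewrite divr_gt0]; rewrite /T; lra.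
have T0 : 0 < T by lra.
have gT : 4 <= g * T.
  have : g * (4 / g) <= g * T by rewrite ler_pM2l // /T; lra.
  by rewrite mulrC divfK // lt0r_neq0.
have aT : (1 + a^-1) * (r2 + X) * (1 + 2 * a) <= a * T.
  by rewrite -aW ler_pM2l // /T; have : 0 < 4 / g by [rewrite divr_gt0]; lra.
have [v hv] := exists_dist2 (ltW T0).
have TE : T `^ q * T `^ (- q) = 1.
  by rewrite -powRD ?subrr ?powRr0 // eqxx lt0r_neq0.
have Tq0 : 0 < T `^ q by rewrite powR_gt0.
have Tv : dist2 v 0 = T by rewrite dist2C.
exists rE, (T `^ q), v; split=> // [x xE|x xE|].
- have xz : x != z by rewrite -dist2_eq0 gt_eqF // (lt_trans rE0).
  rewrite !(riesz_kernelE qE) (negbTE xz); case: eqVneq => [_|xv].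
    by rewrite gt0_muley ?leey // lte_fin mulr_gt0.
  rewrite -EFinM lee_fin cE -powRM ?(ltW T0) ?(ltW g0) //.
  apply: powRN_scale; rewrite ?dist2_gt0 ?mulr_gt0 //.
  have h1 := dist2_split2 z x v; have h2 := dist2_split2 0 z v.
  rewrite (dist2C z 0) hv -/Z in h2.
  have h3 : 8 * (1 + Z) <= g * dist2 x z.
    have : g * rE <= g * dist2 x z by rewrite ler_pM2l // ltW.
    by rewrite /rE !mulrA [g * 8]mulrC -!mulrA mulVKf // lt0r_neq0.
  have d0 := dist2_ge0 x z.
  have h4 : 4 * dist2 x z <= g * T * dist2 x z by apply: ler_wpM2r.
  have h5 : T * (8 * (1 + Z)) <= T * (g * dist2 x z) by rewrite ler_pM2l.
  have h6 : Z <= T * Z by rewrite -[leLHS]mul1r; apply: ler_wpM2r.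
  by move: h1 h2 h3 h4 h5 h6; set D := dist2 x z => *; nra.
- rewrite (riesz_kernelE qE); case: eqVneq => [_|xv].
    by rewrite gt0_muley ?leey // lte_fin mulr_gt0 // addr_gt0.
  rewrite -EFinM lee_fin.
  have h1 := dist2_split 0 x v a0; rewrite hv (dist2C x 0) in h1.
  have h1' := dist2_split 0 v x a0; rewrite Tv (dist2C v x) in h1'.
  have h2 := dist2_split2 z 0 x; rewrite -/Z (dist2C z x) in h2.
  have xr2 : dist2 0 x <= r2 by rewrite /r2; lra.
  have h3 : (1 + a^-1) * dist2 0 x <= a * T.
    apply: le_trans aT; rewrite -mulrA ler_pM2l //.
    have : 0 <= (r2 + X) * (2 * a) by apply: mulr_ge0; [exact: addr_ge0|lra].
    by lra.
  have : T `^ (- q) <= (1 + eta) `^ q * dist2 x v `^ (- q).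
    apply: powRN_scale => //; [exact: dist2_gt0|lra|].
    by move: h1' h3; rewrite etaE; set P := (1 + a^-1) * _; set D := dist2 x v => h1' h3; nra.
  move=> h4; rewrite -[leLHS]TE (mulrC (1 + e)) -mulrA ler_pM2l //; apply: le_trans h4 _.
  by apply: ler_wpM2r => //; exact: powR_ge0.
- have h1 := dist2_split x0 0 v a0; rewrite hv in h1.
  have h1' := dist2_split x0 v 0 a0; rewrite Tv (dist2C x0 0) -/X (dist2C v x0) in h1'.
  have h3 : (1 + a^-1) * X * (1 + 2 * a) <= a * T.
    apply: le_trans aT; apply: ler_wpM2r; first by lra.
    by rewrite ler_pM2l //; lra.
  have dT : T <= (1 + eta) * dist2 x0 v.
    rewrite etaE; move: h1' h3; set P := (1 + a^-1) * X; set D := dist2 x0 v => h1' h3.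
    have h5 : (1 + 2 * a) * T <= (1 + 2 * a) * ((1 + a) * D + P).
      by rewrite ler_pM2l // addr_gt0 // mulr_gt0.
    have h6 : (1 + a) * T <= (1 + a) * ((1 + 2 * a) * D) by nra.
    by rewrite ler_pM2l // addr_gt0 // in h6.
  have d0 : 0 < dist2 x0 v.
    by have := lt_le_trans T0 dT; rewrite pmulr_rgt0 // addr_gt0.
  rewrite (riesz_kernelE qE) -dist2_eq0 gt_eqF // -EFinM lee_fin.
  have : dist2 x0 v `^ (- q) <= (1 + eta) `^ q * T `^ (- q).
    by apply: powRN_scale => //; rewrite addr_gt0.
  move=> h; have : T `^ q * dist2 x0 v `^ (- q) <= T `^ q * ((1 + eta) `^ q * T `^ (- q)).
    by rewrite ler_pM2l.
  by rewrite mulrCA TE mulr1 => /le_trans; apply.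
Qed.

Lemma concentrated_sub mu A E : pos_radon mu -> E `<=` A -> concentrated mu E -> concentrated mu A.
Proof.
move=> pm EA cE; apply: concentrated_intro => // e e0.
have [U [oU EU hU]] := concentrated_open cE e0; exists U; split=> //.
by apply: subset_trans EU; exact: subsetC.
Qed.

(** In integrated form, [lam] together with the constant [c] dominates the kernel of [z] on [A]. A
    far Dirac mass realizes the constant, and the factor [1 + e] absorbs the error, so that [sg] is
    a genuine competitor for [z]; evaluating at [x0] gives the bound. *)
Lemma escape_bound A lam z x0 (c c1 e : R) : pos_radon lam -> potential alpha lam x0 = c1%:E -> 0 < c ->
  (forall sg, Mplus alpha sg ->
     ne_on alpha A (fun y => (potential alpha (dirac_m z) y <= potential alpha sg y)%E) ->
     forall x, (potential alpha (dirac_m z) x <= potential alpha sg x)%E) ->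
  (forall theta r, poslin (@Cont R n) theta -> 0 <= r -> supported r theta -> uniform_tail q theta ->
     (energy alpha theta < +oo)%E -> concentrated theta A ->
     (potential alpha theta z <= uint theta (potential alpha lam) + (theta (fun=> 1) * c)%:E)%E) ->
  0 < e <= 1 -> (riesz_kernel alpha x0 z <= ((1 + e) * (c1 + c * (1 + e)))%:E)%E.
Proof.
move=> pl pE c0 Hz H2 /andP[e0 e1].
have e40 : 0 < e / 4 by rewrite divr_gt0.
have [rE [M [v [M0 hfar hnear hx0]]]] := far_dirac z x0 c0 e40.
have Mc0 : 0 < M * c by rewrite mulr_gt0.
have e10 : 0 <= 1 + e by rewrite addr_ge0 // ltW.
pose sg f := (1 + e) * (lam f + M * c * f v).
have ps : pos_radon sg.
  apply: pos_radon_scale => //; split=> [f g cf cg|d f cf|f cf f0].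
  - by rewrite (poslinD pl) //=; ring.
  - by rewrite (poslinZ pl) //; ring.
  - by rewrite addr_ge0 ?(poslin_ge0 pl) // mulr_ge0 // ltW.
have up : (potential alpha sg x0 <= ((1 + e) * (c1 + c * (1 + e)))%:E)%E.
  apply: uint_le => f cf f0 fx; rewrite lee_fin; apply: ler_wpM2l => //; apply: lerD.
    by rewrite -lee_fin -pE; exact: uint_ge.
  rewrite mulrAC mulrC; apply: ler_wpM2l; first exact: ltW.
  rewrite -lee_fin; apply: le_trans (_ : _ <= (1 + e / 4)%:E)%E _; last by rewrite lee_fin; lra.
  by apply: le_trans hx0; rewrite EFinM; apply: lee_wpmul2l => //; rewrite lee_fin ltW.
apply: (le_trans _ up); rewrite -(potential_dirac qE q0).
have sgk i x : (((1 + e) * (lam (kk i x) + M * c * kk i x v))%:E <= potential alpha sg x)%E.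
  by rewrite (potentialE qE q0) //; exact: (@esup_ge _ _ (fun j x => sg (kk j x))).
have lam0 i x : 0 <= lam (kk i x).
  by apply: (poslin_ge0 pl) => [|y]; [exact: Cc_kk|exact: kk_ge0].
apply: Hz.
  by split=> //; exists x0; rewrite -ltey; apply: le_lt_trans up _; rewrite ltey.
(* Were the capacity of [E] positive, [E] would carry a measure [th] with continuous potential, and
   integrating the strict inequality on [E] against [th] would contradict [H2]. *)
pose E := [set x | A x /\ ~ (potential alpha (dirac_m z) x <= potential alpha sg x)%E].
have EA : E `<=` A by move=> x [].
exists E; split=> //; split; last first.
  by move=> x Ax nE; apply: contrapT => h; apply: nE; split.
apply: contrapT => /inner_cap_neq0[mu [pm cmE em mm]].
have [phi [cphi phi0 phi1 mphi]] : exists f, [/\ Cc f, forall x, 0 <= f x, forall x, ((f x)%:E <= 1)%E & 0 < mu f].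
  by apply: (@uint_gt _ _ mu (cst 1%:E) 0); rewrite -/(total_mass mu) mm lte_fin.
have phi01 x : 0 <= phi x <= 1 by rewrite phi0 /=; have := phi1 x; rewrite lee_fin.
have [th [pt thmu th1 ut]] := continuous_energy_part qE q0 pm em cphi phi01 mphi.
have [r r0 st] := supported_density pm cphi phi0 pt thmu.
have pth := poslin_Cont_radon pt.
have th_mu f : Cc f -> (forall x, 0 <= f x) -> th f <= 1 * mu f.
  move=> cf f0; rewrite mul1r; apply: le_trans (thmu f (Cc_Cont cf) f0) _.
  apply: (poslin_le (@linclass_Cc _ _) pm) => // [|x].
    by apply: Cc_mull => //; case: cphi.
  by rewrite -[leRHS]mulr1; apply: ler_wpM2l => //; case/andP: (phi01 x).
have cthE : concentrated th E := concentrated_scale pth ltr01 th_mu cmE.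
have cthA := concentrated_sub pth EA cthE.
have eth : (energy alpha th < +oo)%E := energy_scale pth ltr01 th_mu em.
have HH := H2 th r pt r0 st ut eth cthA.
have [i [i0 iE]] : exists i : R, 0 <= i /\ uint th (potential alpha lam) = i%:E.
  have I0 : (0 <= uint th (potential alpha lam))%E.
    by apply: uint_ge0 => // x; exact: (potential_ge0 qE q0).
  have [rho0 _ /(_ 1 ltr01)[s0 _ hs]] := uint_potential_split qE q0 pt st ut ltr01 (dist2_ge0 0 x0) r0.
  have := hs rho0 1 x0 lam c1 (lexx _) ltr01 (lexx _) pl pE.
  rewrite (fubini_potential qE q0) // => h.
  exists (fine (uint th (potential alpha lam))); split; first exact: fine_ge0.
  by rewrite fineK // ge0_fin_numE //; apply: le_lt_trans h _; rewrite ltey.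
rewrite iE in HH; set m := th (fun=> 1) in HH th1.
(* Of the factor [1 + e] in [sg], the Dirac mass uses up about [1 + e / 4], and [1 + e / 2] survives
   since [(1 + e / 4) * (1 + e / 2) < 1 + e]. The supremum over [j] makes the first term [i], which
   is absurd because [i + c * m] is positive. *)
have key j : (1 + e / 2) * (th (fun x => lam (kk j x)) + c * m) <= i + m * c.
  rewrite -lee_fin; apply: le_trans HH.
  have chj : Cc (fun x => lam (kk j x)) by exact: (Cc_pot q0).
  pose f1 x := (1 + e / 2) * (lam (kk j x) + c * cutoff r x).
  have cf1 : Cc f1.
    by apply: Cc_scale; apply: Cc_add => //; apply: Cc_scale; exact: Cc_cutoff.
  have m1 : m <= th (cutoff r).
    by apply: st => [||x xr]; [exact: continuous_cst|exact: continuous_cutoff|rewrite cutoff1].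
  apply: (@le_trans _ _ (th f1)%:E).
    rewrite lee_fin /f1 (poslinZ pth); last by apply: Cc_add => //; apply: Cc_scale; exact: Cc_cutoff.
    rewrite (poslinD pth) //; last by apply: Cc_scale; exact: Cc_cutoff.
    rewrite (poslinZ pth); last exact: Cc_cutoff.
    apply: ler_wpM2l; first by rewrite addr_ge0 // divr_ge0 // ltW.
    by rewrite lerD2l ler_pM2l.
  rewrite /potential (esup_kk qE q0); apply: (concentrated_le pth cthE) => //; first exact: incr_kk.
  move=> x [Ax nE]; rewrite -(esup_kk qE q0) (riesz_kernelC qE).
  rewrite (potential_dirac qE q0) in nE.
  have {}nE : (potential alpha sg x < riesz_kernel alpha x z)%E by rewrite ltNge; apply/negP.
  apply: (@le_trans _ _ (potential alpha sg x)); last exact: ltW.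
  (* Beyond [rE] the Dirac part of [sg] alone dominates the kernel of [z], so [E] lies where that
     part is nearly the constant [c]. *)
  have xr : dist2 x z <= rE.
    rewrite leNgt; apply/negP => /hfar H; move: nE; rewrite ltNge => /negP; apply.
    apply: le_trans H _; rewrite muleC -lee_pdivlMr // (esup_kk qE q0); apply: esup_le => k.
    rewrite lee_pdivlMr //; apply: le_trans (sgk k x); rewrite -EFinM lee_fin.
    rewrite mulrC -[leLHS]mul1r; apply: ler_pM; rewrite ?ler01 ?lerDl ?(ltW e0) //.
      by rewrite mulr_ge0 ?(ltW Mc0) ?kk_ge0.
    by rewrite lerDr.
  have [k hk] : exists k, (1 + e / 2) / ((1 + e) * M) < kk k x v.
    apply: (@esup_gt _ _ (fun j => kk j x) v); rewrite -(esup_kk qE q0).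
    have p1 : 0 < (1 + e / 4) * M by rewrite mulr_gt0 // addr_gt0.
    have p2 : 0 < (1 + e) * M by rewrite mulr_gt0 // addr_gt0.
    apply: (@lt_le_trans _ _ (((1 + e / 4) * M)^-1)%:E).
      rewrite lte_fin ltr_pdivrMr // ltr_pdivlMl //.
      have : (1 + e / 4) * (1 + e / 2) < 1 + e by nra.
      by rewrite mulrAC ltr_pM2r.
    by have := hnear x xr; rewrite -lee_pdivrMl // mule1.
  apply: le_trans (sgk (maxn j k) x); rewrite lee_fin /f1.
  have h1 : lam (kk j x) <= lam (kk (maxn j k) x).
    by have [_ _] := incr_pot q0 pl; apply; exact: leq_maxl.
  have h2 : kk k x v <= kk (maxn j k) x v by apply: kk_mono => //; exact: leq_maxr.
  have h3 := cutoff_le1 r x; have h4 := lam0 j x.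
  rewrite ltr_pdivrMr ?mulr_gt0 ?addr_gt0 // in hk.
  have h5 : 1 + e / 2 <= (1 + e) * (M * kk (maxn j k) x v).
    apply: (@le_trans _ _ (kk k x v * ((1 + e) * M))); first exact: ltW.
    by rewrite mulrC mulrA; apply: ler_wpM2l => //; rewrite mulr_ge0 // ltW.
  rewrite !mulrDr; apply: lerD.
    apply: ler_pM => //; first by rewrite addr_ge0 // divr_ge0 // ltW.
    by rewrite lerD2l; lra.
  apply: (@le_trans _ _ ((1 + e / 2) * c)).
    apply: ler_wpM2l; first by rewrite addr_ge0 // divr_ge0 // ltW.
    by rewrite -[leRHS]mulr1; apply: ler_wpM2l => //; exact: ltW.
  have -> : (1 + e) * (M * c * kk (maxn j k) x v) = (1 + e) * (M * kk (maxn j k) x v) * c by ring.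
  by apply: ler_wpM2r => //; exact: ltW.
have p0 : 0 < 1 + e / 2 by rewrite addr_gt0 // divr_gt0.
have : (uint th (potential alpha lam) <= ((i + m * c) / (1 + e / 2) - c * m)%:E)%E.
  rewrite (uint_potential qE q0) //; apply: ge_ereal_sup => _ [j _ <-].
  by rewrite lee_fin lerBrDr ler_pdivlMr // mulrC.
rewrite iE lee_fin lerBrDr ler_pdivlMr //.
rewrite (mulrC m c); have k0 : 0 < i + c * m by rewrite ltr_wpDl // mulr_gt0.
by rewrite mulrDr mulr1 gerDl leNgt mulr_gt0 // divr_gt0.
Qed.

End Escape.

(** * Lower bound at a regular point *)

Section Regular.
Variables (R : realType) (n : nat) (alpha q : R).
Hypotheses (n0 : (0 < n)%N) (qE : q = (n%:R - alpha) / 2) (q0 : 0 < q).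
Notation V := 'rV[R]_n.
Notation ker := (rker q).
Notation kk := (cker q).
Implicit Types (x y z v w : V) (mu lam theta : (V -> R) -> R) (f : V -> R) (A E : set V).

(** Vague compactness. An ultrafilter decides all test functions at once, so no diagonal extraction
    is needed; outside [Cc] the limit functional gets the value 0. *)
Lemma bounded_ultralimit (I : Type) (U : set_system I) (lam_ : I -> (V -> R) -> R) :
  UltraFilter U -> (forall i, pos_radon (lam_ i)) ->
  (forall j : R, 0 <= j -> exists M : R, \forall i \near U, lam_ i (cutoff j) <= M) ->
  exists lam, pos_radon lam /\ forall f, Cc f -> lam_ i f @[i --> U] --> (lam f : R).
Proof.
move=> UU pl hb; have PU := @ultra_proper _ _ UU.
have H f : exists l : R, Cc f -> lam_ i f @[i --> U] --> l.
  have [cf|ncf] := pselect (Cc f); last by exists 0.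
  have [r [r0 hr]] := Cc_cutoff_eq cf; have [N [N0 hN]] := Cc_bounded cf.
  have [M hM] := hb r r0.
  have [l hl] : exists l : R, lam_ i f @[i --> U] --> l.
    apply: (@ultra_cvg_bounded _ _ _ _ (N * M)) => //.
    apply: filterS hM => i hi.
    have cc := @Cc_cutoff R n r.
    have fN x : - N * cutoff r x <= f x <= N * cutoff r x.
      rewrite [f x](hr r) // mulNr [cutoff r x * _]mulrC -mulNr.
      have := hN x; rewrite ler_norml => /andP[h1 h2].
      by rewrite !ler_wpM2r // cutoff_ge0.
    have up : lam_ i f <= N * lam_ i (cutoff r).
      rewrite -(poslinZ (pl i)) //; apply: (poslin_le (@linclass_Cc _ _) (pl i)) => // [|x]; first exact: Cc_scale.
      by case/andP: (fN x).
    have lo : - N * lam_ i (cutoff r) <= lam_ i f.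
      rewrite -(poslinZ (pl i)) //; apply: (poslin_le (@linclass_Cc _ _) (pl i)) => // [|x]; first exact: Cc_scale.
      by case/andP: (fN x).
    have NM : N * lam_ i (cutoff r) <= N * M by rewrite ler_pM2l.
    rewrite ler_norml; apply/andP; split; last exact: le_trans up NM.
    by apply: le_trans lo; rewrite mulNr lerN2.
  by exists l.
have [lam hlam] := choice H; exists lam; split=> //.
apply: (@poslin_lim _ _ I U (@Cc R n) lam_ lam PU (@linclass_Cc _ _)) => // i.
Qed.

(** The measure and the base point move together. The Harnack inequality holds with the same
    constant for all [lam_ i], so moving the base point is a uniformly small relative change. *)
Lemma ultralimit_ker (I : Type) (U : set_system I) (lam_ : I -> (V -> R) -> R) lam (x_ : I -> V) x0 (phi : V -> R) (s : R) :
  ProperFilter U -> (forall i, pos_radon (lam_ i)) -> (forall f, Cc f -> lam_ i f @[i --> U] --> (lam f : R)) ->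
  x_ i @[i --> U] --> x0 -> Cc phi -> (forall x, 0 <= phi x) -> 0 < s ->
  lam_ i (fun y => phi y * ker s (x_ i) y) @[i --> U] --> (lam (fun y => phi y * ker s x0 y) : R).
Proof.
move=> PU pl hl hx cphi phi0 s0.
have cpk x : Cc (fun y => phi y * ker s x y) by apply: Cc_mull => //; exact: continuous_kerr.
have h0 := hl _ (cpk x0); set g0 := lam _ in h0 *.
pose g i x := lam_ i (fun y => phi y * ker s x y).
have gpos i x : 0 <= g i x by apply: (poslin_ge0 (pl i)) => // y; rewrite mulr_ge0 ?ker_ge0.
have d0 : (g i (x_ i) - g i x0) @[i --> U] --> (0 : R).
  apply/cvgrPdist_le => e e0.
  have g1 : 0 < `|g0| + 1 by rewrite ltr_wpDl.
  have e10 : 0 < e / (`|g0| + 1) by rewrite divr_gt0.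
  have gb : \forall i \near U, g i x0 <= `|g0| + 1.
    by move/cvgr_le: h0; apply; apply: le_lt_trans (ler_norm _) _; rewrite ltrDl.
  have hn : \forall i \near U, forall h, harnack q s h ->
      h (x_ i) <= (1 + e / (`|g0| + 1)) * `|h x0| /\ h x0 <= (1 + e / (`|g0| + 1)) * `|h (x_ i)|.
    by have := hx _ (harnack_near q0 x0 s0 e10).
  apply: filterS2 gb hn => i gi hi.
  have [] := hi (g i) (harnack_poslin q0 (@linclass_Cc R n) (pl i) s0 cpk phi0).
  rewrite !(ger0_norm (gpos _ _)) => h1 h2; rewrite sub0r normrN distrC.
  apply: ler_dist_mul h1 h2 => //.
  by rewrite mulrAC ler_pdivrMr // ler_pM2l.
have h1 : (g i (x_ i) - g i x0 + g i x0) @[i --> U] --> 0 + g0 by exact: cvgD d0 h0.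
rewrite add0r in h1; suff -> : (fun i => lam_ i (fun y => phi y * ker s (x_ i) y)) =
  (fun i => g i (x_ i) - g i x0 + g i x0) by [].
by apply/funext => i; rewrite subrK.
Qed.

(** Potentials are nonnegative, so a violation can occur only on the support of [f]. This keeps the
    points [x_ w] bounded, and the potential there, being below [f], bounds the mass of [lam_ w] on
    every ball; hence all limits exist. *)
Lemma regular_lower A z f (d : R) :
  (forall sg, Mplus alpha sg ->
     ne_on alpha A (fun y => (potential alpha (dirac_m z) y <= potential alpha sg y)%E) ->
     forall x, (potential alpha (dirac_m z) x <= potential alpha sg x)%E) ->
  Cc f -> (forall x, 0 <= f x) -> (forall x, ((f x)%:E <= riesz_kernel alpha z x)%E) -> 0 < d ->
  \forall w \near z, forall lam x, Mplus alpha lam ->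
    ne_on alpha A (fun y => (potential alpha (dirac_m w) y <= potential alpha lam y)%E) ->
    ((f x - d)%:E <= potential alpha lam x)%E.
Proof.
move=> Hz cf f0 fz d0.
pose good w (p : ((V -> R) -> R) * V) := [/\ Mplus alpha p.1,
  ne_on alpha A (fun y => (potential alpha (dirac_m w) y <= potential alpha p.1 y)%E) &
  (potential alpha p.1 p.2 < (f p.2 - d)%:E)%E].
pose B := [set w | exists p, good w p].
apply: contrapT => nB.
have {}nB : ~ \forall w \near z, ~ B w.
  move=> H; apply: nB; apply: filterS H => w nBw lam x Ml ne; rewrite leNgt; apply/negP => h.
  by apply: nBw; exists (lam, x).
have PF : ProperFilter (within B (nbhs z)).
  split; last exact: within_filter.
  move=> H; have {}H : \forall w \near z, B w -> False by exact: H.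
  by apply: nB; apply: filterS H.
have [U [UU FU]] := ultraFilterLemma PF.
have PU := @ultra_proper _ _ UU.
have UB : \forall w \near U, B w by apply: FU; exact: withinT.
have Unear (P : set V) : nbhs z P -> U P.
  by move=> zP; apply: FU; apply: filterS zP => w Pw _.
(* Off [B] a dummy Dirac mass is chosen, so that [lam_ w] is a Radon measure for every [w], as the
   limit lemmas require. *)
have H w : exists p, pos_radon p.1 /\ (B w -> good w p).
  have [[p gp]|nb] := pselect (B w); first by exists p; split => //; case: gp => -[].
  by exists (@dirac_m R n 0, 0); split => //; exact: pos_radon_dirac.
have {H}[p_ hp] := choice H.
pose lam_ w := (p_ w).1; pose x_ w := (p_ w).2.
have pl_ w : pos_radon (lam_ w) by case: (hp w).
have Hg w : B w -> good w (p_ w) by case: (hp w).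
have [r [r0 hr]] := Cc_cutoff_eq cf.
have [N [N0 hN]] := Cc_bounded cf.
pose P w := fine (potential alpha (lam_ w) (x_ w)).
have PE w : B w -> [/\ potential alpha (lam_ w) (x_ w) = (P w)%:E, 0 <= P w & P w < f (x_ w) - d].
  move=> /Hg[Ml ne lt]; have p0 := potential_ge0 qE q0 (x_ w) (pl_ w).
  have E : potential alpha (lam_ w) (x_ w) = (P w)%:E.
    by rewrite /P fineK // ge0_fin_numE // (lt_trans lt) // ltey.
  split=> //; first by rewrite -lee_fin -E.
  by rewrite -lte_fin -E.
have xr w : B w -> dist2 0 (x_ w) <= r + 1.
  move=> /PE[_ P0 Pf]; rewrite leNgt; apply/negP => h.
  by move: Pf; rewrite (hr r (lexx _) (x_ w)) cutoff0 ?mul0r; [lra|exact: ltW].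
have r10 : 0 <= r + 1 by rewrite addr_ge0.
have [x0 [x0r hx0]] : exists x0, dist2 0 x0 <= r + 1 /\ x_ w @[w --> U] --> x0.
  have := @compact_dist2 R n 0 (r + 1); rewrite compact_ultra => cK.
  have [|x0 [? ?]] := cK (x_ @ U) (ultra_fmap x_ UU); last by exists x0.
  have : \forall w \near U, dist2 0 (x_ w) <= r + 1 by apply: filterS UB => w; exact: xr.
  by [].
have [lam [pl hlam]] : exists lam, pos_radon lam /\ forall f, Cc f -> lam_ w f @[w --> U] --> (lam f : R).
  apply: bounded_ultralimit => // j j0.
  have [C C0 hC] := radon_local_bound qE q0 r10 j0.
  exists (C * N); apply: filterS UB => w Bw; have [E P0 Pf] := PE w Bw.
  have := hC _ _ (pl_ w) (xr w Bw); rewrite E -EFinM lee_fin => /le_trans; apply.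
  rewrite ler_pM2l //; have := hN (x_ w); rewrite ler_norml => /andP[_]; lra.
have [C0 hC0] : exists C0 : R, P w @[w --> U] --> C0.
  apply: (@ultra_cvg_bounded _ _ _ _ N) => //; apply: filterS UB => w Bw.
  have [E P0 Pf] := PE w Bw; rewrite ger0_norm //.
  by have := hN (x_ w); rewrite ler_norml => /andP[_]; lra.
have hfx : f (x_ w) @[w --> U] --> f x0.
  by apply: (@cvg_comp _ _ _ x_ f U (nbhs x0)) => //; case: cf => + _; apply.
have C0f : C0 + d <= f x0.
  have h : (f (x_ w) - P w) @[w --> U] --> f x0 - C0 by exact: cvgB.
  have : d <= f x0 - C0.
    by apply: (cvgr_to_ge h); apply: filterS UB => w /PE[_ _]; lra.
  by lra.
have hker phi s : Cc phi -> (forall x, 0 <= phi x) -> 0 < s ->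
    lam_ w (fun y => phi y * ker s (x_ w) y) @[w --> U] --> (lam (fun y => phi y * ker s x0 y) : R).
  by move=> cphi phi0 s0; exact: ultralimit_ker.
have le_P chi s w : B w -> Cc chi -> (forall y, 0 <= chi y <= 1) -> 0 < s ->
    lam_ w (fun y => chi y * ker s (x_ w) y) <= P w.
  move=> /PE[E _ _] cchi chi01 s0; rewrite -lee_fin -E; exact: cut_ker_le_potential.
have cut01 (j : R) y : 0 <= @cutoff R n j y <= 1 by rewrite cutoff_ge0 cutoff_le1.
have kk_le j (rho : R) : j%:R <= rho -> lam (kk j x0) <= lam (fun y => cutoff rho y * ker (tr R j) x0 y).
  move=> jr; apply: (poslin_le (@linclass_Cc R n) pl) => [||y]; [exact: Cc_kk|apply: Cc_cutker => //; exact: tr_gt0|].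
  rewrite /cker -[leRHS]mul1r; apply: ler_pM; rewrite ?cutoff_ge0 ?cutoff_le1 ?mulr_ge0 ?cutoff_ge0 ?ker_ge0 //.
  by apply: ler_wpM2r; [exact: ker_ge0|exact: le_cutoff].
have pot_le : (potential alpha lam x0 <= C0%:E)%E.
  rewrite (potentialE qE q0) //; apply: esup_le => j; rewrite lee_fin.
  apply: le_trans (kk_le j _ (lexx _)) _.
  have tj := tr_gt0 R j; have cj := @Cc_cutoff R n j%:R.
  apply: (ler_cvg_to (hker _ _ cj (@cutoff_ge0 _ _ _) tj) hC0).
  by apply: filterS UB => w Bw; apply: le_P.
have pot0 := potential_ge0 qE q0 x0 pl.
pose c1 := fine (potential alpha lam x0).
have c1E : potential alpha lam x0 = c1%:E.
  by rewrite /c1 fineK // ge0_fin_numE // (le_lt_trans pot_le) // ltey.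
have c10 : 0 <= c1 by rewrite -lee_fin -c1E.
have c1C : c1 <= C0 by rewrite -lee_fin -c1E.
pose d1 := d / 4; have d10 : 0 < d1 by rewrite divr_gt0.
(* [C0 - c1] is the potential lost at [x0] in the limit; [d1] makes [c] positive. The choice of [e]
   below gives [(1 + 3 * e) * (C0 + d1) < C0 + d <= f x0], against [f <=] kernel of [z]. *)
pose c := C0 - c1 + d1; have c0 : 0 < c by rewrite ltr_wpDl // subr_ge0.
have C00 : 0 <= C0 by exact: le_trans c1C.
have Cd : 0 < 8 * (C0 + d) by rewrite mulr_gt0 // ltr_wpDl.
pose e := d / (8 * (C0 + d)); have e0 : 0 < e by rewrite divr_gt0.
have e1 : e <= 1 by rewrite ler_pdivrMr // mul1r; lra.
have eE : e * (8 * (C0 + d)) = d by rewrite /e divfK // lt0r_neq0.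
suff H2 : forall theta r, poslin (@Cont R n) theta -> 0 <= r -> supported r theta -> uniform_tail q theta ->
     (energy alpha theta < +oo)%E -> concentrated theta A ->
     (potential alpha theta z <= uint theta (potential alpha lam) + (theta (fun=> 1) * c)%:E)%E.
  have e01 : 0 < e <= 1 by rewrite e0.
  have := escape_bound n0 qE q0 pl c1E c0 Hz H2 e01.
  rewrite (riesz_kernelC qE) => /(le_trans (fz x0)); rewrite lee_fin => h.
  have : (1 + e) * (c1 + c * (1 + e)) <= (1 + e) * ((C0 + d1) * (1 + e)).
    apply: ler_wpM2l; first lra.
    by rewrite /c; have : 0 <= c1 * e by [apply: mulr_ge0 => //; exact: ltW]; move: e0 d10; clear; nra.
  move=> h2; have h3 := le_trans h h2.
  have ee : e * e <= e * 1 by apply: ler_wpM2l => //; exact: ltW.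
  have Cd1 : 0 <= C0 + d1 by apply: addr_ge0 => //; exact: ltW.
  have h4 : (1 + e) * ((C0 + d1) * (1 + e)) <= (1 + 3 * e) * (C0 + d1).
    have -> : (1 + e) * ((C0 + d1) * (1 + e)) = (1 + 2 * e + e * e) * (C0 + d1) by ring.
    by apply: ler_wpM2r => //; lra.
  have h5 : e * d1 <= e * d by apply: ler_wpM2l; [exact: ltW|rewrite /d1; lra].
  by move: h5 h4 h3 eE C0f d0 e0; rewrite /d1; clear; lra.
move=> th r1 pt r10' st ut eth cA.
have pth := poslin_Cont_radon pt.
have m0 : 0 <= th (fun=> 1) by apply: (poslin_ge0 pt) => //; exact: continuous_cst.
have I0 : (0 <= uint th (potential alpha lam))%E.
  by apply: (uint_ge0 pth) => x; exact: (potential_ge0 qE q0 x pl).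
have [->|Iy] := eqVneq (uint th (potential alpha lam)) +oo%E; first by rewrite addye // leey.
have [I IE] : exists I : R, uint th (potential alpha lam) = I%:E.
  by exists (fine (uint th (potential alpha lam))); rewrite fineK // ge0_fin_numE // ltey.
rewrite IE -EFinD (potentialE qE q0) //; apply: esup_le => i.
rewrite lee_fin; apply/ler_addgt0Pr => e2 e20.
pose c' := C0 - c1; have c'0 : 0 <= c' by rewrite subr_ge0.
have cd0 : 0 < c' + d1 / 4 by rewrite ltr_wpDl // divr_gt0.
(* Then [(1 + ea) * (c' + d1 / 4) = c' + d1 / 2 <= c]: one quarter of [d1] pays for the truncation
   at stage [j], another for the relative error [ea]. *)
pose ea := (d1 / 4) / (c' + d1 / 4); have ea0 : 0 < ea by rewrite divr_gt0 // divr_gt0.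
have eaE : ea * (c' + d1 / 4) = d1 / 4 by rewrite /ea divfK // lt0r_neq0.
have [rho0 rho00 hsplit] := uint_potential_split qE q0 pt st ut ea0 r10 r10'.
have [j hj] : exists j, c1 - d1 / 4 < lam (kk j x0).
  apply: (@esup_gt _ _ (fun j x => lam (kk j x)) x0); rewrite -(potentialE qE q0) // c1E lte_fin.
  by rewrite ltrBlDr ltrDl divr_gt0.
pose rho := Num.max rho0 j%:R; have rho1 : rho0 <= rho by rewrite le_max lexx.
have rhoj : j%:R <= rho by rewrite le_max lexx orbT.
have hj' := lt_le_trans hj (kk_le j rho rhoj).
have lamc : 0 <= lam (cutoff rho) by apply: (poslin_ge0 pl) => [|x]; [exact: Cc_cutoff|exact: cutoff_ge0].
pose e' := e2 / (lam (cutoff rho) + 1).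
have e'0 : 0 < e' by rewrite divr_gt0 // ltr_wpDl.
have e'E : e' * lam (cutoff rho) <= e2.
  rewrite /e' mulrAC ler_pdivrMr ?ltr_wpDl // ler_pM2l //.
  by rewrite lerDl.
have [s0 s00 hs] := hsplit e' e'0.
have tj := tr_gt0 R j.
have cths : continuous (fun y => th (ker s0 y)).
  apply: (@harnack_continuous _ _ q q0 s0) => //.
    by move=> y; apply: (poslin_ge0 pt) => [|v]; [exact: Cont_ker|exact: ker_ge0].
  have -> : (fun y => th (ker s0 y)) = (fun y => th (fun v => 1 * ker s0 y v)).
    by apply/funext => y; congr th; apply/funext => v; rewrite mul1r.
  apply: (harnack_poslin (c := fun=> 1) q0 (@linclass_Cont R n) pt s00 _ _) => // y.
  by apply: (linclass_Cont _ _).2; exact: Cont_ker.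
have ccut := @Cc_cutoff R n rho.
pose G y := cutoff rho y * (th (ker s0 y) + e').
have cG : Cc G by apply: Cc_mull => //; apply: continuous_add => //; exact: continuous_cst.
(* The potential of [th] at [w] is at most the integral of the potential of [lam_ w] against [th],
   since [th] ignores exceptional sets. Fubini and the splitting at [rho] bound that integral by
   terms that converge along [U]. *)
have ev : \forall w \near U, th (kk i w) <= lam_ w G + 
    (1 + ea) * th (fun=> 1) * (P w - lam_ w (fun y => cutoff rho y * ker (tr R j) (x_ w) y)).
  apply: filterS UB => w Bw; have [E _ _] := PE w Bw; have [Ml ne _] := Hg w Bw.
  rewrite -lee_fin; apply: le_trans (hs rho (tr R j) (x_ w) (lam_ w) (P w) rho1 tj (xr w Bw) (pl_ w) E).
  rewrite -(fubini_potential qE q0) //.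
  apply: (@le_trans _ _ (potential alpha th w)); last exact: (ne_potential_le qE q0 pth (pl_ w) eth cA ne).
  by rewrite (potentialE qE q0) //; exact: (@esup_ge _ _ (fun j x => th (kk j x))).
have lim1 : th (kk i w) @[w --> U] --> th (kk i z).
  apply: (@cvg_comp _ _ _ id (fun w => th (kk i w)) U (nbhs z)) => //.
  by have [+ _] := Cc_pot q0 i pth; apply.
have lim2 : (lam_ w G + (1 + ea) * th (fun=> 1) * (P w - lam_ w (fun y => cutoff rho y * ker (tr R j) (x_ w) y))) @[w --> U] -->
   lam G + (1 + ea) * th (fun=> 1) * (C0 - lam (fun y => cutoff rho y * ker (tr R j) x0 y)).
  apply: cvgD; first exact: hlam.
  apply: cvgM; first exact: cvg_cst.
  by apply: cvgB => //; apply: hker => // x; exact: cutoff_ge0.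
apply: (le_trans (ler_cvg_to lim1 lim2 ev)).
have GI : lam G <= I + e2.
  have cc1 : Cc (fun y => cutoff rho y * th (ker s0 y)) by exact: Cc_mull.
  have -> : G = fun y => cutoff rho y * th (ker s0 y) + e' * cutoff rho y.
    by apply/funext => y; rewrite /G mulrDr [cutoff rho y * e']mulrC.
  rewrite (poslinD pl) //; last exact: Cc_scale.
  rewrite (poslinZ pl) //; apply: lerD => //.
  rewrite -lee_fin -IE (fubini_potential qE q0) //; apply: uint_ge => // y.
    rewrite mulr_ge0 ?cutoff_ge0 //; apply: (poslin_ge0 pt) => [|v]; [exact: Cont_ker|exact: ker_ge0].
  apply: le_trans (le_ker_potential qE q0 y pt st s00); rewrite lee_fin -[leRHS]mul1r.
  apply: ler_wpM2r; last exact: cutoff_le1.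
  by apply: (poslin_ge0 pt) => [|v]; [exact: Cont_ker|exact: ker_ge0].
have : (1 + ea) * th (fun=> 1) * (C0 - lam (fun y => cutoff rho y * ker (tr R j) x0 y)) <= th (fun=> 1) * c.
  rewrite [(1 + ea) * _]mulrC -mulrA; apply: ler_wpM2l => //.
  apply: (@le_trans _ _ ((1 + ea) * (c' + d1 / 4))).
    apply: ler_wpM2l; first by rewrite addr_ge0 // ltW.
    by move: hj'; rewrite /c'; clear; lra.
  by rewrite mulrDl mul1r eaE /c -/c'; have := d10; clear; lra.
by move: GI; clear; lra.
Qed.

End Regular.

(** * The maximum principle in the half-space *)

Section Taylor.
Variables (R : realType).
Implicit Types (Q q u v r t h a b : R).

Lemma bernoulli Q u : 0 < Q -> -1 < u -> 1 - Q * u <= (1 + u) `^ (- Q).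
Proof.
move=> Q0 u1; have u0 : 0 < 1 + u by lra.
rewrite /powR gt_eqF //; apply: le_trans (expR_ge1Dx _).
rewrite lerD2l mulNr lerN2 ler_pM2l //; exact: le_ln1Dx.
Qed.

(** Bernoulli's inequality for the reciprocal of [1 + u], multiplied back by [(1 + u)^(-Q)]. *)
Lemma bernoulli_up Q u : 0 < Q -> -1 < u -> (1 + u) `^ (- Q) <= 1 - Q * u * (1 + u) `^ (- Q - 1).
Proof.
move=> Q0 u1; have u0 : 0 < 1 + u by lra.
have h : -1 < - u / (1 + u) by rewrite ltr_pdivlMr //; lra.
have := bernoulli Q0 h.
have -> : 1 + - u / (1 + u) = (1 + u)^-1 by field; exact: lt0r_neq0.
rewrite -[(1 + u)^-1]powR_inv1 ?(ltW u0) // -powRrM mulN1r opprK.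
set X := (1 + u) `^ (- Q); set Y := (1 + u) `^ Q.
have X0 : 0 < X by rewrite powR_gt0.
have XY : X * Y = 1 by rewrite -powRD ?addNr ?powRr0 // eqxx lt0r_neq0.
have -> : (1 + u) `^ (- Q - 1) = X / (1 + u).
  by rewrite powRB ?powRr1 ?(ltW u0) //; apply/implyP => _; exact: lt0r_neq0.
move=> H; have := ler_wpM2l (ltW X0) H; rewrite XY.
rewrite powR_inv1 ?(ltW u0) //.
have -> : X * (1 - Q * (- u / (1 + u))) = X + Q * u * (X / (1 + u)) by ring.
by lra.
Qed.

(** The two Bernoulli bounds for [Q] reduce the error to [Q * u * (1 - w)], and those for [Q + 1]
    bound [1 - w] by a multiple of [u]. *)
Lemma powRN_taylor1 Q : 0 < Q -> exists2 C, 0 < C & forall u, `|u| <= 2^-1 ->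
  `|(1 + u) `^ (- Q) - (1 - Q * u)| <= C * u ^+ 2.
Proof.
move=> Q0; have Q1 : 0 < Q + 1 by lra.
pose K := (2^-1 : R) `^ (- (Q + 1) - 1); have K0 : 0 < K by rewrite powR_gt0 // invr_gt0.
exists (Q * (Q + 1) * (1 + K)).
  by rewrite mulr_gt0 ?mulr_gt0 // ltr_wpDr // ltW.
move=> u; rewrite ler_norml => /andP[u1 u2].
have um1 : -1 < u by lra.
have u0 : 0 < 1 + u by lra.
have h1 := bernoulli Q0 um1; have h2 := bernoulli_up Q0 um1.
rewrite ger0_norm ?subr_ge0 //.
rewrite (_ : - Q - 1 = - (Q + 1)) in h2; last by ring.
set w := (1 + u) `^ (- (Q + 1)) in h2 *.
have h3 := bernoulli Q1 um1; have h4 := bernoulli_up Q1 um1; rewrite -/w in h3 h4.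
set w2 := (1 + u) `^ (- (Q + 1) - 1) in h4.
have w20 : 0 <= w2 by exact: powR_ge0.
have w2K : w2 <= K.
  have E : - (Q + 1) - 1 = - (Q + 2) by ring.
  by rewrite /w2 /K E; apply: powRN_le; rewrite ?invr_gt0 //; lra.
have qq : 0 <= Q * (Q + 1) by rewrite mulr_ge0 // ltW.
have uu : 0 <= u ^+ 2 by exact: sqr_ge0.
apply: (@le_trans _ _ (Q * (u * (1 - w)))).
  by rewrite -/w; move: h2; lra.
have [up|un] := leP 0 u.
  have : u * (1 - w) <= u * ((Q + 1) * u) by apply: ler_wpM2l => //; lra.
  move=> h; apply: (@le_trans _ _ (Q * (u * ((Q + 1) * u)))); first by rewrite ler_pM2l.
  have -> : Q * (u * ((Q + 1) * u)) = Q * (Q + 1) * u ^+ 2 by ring.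
  rewrite [leRHS]mulrAC -[leLHS]mulr1; apply: ler_wpM2l; first exact: mulr_ge0.
  by rewrite lerDl ltW.
have h5 : w - 1 <= (- u) * ((Q + 1) * K).
  apply: (@le_trans _ _ (- u * ((Q + 1) * w2))); first by lra.
  by apply: ler_wpM2l; [lra|rewrite ler_pM2l].
have h6 : (- u) * (w - 1) <= (- u) * ((- u) * ((Q + 1) * K)) by apply: ler_wpM2l => //; lra.
have -> : u * (1 - w) = (- u) * (w - 1) by ring.
apply: (@le_trans _ _ (Q * ((- u) * ((- u) * ((Q + 1) * K))))); first by rewrite ler_pM2l.
have -> : Q * ((- u) * ((- u) * ((Q + 1) * K))) = Q * (Q + 1) * u ^+ 2 * K by ring.
rewrite [leRHS]mulrAC; apply: ler_wpM2l; first exact: mulr_ge0.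
by rewrite lerDr ler01.
Qed.

(** The mean value theorem; the derivative of the error is [- q] times the first-order error for the
    exponent [q + 1]. *)
Lemma powRN_taylor2 q : 0 < q -> exists2 C, 0 < C & forall u, `|u| <= 2^-1 ->
  `|(1 + u) `^ (- q) - (1 - q * u + q * (q + 1) / 2 * u ^+ 2)| <= C * `|u| ^+ 3.
Proof.
move=> q0; have q1 : 0 < q + 1 by lra.
have [C C0 hC] := powRN_taylor1 q1; exists (q * C); first by rewrite mulr_gt0.
pose f v : R := v `^ (- q) - (1 - q * (v - 1) + q * (q + 1) / 2 * (v - 1) ^+ 2).
pose df v : R := - q * (v `^ (- q - 1) - (1 - (q + 1) * (v - 1))).
have fd (v : R) : 0 < v -> is_derive v 1 f (df v).
  move=> v0; have := is_derive1_powR (- q) v0 => hd.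
  apply: is_derive_eq; rewrite /df /GRing.scale /=.
  by set w := v `^ _; field.
have f1 : f 1 = 0 by rewrite /f powR1; ring.
have dfb (v : R) : `|v - 1| <= 2^-1 -> `|df v| <= q * C * `|v - 1| ^+ 2.
  move=> hv; rewrite /df normrM normrN (gtr0_norm q0) -mulrA ler_pM2l //.
  have := hC _ hv; have -> : 1 + (v - 1) = v by ring.
  have -> : - (q + 1) = - q - 1 by ring.
  by rewrite real_normK ?num_real.
have key (v : R) : `|v - 1| <= 2^-1 -> `|f v| <= q * C * `|v - 1| ^+ 3.
  move=> hv; have := hv; rewrite ler_norml => /andP[hv1 hv2].
  have cf (a b : R) : 0 < a -> {within `[a, b], continuous f}.
    move=> a0; apply: derivable_within_continuous => x; rewrite in_itv /= => /andP[ax _].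
    by have [] := fd x (lt_le_trans a0 ax).
  have [c [cv cE]] : exists c, `|c - 1| <= `|v - 1| /\ `|f v| = `|df c| * `|v - 1|.
    have [v1|v1] := leP 1 v.
      have [||c] := @MVT_segment R f df 1 v v1.
      - by move=> x; rewrite in_itv /= => /andP[x1 _]; apply: fd; lra.
      - exact: cf.
      rewrite in_itv /= => /andP[c1 c2]; rewrite f1 subr0 => E; exists c; split; last by rewrite E normrM.
      by rewrite !ger0_norm ?subr_ge0 // lerD2r.
    have v0 : 0 < v by lra.
    have [||c] := @MVT_segment R f df v 1 (ltW v1).
    - by move=> x; rewrite in_itv /= => /andP[x1 _]; apply: fd; lra.
    - exact: cf.
    rewrite in_itv /= => /andP[c1 c2]; rewrite f1 sub0r => E; exists c; split.
      by rewrite !ler0_norm ?subr_le0 ?(ltW v1) // lerN2 lerD2r.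
    by rewrite -normrN E normrM [`|1 - v|]distrC.
  rewrite cE exprSr mulrA; apply: ler_pM => //; apply: le_trans (dfb c (le_trans cv hv)) _.
  by apply: ler_wpM2l; [rewrite mulr_ge0 // ltW|rewrite lerXn2r ?nnegrE].
move=> u hu; have := key (1 + u); rewrite /f.
by have E : 1 + u - 1 = u; [ring|rewrite !E => /(_ hu)].
Qed.

End Taylor.

Section MaximumPrinciple.
Variables (R : realType) (n : nat) (alpha q : R).
Hypotheses (n0 : (0 < n)%N) (qE : q = (n%:R - alpha) / 2) (q0 : 0 < q) (al : 0 < alpha <= 2).
Notation V := 'rV[R]_n.
Notation ker := (rker q).
Implicit Types (x y z : V) (L : (V -> R) -> R) (h a b r t : R).

(** One step of length [h] on the grid. With [r = |y - x|^2 + a^2], the case [t = y_i - x_i] is a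
    horizontal step and [t = a] a vertical one; both satisfy [t^2 <= r], which makes the relative
    increment of order [h / a1]. *)
Lemma powRN_step a1 : 0 < a1 -> exists2 K : R, 0 < K & forall r t h, a1 ^+ 2 <= r -> t ^+ 2 <= r ->
  `|h| <= a1 / 8 ->
  `|(r + (2 * h * t + h ^+ 2)) `^ (- q) - r `^ (- q) * (1 - q * ((2 * h * t + h ^+ 2) / r) +
     q * (q + 1) / 2 * ((2 * h * t + h ^+ 2) / r) ^+ 2)| <= K * `|h| ^+ 3.
Proof.
move=> a0; have [C C0 hC] := powRN_taylor2 q0.
have a20 : 0 < a1 ^+ 2 by rewrite exprn_gt0.
have A0 : 0 < (a1 ^+ 2) `^ (- q) by rewrite powR_gt0.
exists ((a1 ^+ 2) `^ (- q) * (C * (4 / a1) ^+ 3)).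
  by apply: mulr_gt0 => //; apply: mulr_gt0 => //; apply: exprn_gt0; rewrite divr_gt0.
move=> r t h ar tr ha; have r0 : 0 < r := lt_le_trans a20 ar.
set s := 2 * h * t + h ^+ 2; pose u := s / r.
have h8 : h ^+ 2 <= a1 ^+ 2 / 64.
  have : `|h| ^+ 2 <= (a1 / 8) ^+ 2 by rewrite lerXn2r ?nnegrE ?divr_ge0 // ltW.
  by rewrite real_normK ?num_real // expr_div_n; have -> : (8 ^+ 2 : R) = 64 by ring.
have hr : h ^+ 2 <= r by apply: le_trans h8 _; have := ltW a20; lra.
have h20 := sqr_ge0 h.
have s2 : s ^+ 2 <= 16 * h ^+ 2 * r.
  have : s ^+ 2 <= 2 * (4 * h ^+ 2 * t ^+ 2) + 2 * (h ^+ 2 * h ^+ 2).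
    by rewrite -subr_ge0 [X in 0 <= X](_ : _ = (2 * h * t - h ^+ 2) ^+ 2) ?sqr_ge0 // /s; ring.
  have : h ^+ 2 * t ^+ 2 <= h ^+ 2 * r by apply: ler_wpM2l.
  have : h ^+ 2 * h ^+ 2 <= h ^+ 2 * r by apply: ler_wpM2l.
  have : 0 <= h ^+ 2 * r by rewrite mulr_ge0 // ltW.
  by lra.
have ub : `|u| <= 4 / a1 * `|h|.
  rewrite -ler_sqr ?nnegrE ?mulr_ge0 ?invr_ge0 ?(ltW a0) // real_normK ?num_real //.
  rewrite /u exprMn exprVn ler_pdivrMr ?exprn_gt0 //; apply: le_trans s2 _.
  have -> : (4 / a1 * `|h|) ^+ 2 * r ^+ 2 = 16 * h ^+ 2 * r * (r / a1 ^+ 2).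
    rewrite !exprMn real_normK ?num_real // exprVn; ring.
  rewrite -[leLHS]mulr1; apply: ler_wpM2l; first by apply: mulr_ge0; [lra|exact: ltW].
  by rewrite ler_pdivlMr // mul1r.
have u2 : `|u| <= 2^-1.
  apply: le_trans ub _; rewrite mulrAC ler_pdivrMr //; lra.
have -> : r + s = r * (1 + u) by rewrite /u; field; exact: lt0r_neq0.
have u1p : 0 <= 1 + u by move: u2; rewrite ler_norml => /andP[u21 _]; lra.
rewrite powRM ?(ltW r0) //.
rewrite -mulrBr normrM (ger0_norm (powR_ge0 _ _)) -[leRHS]mulrA.
apply: ler_pM => //; [exact: powR_ge0|exact: (powRN_le q0 a20 ar)|].
apply: le_trans (hC u u2) _; rewrite -mulrA ler_pM2l // -exprMn.
by rewrite lerXn2r ?nnegrE // mulr_ge0 // ?divr_ge0 // ltW.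
Qed.

Definition shift (i : 'I_n) h y : V := y + h *: delta_mx ord0 i.

Lemma dist2_shift i h y x :
  dist2 (shift i h y) x = dist2 y x + (2 * h * (y ord0 i - x ord0 i) + h ^+ 2).
Proof.
rewrite /dist2 (bigD1 i) //= [in RHS](bigD1 i) //= !mxE !eqxx /= mulr1.
rewrite (eq_bigr (fun j => (y ord0 j - x ord0 j) ^+ 2)); first by ring.
by move=> j ji; rewrite !mxE eqxx (negbTE ji) /= mulr0 addr0.
Qed.

(* discretization of the Caffarelli-Silvestre operator, [b = 1 - alpha] *)
Definition dlap b (F : V -> R -> R) y a h :=
  \sum_(i < n) (F (shift i h y) a + F (shift i (- h) y) a - 2 * F y a)
  + ((1 + b * h / (2 * a)) * (F y (a + h) - F y a) + (1 - b * h / (2 * a)) * (F y (a - h) - F y a)).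

(** Consistency of the scheme: the [h^2] terms cancel because [2 * q = n - alpha] matches the drift
    coefficient [1 - alpha]. What is left is of order [h^3], uniformly in [x] and [y], hence
    integrable against a finite measure. *)
Lemma dlap_ker a1 : 0 < a1 -> exists2 K : R, 0 < K & forall x y a h, a1 <= a -> 0 < h -> h <= a1 / 8 -> h <= 1 ->
  `|dlap (1 - alpha) (fun y a => ker (a ^+ 2) y x) y a h| <= K * h ^+ 3.
Proof.
move=> a0; have [K K0 hK] := powRN_step a0.
have a20 : 0 < a1 ^+ 2 by rewrite exprn_gt0.
pose b := 1 - alpha.
have b1 : `|b| <= 1 by rewrite /b ler_norml; case/andP: al; lra.
pose K2 := (a1 ^+ 2) `^ (- q) * (q * (q + 1) * (n%:R + 3)) / (a1 ^+ 2) ^+ 2.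
have q1 : 0 < q * (q + 1) by rewrite mulr_gt0 // addr_gt0.
have n3 : 0 < n%:R + 3 :> R by rewrite ltr_wpDl.
have K20 : 0 < K2.
  apply: divr_gt0; last by rewrite exprn_gt0.
  by apply: mulr_gt0; [rewrite powR_gt0|exact: mulr_gt0].
exists ((2 * n%:R + 4) * K + K2).
  by rewrite addr_gt0 // mulr_gt0 // ltr_wpDl // mulr_ge0.
move=> x y a h aa h0 ha h1; pose r := dist2 y x + a ^+ 2.
have a00 : 0 < a := lt_le_trans a0 aa.
have ar : a1 ^+ 2 <= r.
  apply: le_trans (_ : a ^+ 2 <= _); first by rewrite lerXn2r ?nnegrE // ltW.
  by rewrite lerDr dist2_ge0.
have r0 := lt_le_trans a20 ar.
have hh : `|h| = h by rewrite ger0_norm // ltW.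
have hhN : `|- h| = h by rewrite normrN hh.
pose P t k := r `^ (- q) * (1 - q * ((2 * k * t + k ^+ 2) / r) +
     q * (q + 1) / 2 * ((2 * k * t + k ^+ 2) / r) ^+ 2).
pose T i := y ord0 i - x ord0 i.
have Tr i : T i ^+ 2 <= r.
  by apply: le_trans (dist2_coord _ _ _) _; rewrite lerDl sqr_ge0.
have ar2 : a ^+ 2 <= r by rewrite lerDr dist2_ge0.
have kS i k : ker (a ^+ 2) (shift i k y) x = (r + (2 * k * T i + k ^+ 2)) `^ (- q).
  by rewrite /rker dist2_shift /r /T; congr (_ `^ _); ring.
have kA k : ker ((a + k) ^+ 2) y x = (r + (2 * k * a + k ^+ 2)) `^ (- q).
  by rewrite /rker /r; congr (_ `^ _); ring.
pose b' := b * h / (2 * a).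
have b'1 : `|b'| <= 1.
  have a2 : 0 < 2 * a by rewrite mulr_gt0.
  rewrite /b' normrM normrM hh normfV (gtr0_norm a2) ler_pdivrMr // mul1r.
  apply: le_trans (_ : 1 * h <= _); first by apply: ler_wpM2r => //; exact: ltW.
  by lra.
have [b'l b'u] : -1 <= b' /\ b' <= 1 by move: b'1; rewrite ler_norml => /andP.
pose D t k := (r + (2 * k * t + k ^+ 2)) `^ (- q) - P t k.
have Db t k : t ^+ 2 <= r -> `|k| = h -> `|D t k| <= K * h ^+ 3.
  by move=> tr kh; rewrite -kh; apply: hK => //; rewrite kh.
(* On the quadratic Taylor polynomials the scheme is computed exactly; the sum of the [T i ^+ 2] is
   [r - a ^+ 2], and only an [h^4] term survives. *)
have main : \sum_(i < n) (P (T i) h + P (T i) (- h) - 2 * r `^ (- q)) +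
   ((1 + b') * (P a h - r `^ (- q)) + (1 - b') * (P a (- h) - r `^ (- q))) =
   r `^ (- q) * (q * (q + 1) * (n%:R + 1 + 2 * b)) * h ^+ 4 / r ^+ 2.
  pose Ac := r `^ (- q) * (- q * (2 * h ^+ 2 / r) + q * (q + 1) * h ^+ 4 / r ^+ 2).
  pose Bc := r `^ (- q) * (q * (q + 1) * 4 * h ^+ 2 / r ^+ 2).
  have -> : \sum_(i < n) (P (T i) h + P (T i) (- h) - 2 * r `^ (- q)) = n%:R * Ac + Bc * (r - a ^+ 2).
    rewrite (eq_bigr (fun i => Ac + Bc * T i ^+ 2)); last first.
      move=> i _; rewrite /P /Ac /Bc; set X := r `^ _; field; exact: lt0r_neq0.
    rewrite big_split /= sumr_const card_ord -[Ac *+ n]mulr_natl -mulr_sumr.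
    have -> : r - a ^+ 2 = dist2 y x by rewrite /r addrK.
    by [].
  have alE : alpha = n%:R - 2 * q by rewrite qE; field.
  rewrite /Ac /Bc /P /b' /b alE; set X := r `^ _; field.
  by rewrite !lt0r_neq0.
pose S0 := \sum_(i < n) (D (T i) h + D (T i) (- h)) + ((1 + b') * D a h + (1 - b') * D a (- h)).
have E : dlap (1 - alpha) (fun y a => ker (a ^+ 2) y x) y a h = S0 +
    r `^ (- q) * (q * (q + 1) * (n%:R + 1 + 2 * b)) * h ^+ 4 / r ^+ 2.
  have ky : ker (a ^+ 2) y x = r `^ (- q) by [].
  rewrite -main /S0 /dlap -/b -/b' addrACA -big_split /=; congr (_ + _).
    by apply: eq_bigr => i _; rewrite !kS ky /D; ring.
  by rewrite !kA ky /D; ring.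
rewrite E; apply: le_trans (ler_normD _ _) _; rewrite [leRHS]mulrDl; apply: lerD.
  have h3 : 0 <= K * h ^+ 3 by rewrite mulr_ge0 ?exprn_ge0 // ltW.
  apply: le_trans (ler_normD _ _) _.
  have -> : (2 * n%:R + 4) * K * h ^+ 3 = n%:R * (2 * (K * h ^+ 3)) + 4 * (K * h ^+ 3) by ring.
  apply: lerD.
    apply: le_trans (ler_norm_sum _ _ _) _.
    apply: (@le_trans _ _ (\sum_(i < n) (2 * (K * h ^+ 3)))).
      apply: ler_sum => i _; apply: le_trans (ler_normD _ _) _.
      by have := Db (T i) h (Tr i) hh; have := Db (T i) (- h) (Tr i) hhN; lra.
    by rewrite sumr_const card_ord -[leLHS]mulr_natl.
  apply: le_trans (ler_normD _ _) _; rewrite !normrM.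
  have d1 := Db a h ar2 hh; have d2 := Db a (- h) ar2 hhN.
  have n1 : `|1 + b'| <= 2 by rewrite ler_norml; lra.
  have n2 : `|1 - b'| <= 2 by rewrite ler_norml; lra.
  have := ler_pM (normr_ge0 _) (normr_ge0 _) n1 d1; have := ler_pM (normr_ge0 _) (normr_ge0 _) n2 d2.
  by lra.
have b3 : `|n%:R + 1 + 2 * b| <= n%:R + 3.
  have : 0 <= n%:R :> R by [].
  by move: b1; rewrite !ler_norml; lra.
have rq : r `^ (- q) <= (a1 ^+ 2) `^ (- q) by exact: powRN_le.
have ri : (r ^+ 2)^-1 <= ((a1 ^+ 2) ^+ 2)^-1.
  by rewrite lef_pV2 ?posrE ?exprn_gt0 // lerXn2r ?nnegrE ?(ltW a20) ?(ltW r0).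
have h43 : h ^+ 4 <= h ^+ 3.
  by rewrite [h ^+ 4]exprS -[leRHS]mul1r; apply: ler_wpM2r => //; rewrite exprn_ge0 // ltW.
have i0 : 0 <= (r ^+ 2)^-1 by rewrite invr_ge0 exprn_ge0 // ltW.
have h40 : 0 <= h ^+ 4 by rewrite exprn_ge0 // ltW.
have A1 : 0 <= r `^ (- q) * (q * (q + 1)) by rewrite mulr_ge0 ?powR_ge0 // ltW.
have A2 : 0 <= (r ^+ 2)^-1 * h ^+ 4 by exact: mulr_ge0.
have -> : r `^ (- q) * (q * (q + 1) * (n%:R + 1 + 2 * b)) * h ^+ 4 / r ^+ 2 =
  (r `^ (- q) * (q * (q + 1))) * (n%:R + 1 + 2 * b) * ((r ^+ 2)^-1 * h ^+ 4) by ring.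
rewrite normrM (ger0_norm A2) normrM (ger0_norm A1).
have -> : K2 * h ^+ 3 = ((a1 ^+ 2) `^ (- q) * (q * (q + 1))) * (n%:R + 3) * (((a1 ^+ 2) ^+ 2)^-1 * h ^+ 3).
  by rewrite /K2; ring.
apply: ler_pM => //; first by rewrite mulr_ge0.
  apply: ler_pM => //; apply: ler_wpM2r => //; exact: ltW.
exact: ler_pM.
Qed.

End MaximumPrinciple.

(** * Comparison of extended potentials in the half-space *)

Section Uniqueness.
Variables (R : realType) (n : nat) (alpha q : R).
Hypotheses (n0 : (0 < n)%N) (qE : q = (n%:R - alpha) / 2) (q0 : 0 < q) (al : 0 < alpha <= 2).
Notation V := 'rV[R]_n.
Notation ker := (rker q).
Implicit Types (x y z : V) (L : (V -> R) -> R) (h a b r t s : R).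

(** Positive functionals on bounded continuous functions may have mass at infinity; tightness
    excludes this and makes the extended potentials decay. *)
Definition tight L := forall e : R, 0 < e -> exists2 rho : R, 0 <= rho & L (fun x => 1 - cutoff rho x) <= e.

Lemma Cb_scale (c : R) (f : V -> R) : Cb f -> Cb (fun x => c * f x).
Proof. exact: (@linclass_Cb R n).2. Qed.

Lemma Cb_add (f g : V -> R) : Cb f -> Cb g -> Cb (fun x => f x + g x).
Proof. exact: (@linclass_Cb R n).1. Qed.

Lemma Cb_ker s y : 0 < s -> Cb (ker s y).
Proof.
move=> s0; split; first exact: continuous_kerr.
by exists (s `^ (- q)) => x; rewrite ger0_norm ?ker_ge0 // ker_le.
Qed.

Lemma Cb_cut1 (rho : R) : Cb (fun x : V => 1 - cutoff rho x).
Proof.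
have -> : (fun x : V => 1 - cutoff rho x) = (fun x => 1 + (-1) * cutoff rho x).
  by apply/funext => x; rewrite mulN1r.
apply: Cb_add; first exact: Cb_cst.
by apply: Cb_scale; apply: Cc_Cb; exact: Cc_cutoff.
Qed.

Lemma ker_decay L a1 (e : R) : poslin (@Cb R n) L -> tight L -> 0 < a1 -> 0 < e ->
  exists2 R0, 1 <= R0 & forall y s, a1 <= s -> R0 <= dist2 0 y + s -> L (ker s y) <= e.
Proof.
move=> pL tL a0 e0; pose B := a1 `^ (- q); have B0 : 0 <= B by exact: powR_ge0.
have lB := @linclass_Cb R n.
have c1 : Cb (fun _ : V => 1 : R) by exact: Cb_cst.
pose m := L (fun=> 1); have m0 : 0 <= m by apply: (poslin_ge0 pL).
have e1 : 0 < e / (2 * (B + 1)) by rewrite divr_gt0 // mulr_gt0 // ltr_wpDl.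
have [rho rho0 hrho] := tL _ e1.
have e2 : 0 < e / (2 * (m + 1)) by rewrite divr_gt0 // mulr_gt0 // ltr_wpDl.
have [M M0 hM] := powRN_small q0 e2.
exists (2 * M + 2 * (rho + 1) + 1); first by lra.
move=> y s as_ yR; have s0 : 0 < s := lt_le_trans a0 as_.
apply: (@le_trans _ _ (L (fun x => e / (2 * (m + 1)) * 1 + B * (1 - cutoff rho x)))).
  apply: (poslin_le lB pL) => [||x]; first exact: Cb_ker.
    by apply: Cb_add; apply: Cb_scale => //; exact: Cb_cut1.
  have cu0 : 0 <= B * (1 - cutoff rho x) by rewrite mulr_ge0 // subr_ge0 cutoff_le1.
  have [xr|xr] := leP (dist2 0 x) (rho + 1).
    rewrite mulr1 -[leLHS]addr0; apply: lerD => //; apply: hM.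
    by have := dist2_split2 x 0 y; rewrite (dist2C x y); lra.
  rewrite (cutoff0 (ltW xr)) subr0 !mulr1 -[leLHS]add0r; apply: lerD; first exact: ltW.
  apply: le_trans (ker_le q0 y x s0) _; exact: powRN_le.
rewrite (poslinD pL); [|exact: Cb_scale|by apply: Cb_scale; exact: Cb_cut1].
rewrite (poslinZ pL) // (poslinZ pL); last exact: Cb_cut1.
have h1 : e / (2 * (m + 1)) * L (fun=> 1) <= e / 2.
  have -> : e / (2 * (m + 1)) = e / 2 / (m + 1) by field; rewrite lt0r_neq0 // ltr_wpDl.
  rewrite -/m mulrAC ler_pdivrMr ?ltr_wpDl //; apply: ler_wpM2l; first by rewrite divr_ge0 // ltW.
  by rewrite lerDl.
have h2 : B * L (fun x => 1 - cutoff rho x) <= e / 2.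
  apply: (@le_trans _ _ (B * (e / (2 * (B + 1))))); first exact: ler_wpM2l.
  have -> : e / (2 * (B + 1)) = e / 2 / (B + 1) by field; rewrite lt0r_neq0 // ltr_wpDl.
  rewrite mulrA ler_pdivrMr ?ltr_wpDl // mulrC; apply: ler_wpM2l; first by rewrite divr_ge0 // ltW.
  by rewrite lerDl.
by lra.
Qed.

Lemma dlap_poslin L b y a h : poslin (@Cb R n) L -> 0 < h -> h < a ->
  Cb (fun x => dlap b (fun y a => ker (a ^+ 2) y x) y a h) /\
  dlap b (fun y a => L (ker (a ^+ 2) y)) y a h = L (fun x => dlap b (fun y a => ker (a ^+ 2) y x) y a h).
Proof.
move=> pL h0 ha; have lB := @linclass_Cb R n; have a0 := lt_trans h0 ha.
have ck y' k : 0 < k -> Cb (ker (k ^+ 2) y') by move=> k0; apply: Cb_ker; rewrite exprn_gt0.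
have ap : 0 < a + h by rewrite addr_gt0.
have am : 0 < a - h by rewrite subr_gt0.
have c0 := ck y a a0; have c1 := ck y _ ap; have c2 := ck y _ am.
have cZ (c : R) f : Cb f -> Cb (fun x : V => c * f x) by exact: Cb_scale.
have cD f g : Cb f -> Cb g -> Cb (fun x : V => f x + g x) by exact: Cb_add.
have cB f g : Cb f -> Cb g -> Cb (fun x : V => f x - g x) by exact: (linclassB lB).
pose G i x := ker (a ^+ 2) (shift i h y) x + ker (a ^+ 2) (shift i (- h) y) x - 2 * ker (a ^+ 2) y x.
have cG i : Cb (G i) by apply: cB; [apply: cD; exact: ck|exact: cZ].
have cs : Cb (fun x => \sum_(i < n) G i x) by apply: (linclass_sum lB) => //; exact: Cb_cst.
have cA : Cb (fun x => (1 + b * h / (2 * a)) * (ker ((a + h) ^+ 2) y x - ker (a ^+ 2) y x)) by apply: cZ; exact: cB.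
have cA' : Cb (fun x => (1 - b * h / (2 * a)) * (ker ((a - h) ^+ 2) y x - ker (a ^+ 2) y x)) by apply: cZ; exact: cB.
have cAA := cD _ _ cA cA'.
split; first exact: (cD _ _ cs cAA).
rewrite /dlap (poslinD pL cs cAA) (poslinD pL cA cA').
rewrite (poslinZ pL _ (cB _ _ c1 c0)) (poslinZ pL _ (cB _ _ c2 c0)).
rewrite (poslinB lB pL c1 c0) (poslinB lB pL c2 c0); congr (_ + _).
rewrite (poslin_sum lB pL _ (Cb_cst _ _) cG).
apply: eq_bigr => i _; have k1 := ck (shift i h y) a a0; have k2 := ck (shift i (- h) y) a a0.
by rewrite (poslinB lB pL (cD _ _ k1 k2) (cZ 2 _ c0)) (poslinD pL k1 k2) (poslinZ pL _ c0).
Qed.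

Lemma dlapB b (F1 F2 : V -> R -> R) y a h :
  dlap b (fun y a => F1 y a - F2 y a) y a h = dlap b F1 y a h - dlap b F2 y a h.
Proof.
rewrite /dlap; set c1 := 1 + _; set c2 := 1 - _.
have -> : \sum_(i < n) (F1 (shift i h y) a - F2 (shift i h y) a + (F1 (shift i (- h) y) a - F2 (shift i (- h) y) a) - 2 * (F1 y a - F2 y a)) =
  \sum_(i < n) (F1 (shift i h y) a + F1 (shift i (- h) y) a - 2 * F1 y a) -
  \sum_(i < n) (F2 (shift i h y) a + F2 (shift i (- h) y) a - 2 * F2 y a).
  rewrite -sumrB; apply: eq_bigr => i _; ring.
ring.
Qed.

Lemma ler_diff2 (tau S g gp gm : R) : S - tau < g -> gp <= S -> gm <= S -> gp + gm - 2 * g <= 2 * tau.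
Proof. by lra. Qed.

Lemma ler_dlap (b' tau S g gp gm : R) : -1 <= b' -> b' <= 1 -> S - tau < g -> gp <= S -> gm <= S ->
  (1 + b') * (gp - g) + (1 - b') * (gm - g) <= 2 * tau.
Proof.
move=> b1 b2 gt h1 h2; have k1 : gp - g <= tau by lra.
have k2 : gm - g <= tau by lra.
have : (1 + b') * (gp - g) <= (1 + b') * tau by apply: ler_wpM2l; lra.
have : (1 - b') * (gm - g) <= (1 - b') * tau by apply: ler_wpM2l; lra.
by lra.
Qed.

(** Adding [eta * Q] makes [F] a strict discrete subsolution: it contributes at least
    [2 * eta * h^2], while the kernel contributes an error of order [h^3]. For small [h] this is
    incompatible with a point where [G] is almost maximal. Near-maximality suffices, so the supremum
    need not be attained. *)
Lemma maximum_principle L1 L2 : poslin (@Cb R n) L1 -> poslin (@Cb R n) L2 -> tight L1 ->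
  (forall e : R, 0 < e -> exists2 s0, 0 < s0 & forall s y, 0 < s <= s0 -> L1 (ker s y) <= L2 (ker s y) + e) ->
  forall s y, 0 < s -> L1 (ker s y) <= L2 (ker s y).
Proof.
have N1 : 1 <= n%:R :> R by rewrite ler1n.
have bn1 : `|1 - alpha| <= 1 by rewrite ler_norml; case/andP: al; lra.
have nb2 : 2 <= 2 * n%:R + 2 + 2 * (1 - alpha) by case/andP: al; lra.
move=> p1 p2 t1 bd s y0 s0; rewrite leNgt; apply/negP => lt.
have lB := @linclass_Cb R n.
pose F y a := L1 (ker (a ^+ 2) y) - L2 (ker (a ^+ 2) y).
pose a0 := Num.sqrt s; have a00 : 0 < a0 by rewrite sqrtr_gt0.
pose M0 := F y0 a0.
have M00 : 0 < M0 by rewrite /M0 /F /a0 sqr_sqrtr ?(ltW s0) // subr_gt0.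
have M40 : 0 < M0 / 4 by rewrite divr_gt0.
have [s1 s10 hs1] := bd _ M40.
(* For [a <= 2 * a1 <= 1] one has [a^2 <= a <= s1], so the boundary hypothesis applies in a strip
   twice as high as [a1]; this leaves room for a step downwards. *)
pose a1 := Num.min 1 s1 / 2.
have m10 : 0 < Num.min 1 s1 by rewrite lt_min ltr01.
have a10 : 0 < a1 by rewrite divr_gt0.
have bottom y a : 0 < a -> a <= 2 * a1 -> F y a <= M0 / 4.
  move=> a_0 a_1; rewrite lerBlDl; apply: hs1; rewrite exprn_gt0 //=.
  have E : 2 * a1 = Num.min 1 s1 by rewrite /a1 mulrC divfK.
  have m1 : Num.min 1 s1 <= 1 by rewrite ge_min lexx.
  have m2 : Num.min 1 s1 <= s1 by rewrite ge_min lexx orbT.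
  rewrite E in a_1; apply: le_trans m2; rewrite expr2; apply: (@le_trans _ _ (1 * a)).
    by apply: ler_wpM2r; [exact: ltW|exact: le_trans m1].
  by rewrite mul1r.
have a120 : 0 < a1 ^+ 2 by rewrite exprn_gt0.
have [R0 R01 hR0] := ker_decay p1 t1 a120 M40.
have cb y a : 0 < a -> Cb (ker (a ^+ 2) y) by move=> a_0; apply: Cb_ker; rewrite exprn_gt0.
have Fle y a : 0 < a -> F y a <= L1 (ker (a ^+ 2) y).
  move=> a_0; rewrite gerBl; apply: (poslin_ge0 p2); first exact: cb.
  by move=> x; exact: ker_ge0.
have sqa a : a1 <= a -> a1 ^+ 2 <= a ^+ 2.
  by move=> h; rewrite lerXn2r ?nnegrE ?(ltW a10) // (le_trans (ltW a10)).
have far y a : a1 <= a -> R0 <= dist2 0 y + a ^+ 2 -> F y a <= M0 / 4.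
  move=> aa h; apply: le_trans (Fle y a (lt_le_trans a10 aa)) _.
  by apply: hR0 => //; exact: sqa.
pose Q y a := dist2 0 y + a ^+ 2.
have R00 : 0 < R0 by lra.
(* On [Q <= R0] the perturbation is at most [M0 / 4], so a near-maximum of [G] still has
   [F > M0 / 4] and lies above the strip. *)
pose eta := M0 / (4 * R0); have eta0 : 0 < eta by rewrite divr_gt0 // mulr_gt0.
have etaE : eta * R0 = M0 / 4 by rewrite /eta; field; exact: lt0r_neq0.
pose G y a := F y a + eta * Q y a.
pose Om := [set G p.1 p.2 | p in [set p : V * R | a1 <= p.2 /\ Q p.1 p.2 <= R0]].
have in0 : Om (G y0 a0).
  exists (y0, a0) => //=; split.
    rewrite leNgt; apply/negP => h; have : M0 <= M0 / 4 by apply: bottom => //; lra.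
    by lra.
  rewrite leNgt; apply/negP => h; have : M0 <= M0 / 4; last by lra.
  have [aa|aa] := leP a1 a0; first by apply: far => //; exact: ltW.
  by apply: bottom => //; lra.
have Q0 y a : 0 <= Q y a by rewrite addr_ge0 ?dist2_ge0 ?sqr_ge0.
have hs : has_sup Om.
  split; first by exists (G y0 a0).
  exists (L1 (fun=> (a1 ^+ 2) `^ (- q)) + M0 / 4) => _ [[y a] /= [aa Qa] <-].
  have a_0 := lt_le_trans a10 aa.
  rewrite /G; apply: lerD; last by rewrite -etaE ler_pM2l.
  apply: le_trans (Fle y a a_0) _; apply: (poslin_le lB p1) => [||x]; [exact: cb|exact: Cb_cst|].
  apply: le_trans (ker_le q0 y x _) _; first by rewrite exprn_gt0.
  by apply: powRN_le => //; exact: sqa.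
pose S := sup Om.
have GS0 : M0 <= S.
  apply: (@le_trans _ _ (G y0 a0)); last exact: sup_upper_bound.
  by rewrite /G lerDl mulr_ge0 // ltW.
have [K K0 hK] := dlap_ker qE q0 al a10.
pose m1 := L1 (fun=> 1); pose m2 := L2 (fun=> 1).
have c1 : Cb (fun _ : V => 1 : R) by exact: Cb_cst.
have m10' : 0 <= m1 by apply: (poslin_ge0 p1).
have m20' : 0 <= m2 by apply: (poslin_ge0 p2).
pose K' := K * (m1 + m2) + 1.
have K'0 : 0 < K' by rewrite ltr_wpDl // mulr_ge0 ?addr_ge0 // ltW.
pose h := Num.min (Num.min (2^-1) (a1 / 8)) (eta / K').
have h0 : 0 < h.
  have i2 : 0 < (2^-1 : R) by rewrite invr_gt0.
  have a8 : 0 < a1 / 8 by rewrite divr_gt0.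
  by rewrite /h !lt_min i2 a8 divr_gt0.
have [h12 h8 hK'] : [/\ h <= 2^-1, h <= a1 / 8 & h <= eta / K'].
  by rewrite /h !ge_min !lexx /= !orbT.
(* Near-maximality up to [tau] bounds the discrete operator by [(2 * n + 2) * tau = eta * h^2 / 2],
   below the value [eta * h^2] that the strict subsolution forces. *)
pose tau := eta * h ^+ 2 / (4 * n%:R + 4).
have h20 : 0 < h ^+ 2 by rewrite exprn_gt0.
have tau0 : 0 < tau by apply: divr_gt0; [exact: mulr_gt0|lra].
have tauE : (2 * n%:R + 2) * tau = eta * h ^+ 2 / 2.
  by rewrite /tau; field; apply: lt0r_neq0; lra.
have h21 : h ^+ 2 <= 2^-1.
  rewrite expr2; apply: (@le_trans _ _ (1 * h)); last by rewrite mul1r.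
  by apply: ler_wpM2r; [exact: ltW|lra].
have etah : eta * h ^+ 2 <= M0 / 8.
  apply: (@le_trans _ _ (eta * (R0 / 2))); first by rewrite ler_pM2l //; lra.
  by rewrite mulrA etaE; lra.
have tauM : tau <= M0 / 8.
  apply: le_trans etah; rewrite /tau ler_pdivrMr; last by lra.
  have : 0 < eta * h ^+ 2 by rewrite mulr_gt0.
  by nra.
have [_ [[y a] /= [aa Qa] <-] near] := sup_adherent tau0 hs; rewrite -/S in near.
have GF : F y a = G y a - eta * Q y a by rewrite /G addrK.
have etaQ : eta * Q y a <= M0 / 4 by rewrite -etaE ler_pM2l.
have Fbig : M0 / 4 < F y a by rewrite GF; move: near GS0 tauM etaQ M00; clear; lra.
have a_0 := lt_le_trans a10 aa.
have a2 : 2 * a1 < a by rewrite ltNge; apply/negP => /(bottom y a a_0); rewrite leNgt Fbig.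
(* A neighbour may leave the region [Q <= R0]. There [F <= M0 / 4] by decay and
   [eta * Q <= 3 * M0 / 4], so [G] is still at most [M0 <= S]. *)
have nbr y' a' : a1 <= a' -> Q y' a' <= 2 * Q y a + 2 * h ^+ 2 -> G y' a' <= S.
  move=> aa' Q'; have [QR|QR] := leP (Q y' a') R0.
    by apply: sup_upper_bound => //; exists (y', a').
  apply: le_trans GS0; have := far y' a' aa' (ltW QR).
  have : eta * Q y' a' <= eta * (2 * R0 + 2 * h ^+ 2).
    by rewrite (ler_pM2l eta0); move: Q' Qa; clear; lra.
  have -> : eta * (2 * R0 + 2 * h ^+ 2) = 2 * (eta * R0) + 2 * (eta * h ^+ 2) by ring.
  by rewrite etaE /G; move: etah; clear; lra.
pose b := 1 - alpha; pose b' := b * h / (2 * a).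
have b'1 : `|b'| <= 1.
  have a22 : 0 < 2 * a by rewrite mulr_gt0.
  have b1 : `|b| <= 1 := bn1.
  rewrite /b' normrM normrM (gtr0_norm h0) normfV (gtr0_norm a22) ler_pdivrMr // mul1r.
  apply: (@le_trans _ _ (1 * h)); first by apply: ler_wpM2r => //; exact: ltW.
  by move: h8 a2 a10; clear; lra.
have [b'l b'u] : -1 <= b' /\ b' <= 1 by move: b'1; rewrite ler_norml => /andP.
have ha : h < a by move: h8 a2 a10; clear; lra.
have Qshift i k : k ^+ 2 = h ^+ 2 -> Q (shift i k y) a <= 2 * Q y a + 2 * h ^+ 2.
  move=> kh; rewrite /Q (dist2C 0) dist2_shift (dist2C y 0) kh.
  have := dist2_coord 0 y i; rewrite !mxE sub0r sqrrN subr0 => yi.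
  have : 2 * k * y ord0 i <= k ^+ 2 + y ord0 i ^+ 2.
    by rewrite -subr_ge0 [X in 0 <= X](_ : _ = (k - y ord0 i) ^+ 2) ?sqr_ge0 //; ring.
  have := sqr_ge0 a; rewrite kh; move: yi h20; clear; lra.
have QA k : k ^+ 2 = h ^+ 2 -> Q y (a + k) <= 2 * Q y a + 2 * h ^+ 2.
  move=> kh; rewrite /Q; have := dist2_ge0 0 y.
  have : (a + k) ^+ 2 <= 2 * a ^+ 2 + 2 * k ^+ 2.
    by rewrite -subr_ge0 [X in 0 <= X](_ : _ = (a - k) ^+ 2) ?sqr_ge0 //; ring.
  rewrite kh; move: h20; clear; lra.
have hN : (- h) ^+ 2 = h ^+ 2 by rewrite sqrrN.
have up : dlap b G y a h <= (2 * n%:R + 2) * tau.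
  have -> : (2 * n%:R + 2) * tau = \sum_(i < n) (2 * tau) + 2 * tau.
    by rewrite sumr_const card_ord -[_ *+ n]mulr_natl; ring.
  rewrite /dlap -/b'; apply: lerD.
    apply: ler_sum => i _.
    exact: ler_diff2 near (nbr _ a aa (Qshift i h erefl)) (nbr _ a aa (Qshift i (- h) hN)).
  have g1 : G y (a + h) <= S by apply: nbr; [move: a2 h0 a10; clear; lra|exact: QA].
  have g2 : G y (a - h) <= S by apply: nbr; [move: a2 h8 a10; clear; lra|exact: QA].
  exact: ler_dlap near g1 g2.
have split : dlap b G y a h = dlap b F y a h + eta * ((2 * n%:R + 2 + 2 * b) * h ^+ 2).
  have -> : eta * ((2 * n%:R + 2 + 2 * b) * h ^+ 2) = \sum_(i < n) (eta * (2 * h ^+ 2)) + eta * ((2 + 2 * b) * h ^+ 2).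
    by rewrite sumr_const card_ord -[_ *+ n]mulr_natl; ring.
  rewrite /dlap addrACA -big_split /=; congr (_ + _).
    apply: eq_bigr => i _; rewrite /G.
    have -> : Q y a = (Q (shift i h y) a + Q (shift i (- h) y) a) / 2 - h ^+ 2.
      by rewrite /Q !(dist2C 0) !dist2_shift; field.
    by move: (F _ _) (F _ _) (F _ _) (Q _ _) (Q _ _) => *; field.
  have -> : 1 + b' = 1 + b * h / (2 * a) by [].
  rewrite /G /Q; move: (F _ _) (F _ _) (F _ _) (dist2 _ _) => *; field; exact: lt0r_neq0.
have lo : - (K * h ^+ 3 * (m1 + m2)) <= dlap b F y a h.
  have [cd e1] := dlap_poslin b y p1 h0 ha; have [_ e2] := dlap_poslin b y p2 h0 ha.
  set lam := fun x => dlap b _ y a h in cd e1 e2.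
  have lb x : - (K * h ^+ 3) <= lam x <= K * h ^+ 3.
    rewrite -ler_norml; apply: (hK _ _ _ _ aa h0 h8); move: h12; clear; lra.
  have -> : dlap b F y a h = L1 lam - L2 lam.
    by rewrite -e1 -e2 -dlapB.
  have l1 : - (K * h ^+ 3) * m1 <= L1 lam.
    rewrite -(poslinZ p1) //; apply: (poslin_le lB p1) => // [|x]; first exact: Cb_scale.
    by rewrite mulr1; case/andP: (lb x).
  have l2 : L2 lam <= K * h ^+ 3 * m2.
    rewrite -(poslinZ p2) //; apply: (poslin_le lB p2) => // [|x]; first exact: Cb_scale.
    by rewrite mulr1; case/andP: (lb x).
  by move: l1 l2; clear; lra.
have kh : K * h ^+ 3 * (m1 + m2) <= eta * h ^+ 2.
  have -> : K * h ^+ 3 * (m1 + m2) = (K * (m1 + m2) * h) * h ^+ 2 by ring.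
  apply: ler_wpM2r; first exact: ltW.
  apply: (@le_trans _ _ (K' * h)); first by apply: ler_wpM2r; [exact: ltW|rewrite /K' lerDl].
  by rewrite mulrC -ler_pdivlMr.
have fin : 2 * (eta * h ^+ 2) <= eta * ((2 * n%:R + 2 + 2 * b) * h ^+ 2).
  have -> : 2 * (eta * h ^+ 2) = eta * (2 * h ^+ 2) by ring.
  rewrite ler_pM2l //; apply: ler_wpM2r; [exact: ltW|exact: nb2].
have pos : 0 < eta * h ^+ 2 by rewrite mulr_gt0.
move: up; rewrite split tauE; move: lo kh fin pos; lra.
Qed.

End Uniqueness.

(** * Gaussians determine a functional *)

Section Gaussians.
Variables (R : realType) (n : nat).
Notation V := 'rV[R]_n.
Implicit Types (x y z : V) (L : (V -> R) -> R) (f g : V -> R) (Q q h a b r t s v : R) (k N : nat).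

Lemma powRN_difference Q r h : 0 < Q -> 0 < r -> 0 < h ->
  Q * h * (r + h) `^ (- (Q + 1)) <= r `^ (- Q) - (r + h) `^ (- Q) /\
  r `^ (- Q) - (r + h) `^ (- Q) <= Q * h * r `^ (- (Q + 1)).
Proof.
move=> Q0 r0 h0; pose u := h / r; have u0 : 0 < u by rewrite divr_gt0.
have um : -1 < u by lra.
have u1 : 0 < 1 + u by lra.
have rh : r + h = r * (1 + u) by rewrite /u; field; exact: lt0r_neq0.
have hu : h = r * u by rewrite /u; field; exact: lt0r_neq0.
have p1 : r `^ (- (Q + 1)) * r = r `^ (- Q).
  rewrite -{2}[r]powRr1 ?(ltW r0) // -powRD; first by congr (_ `^ _); ring.
  by apply/implyP => _; exact: lt0r_neq0.
have E : - (Q + 1) = - Q - 1 by ring.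
have b1 := bernoulli Q0 um; have b2 := bernoulli_up Q0 um; rewrite -E in b2.
have X0 := powR_ge0 r (- Q).
rewrite rh !powRM ?(ltW r0) ?(ltW u1) //; split.
  have -> : Q * h * (r `^ (- (Q + 1)) * (1 + u) `^ (- (Q + 1))) = r `^ (- Q) * (Q * u * (1 + u) `^ (- (Q + 1))).
    by rewrite -p1 hu; ring.
  by move: (ler_wpM2l X0 b2); lra.
have -> : Q * h * r `^ (- (Q + 1)) = r `^ (- Q) * (Q * u) by rewrite -p1 hu; ring.
by move: (ler_wpM2l X0 b1); lra.
Qed.

(** Differentiation in [s] raises the exponent by 1. Under a functional it is replaced by two-sided
    bounds on the difference quotient, whose ends are the kernels at [s] and [s + h]; these differ
    by a factor near 1 when [h] is small relative to [s]. *)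
Lemma ker_exponent_le L1 L2 Q : 0 < Q -> poslin (@Cb R n) L1 -> poslin (@Cb R n) L2 ->
  (forall s y, 0 < s -> L1 (rker Q s y) = L2 (rker Q s y)) ->
  forall s y, 0 < s -> L1 (rker (Q + 1) s y) <= L2 (rker (Q + 1) s y).
Proof.
move=> Q0 p1 p2 E s y s0; have Q1 : 0 < Q + 1 by lra.
have lB := @linclass_Cb R n.
have cQ (t : R) : 0 < t -> Cb (rker Q t y) by move=> t0; exact: Cb_ker.
have cQ1 (t : R) : 0 < t -> Cb (rker (Q + 1) t y) by move=> t0; exact: Cb_ker.
have step h : 0 < h -> L1 (rker (Q + 1) (s + h) y) <= L2 (rker (Q + 1) s y).
  move=> h0; have sh0 : 0 < s + h by rewrite addr_gt0.
  have Qh : 0 < Q * h by rewrite mulr_gt0.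
  rewrite -(ler_pM2l Qh) -(poslinZ p1 _ (cQ1 _ sh0)) -(poslinZ p2 _ (cQ1 _ s0)).
  apply: (@le_trans _ _ (L1 (fun x => rker Q s y x - rker Q (s + h) y x))).
    apply: (poslin_le lB p1) => [||x]; [by apply: Cb_scale; exact: cQ1|exact: (linclassB lB (cQ _ s0) (cQ _ sh0))|].
    by rewrite /rker addrA; apply: (powRN_difference Q0 _ h0).1; rewrite dist2D_gt0.
  rewrite (poslinB lB p1 (cQ _ s0) (cQ _ sh0)) !E // -(poslinB lB p2 (cQ _ s0) (cQ _ sh0)).
  apply: (poslin_le lB p2) => [||x]; [exact: (linclassB lB (cQ _ s0) (cQ _ sh0))|by apply: Cb_scale; exact: cQ1|].
  by rewrite /rker addrA; apply: (powRN_difference Q0 _ h0).2; rewrite dist2D_gt0.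
have l2 : 0 <= L2 (rker (Q + 1) s y).
  by apply: (poslin_ge0 p2) => [|x]; [exact: cQ1|exact: ker_ge0].
suff H (e : R) : 0 < e -> L1 (rker (Q + 1) s y) <= (1 + e) * L2 (rker (Q + 1) s y).
  apply/ler_addgt0Pr => e e0; pose d := e / (L2 (rker (Q + 1) s y) + 1).
  have l3 : 0 < L2 (rker (Q + 1) s y) + 1 by lra.
  have d0 : 0 < d by rewrite divr_gt0.
  have : d * L2 (rker (Q + 1) s y) <= e.
    by rewrite /d mulrAC ler_pdivrMr // ler_pM2l //; lra.
  by have := H d d0; rewrite mulrDl mul1r; lra.
move=> e0; have [eta eta0 he] := powR_1D_le Q1 e0.
pose h := eta * s; have h0 : 0 < h by rewrite mulr_gt0.
have sh0 : 0 < s + h by rewrite addr_gt0.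
apply: (@le_trans _ _ ((1 + e) * L1 (rker (Q + 1) (s + h) y))).
  rewrite -(poslinZ p1 _ (cQ1 _ sh0)).
  apply: (poslin_le lB p1) => [||x]; [exact: cQ1|by apply: Cb_scale; exact: cQ1|].
  apply: (@le_trans _ _ ((1 + eta) `^ (Q + 1) * rker (Q + 1) (s + h) y x)).
    apply: powRN_scale => //; rewrite ?dist2D_gt0 //; first lra.
    have d0 := dist2_ge0 y x; have : 0 <= eta * dist2 y x by rewrite mulr_ge0 // ltW.
    by rewrite /h mulrDl mul1r mulrDr; lra.
  by apply: ler_wpM2r; [exact: ker_ge0|apply: he; rewrite lexx ltW].
by apply: ler_wpM2l; [lra|exact: step].
Qed.

Lemma ker_exponent L1 L2 Q k : 0 < Q -> poslin (@Cb R n) L1 -> poslin (@Cb R n) L2 ->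
  (forall s y, 0 < s -> L1 (rker Q s y) = L2 (rker Q s y)) ->
  forall s y, 0 < s -> L1 (rker (Q + k%:R) s y) = L2 (rker (Q + k%:R) s y).
Proof.
move=> Q0 p1 p2 E; elim: k => [|k IH]; first by rewrite addr0.
have Qk : 0 < Q + k%:R by rewrite ltr_wpDr.
have -> : Q + k.+1%:R = Q + k%:R + 1 by rewrite -natr1; ring.
move=> s y s0; apply/eqP; rewrite eq_le; apply/andP; split.
  exact: ker_exponent_le.
by apply: ker_exponent_le => // s' y' s'0; rewrite IH.
Qed.

(** Uniformity in [v] is the point. Below, Bernoulli and [v * exp (- v) <= 1] cost [q / k]. Above,
    with [A = v / (1 + v / k)], the power is at most [exp (- A)]: for [v <= k], [v - A] is at most
    [2 * A^2 / k], and for [v > k] both terms are small since [A >= k / 2]. *)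
Lemma powRN_expR q (k : nat) v : 0 < q -> (0 < k)%N -> 0 <= v ->
  `|(1 + v / k%:R) `^ (- (q + k%:R)) - expR (- v)| <= (q + 4) / k%:R.
Proof.
move=> q0 k0 v0; have K0 : 0 < k%:R :> R by rewrite ltr0n.
set K : R := k%:R in K0 *; pose x := v / K; have x0 : 0 <= x by rewrite divr_ge0 // ltW.
have x1 : 0 < 1 + x by lra.
have xm : -1 < x by lra.
have vE : v = K * x by rewrite /x mulrC divfK // lt0r_neq0.
have pe (p : R) : (1 + x) `^ (- p) = expR (- p * ln (1 + x)) by rewrite /powR gt_eqF.
have eD : (1 + x) `^ (- (q + K)) = (1 + x) `^ (- q) * (1 + x) `^ (- K).
  by rewrite -powRD ?opprD //; apply/implyP => _; exact: lt0r_neq0.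
have lnu : ln (1 + x) <= x by exact: le_ln1Dx.
have lnl : x / (1 + x) <= ln (1 + x).
  have h : -1 < - x / (1 + x) by rewrite ltr_pdivlMr //; lra.
  have := le_ln1Dx h; have -> : 1 + - x / (1 + x) = (1 + x)^-1 by field; exact: lt0r_neq0.
  by rewrite lnV ?posrE // => H; rewrite mulNr in H; lra.
have e0 := expR_ge0 (- v).
have low : expR (- v) - q / K <= (1 + x) `^ (- (q + K)).
  have h1 : expR (- v) <= (1 + x) `^ (- K).
    by rewrite pe ler_expR vE mulNr lerN2 ler_pM2l.
  have h2 := bernoulli q0 xm.
  have h3 : expR (- v) * (1 - q * x) <= (1 + x) `^ (- (q + K)).
    have [neg|pos] := leP (1 - q * x) 0.
      apply: le_trans (powR_ge0 _ _); exact: mulr_ge0_le0.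
    rewrite eD mulrC; apply: ler_pM => //; exact: ltW.
  have h4 : expR (- v) * v <= 1.
    have : v <= expR v by have := expR_ge1Dx v; lra.
    move=> h; have := ler_wpM2l e0 h; rewrite -expRD addNr expR0; lra.
  have h5 : expR (- v) * (q * x) <= q / K.
    have -> : expR (- v) * (q * x) = q / K * (expR (- v) * v) by rewrite /x; ring.
    rewrite -[leRHS]mulr1; apply: ler_wpM2l => //; by rewrite divr_ge0 // ltW.
  by move: h3; rewrite mulrBr mulr1; lra.
pose A := v / (1 + x); have A0 : 0 <= A by rewrite divr_ge0 // ltW.
have up1 : (1 + x) `^ (- (q + K)) <= expR (- A).
  have a1 : (1 + x) `^ (- q) <= 1.
    rewrite pe -[leRHS](@expR0 R) ler_expR mulNr oppr_le0 mulr_ge0 ?(ltW q0) //.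
    by apply: le_trans lnl; rewrite divr_ge0 // ltW.
  have a2 : (1 + x) `^ (- K) <= expR (- A).
    rewrite pe ler_expR mulNr lerN2 /A vE -mulrA ler_pM2l //.
  rewrite eD -[leRHS]mul1r; apply: ler_pM => //; exact: powR_ge0.
have up : (1 + x) `^ (- (q + K)) - expR (- v) <= 4 / K.
  have eA0 := expR_ge0 (- A).
  have [vK|vK] := leP v K.
    have x11 : x <= 1 by rewrite /x ler_pdivrMr // mul1r.
    have vA : v <= 2 * A by rewrite /A mulrA ler_pdivlMr // mulrC; apply: ler_wpM2r => //; lra.
    have d1 : v - A = A * x by rewrite /A; field; exact: lt0r_neq0.
    have h1 : expR (- A) * (1 - (v - A)) <= expR (- v).
      have -> : expR (- v) = expR (- A) * expR (- (v - A)) by rewrite -expRD; congr expR; ring.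
      by apply: ler_wpM2l => //; exact: expR_ge1Dx.
    have h2 : expR (- A) * A ^+ 2 <= 2.
      have := expR_ge1Dxn 1 A0; rewrite (_ : (2`!)%:R = 2 :> R) // => h.
      have : A ^+ 2 <= 2 * expR A by lra.
      move=> h'; have eAA : expR (- A) * expR A = 1 by rewrite -expRD addNr expR0.
      by move: (ler_wpM2l eA0 h') eAA; lra.
    have h3 : A * x <= A * (2 * A / K) by apply: ler_wpM2l => //; rewrite /x ler_pM2r ?invr_gt0.
    have h4 : expR (- A) * (v - A) <= 4 / K.
      rewrite d1; apply: (@le_trans _ _ (expR (- A) * (A * (2 * A / K)))); first exact: ler_wpM2l.
      have -> : expR (- A) * (A * (2 * A / K)) = expR (- A) * A ^+ 2 * 2 / K by ring.
      by rewrite ler_pM2r ?invr_gt0 //; lra.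
    by move: h1; rewrite mulrBr mulr1; lra.
  have AK : K / 2 <= A.
    have x11 : 1 < x by rewrite /x ltr_pdivlMr // mul1r.
    rewrite /A vE ler_pdivlMr // mulrAC -mulrA ler_pM2l //; lra.
  have h1 : expR (- A) <= 2 / K.
    apply: (@le_trans _ _ (expR (- (K / 2)))); first by rewrite ler_expR lerN2.
    rewrite expRN -[2 / K]invrK lef_pV2 ?posrE ?expR_gt0 ?invr_gt0 ?divr_gt0 //.
    by rewrite invf_div; have := expR_ge1Dx (K / 2); lra.
  have : 2 / K <= 4 / K by rewrite ler_pM2r ?invr_gt0 //; lra.
  by lra.
have qK : 0 <= q / K by rewrite divr_ge0 // ltW.
have k4 : 0 <= 4 / K by rewrite divr_ge0 // ltW.
rewrite ler_norml mulrDl; apply/andP; split; lra.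
Qed.

Definition gaussian t y x : R := expR (- (t * dist2 y x)).

Notation gauss := gaussian.

Lemma Cb_gauss t y : 0 < t -> Cb (gauss t y).
Proof.
move=> t0; split.
  have -> : gauss t y = expR \o (fun x => - (t * dist2 y x)) by [].
  move=> x; apply: continuous_comp; last exact: continuous_expR.
  by apply: continuous_opp; apply: continuous_scale; exact: continuous_dist2r.
exists 1 => x; rewrite ger0_norm ?expR_ge0 // -[leRHS](@expR0 R) ler_expR oppr_le0.
by rewrite mulr_ge0 ?dist2_ge0 // ltW.
Qed.

Lemma poslin_dist L f g (e : R) : poslin (@Cb R n) L -> Cb f -> Cb g -> (forall x, `|f x - g x| <= e) ->
  `|L f - L g| <= e * L (fun=> 1).
Proof.
move=> pL cf cg fg; have lB := @linclass_Cb R n.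
have c1 : Cb (fun _ : V => 1 : R) by exact: Cb_cst.
have ce c : Cb (fun _ : V => c * 1 : R) by exact: Cb_scale.
have cB := linclassB lB cf cg.
rewrite -(poslinB lB pL cf cg) ler_norml -mulNr -!(poslinZ pL _ c1); apply/andP; split.
  by apply: (poslin_le lB pL) => // x; have := fg x; rewrite ler_norml mulr1 => /andP[].
by apply: (poslin_le lB pL) => // x; have := fg x; rewrite ler_norml mulr1 => /andP[].
Qed.

(** With exponent [q + k] and [s = k / t], the rescaled kernel is
    [(1 + t * dist2 y x / k)^(-(q + k))], which converges to the Gaussian uniformly in [x]. *)
Lemma gauss_eq L1 L2 q : 0 < q -> poslin (@Cb R n) L1 -> poslin (@Cb R n) L2 ->
  (forall s y, 0 < s -> L1 (rker q s y) = L2 (rker q s y)) ->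
  forall t y, 0 < t -> L1 (gauss t y) = L2 (gauss t y).
Proof.
move=> q0 p1 p2 E t y t0; pose m := L1 (fun=> 1) + L2 (fun=> 1).
have c1 : Cb (fun _ : V => 1 : R) by exact: Cb_cst.
have m0 : 0 <= m by rewrite addr_ge0 // (poslin_ge0 p1, poslin_ge0 p2).
have key k : (0 < k)%N -> `|L1 (gauss t y) - L2 (gauss t y)| <= (q + 4) / k%:R * m.
  move=> k0; have K0 : 0 < k%:R :> R by rewrite ltr0n.
  have s0 : 0 < k%:R / t by rewrite divr_gt0.
  pose G x := (k%:R / t) `^ (q + k%:R) * rker (q + k%:R) (k%:R / t) y x.
  have qk : 0 < q + k%:R by rewrite addr_gt0.
  have ck : Cb (rker (q + k%:R) (k%:R / t) y) by exact: Cb_ker.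
  have cG : Cb G by exact: Cb_scale.
  have GE x : G x = (1 + (t * dist2 y x) / k%:R) `^ (- (q + k%:R)).
    have -> : 1 + (t * dist2 y x) / k%:R = (k%:R / t)^-1 * (dist2 y x + k%:R / t).
      by field; rewrite !lt0r_neq0.
    rewrite powRM ?invr_ge0 ?(ltW s0) ?addr_ge0 ?dist2_ge0 ?(ltW s0) // /G; congr (_ * _).
    by rewrite -[(k%:R / t)^-1]powR_inv1 ?(ltW s0) // -powRrM mulN1r opprK.
  have Gg x : `|gauss t y x - G x| <= (q + 4) / k%:R.
    rewrite distrC GE; apply: powRN_expR => //.
    by rewrite mulr_ge0 ?dist2_ge0 // ltW.
  have L12 : L1 G = L2 G by rewrite /G (poslinZ p1 _ ck) (poslinZ p2 _ ck) (ker_exponent k q0 p1 p2 E).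
  have h1 := poslin_dist p1 (Cb_gauss y t0) cG Gg.
  have h2 := poslin_dist p2 (Cb_gauss y t0) cG Gg.
  rewrite /m mulrDr; apply: le_trans (lerD h1 h2).
  have -> : L1 (gauss t y) - L2 (gauss t y) = (L1 (gauss t y) - L1 G) - (L2 (gauss t y) - L2 G) by rewrite L12; ring.
  exact: ler_normB.
apply/eqP; rewrite -subr_eq0 -normr_eq0 eq_le normr_ge0 andbT.
apply/ler_addgt0Pr => e e0; rewrite add0r.
have [k hk] := nat_large ((q + 4) * m / e).
have := hk k.+1 (leqnSn k); rewrite ler_pdivrMr // => h.
apply: le_trans (key k.+1 _) _ => //.
by rewrite mulrAC ler_pdivrMr ?ltr0n // mulrC [leRHS]mulrC mulrC.
Qed.

End Gaussians.

(** * Uniform approximation by sums of Gaussians *)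

Section Density.
Variables (R : realType) (n : nat).
Notation V := 'rV[R]_n.
Notation gauss := (@gaussian R n).
Implicit Types (x y z : V) (L : (V -> R) -> R) (f g : V -> R) (t s d : R) (k N : nat).

Inductive gauss_span : (V -> R) -> Prop :=
| gauss_span_gauss (c t : R) y : 0 < t -> gauss_span (fun x => c * gauss t y x)
| gauss_span_add f g : gauss_span f -> gauss_span g -> gauss_span (fun x => f x + g x).

Lemma gauss_span0 : gauss_span (fun=> 0).
Proof.
have -> : (fun _ : V => 0 : R) = (fun x => 0 * gauss 1 0 x) by apply/funext => x; rewrite mul0r.
exact: gauss_span_gauss.
Qed.

Lemma gauss_span_scale (a : R) f : gauss_span f -> gauss_span (fun x => a * f x).
Proof.
elim=> [c t y t0|g h _ IHg _ IHh].
  have -> : (fun x => a * (c * gauss t y x)) = (fun x => (a * c) * gauss t y x).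
    by apply/funext => x; rewrite mulrA.
  exact: gauss_span_gauss.
have -> : (fun x => a * (g x + h x)) = (fun x => a * g x + a * h x).
  by apply/funext => x; rewrite mulrDr.
exact: gauss_span_add.
Qed.

Lemma gauss_span_sub f g : gauss_span f -> gauss_span g -> gauss_span (fun x => f x - g x).
Proof.
move=> sf sg; have -> : (fun x => f x - g x) = (fun x => f x + (-1) * g x).
  by apply/funext => x; rewrite mulN1r.
by apply: gauss_span_add => //; exact: gauss_span_scale.
Qed.

(** Completing the square; the new centre is the weighted mean of [y] and [y']. *)
Lemma gauss_mul t t' y y' : 0 < t -> 0 < t' -> exists c z, forall x,
  gauss t y x * gauss t' y' x = c * gauss (t + t') z x.
Proof.
move=> t0 t'0; have tt : 0 < t + t' by rewrite addr_gt0.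
exists (expR (- (t * t' / (t + t') * dist2 y y'))), ((t + t')^-1 *: (t *: y + t' *: y')) => x.
rewrite /gaussian -!expRD; congr expR; rewrite /dist2 -!opprD; congr (- _).
rewrite !mulr_sumr -!big_split /=; apply: eq_bigr => i _; rewrite !mxE; field.
exact: lt0r_neq0.
Qed.

Lemma gauss_span_mul f g : gauss_span f -> gauss_span g -> gauss_span (fun x => f x * g x).
Proof.
move=> sf sg; elim: sf => [c t y t0|f1 f2 _ IH1 _ IH2]; last first.
  have -> : (fun x => (f1 x + f2 x) * g x) = (fun x => f1 x * g x + f2 x * g x).
    by apply/funext => x; rewrite mulrDl.
  exact: gauss_span_add.
elim: sg => [c' t' y' t'0|f1 f2 _ IH1 _ IH2]; last first.
  have -> : (fun x => c * gauss t y x * (f1 x + f2 x)) = (fun x => c * gauss t y x * f1 x + c * gauss t y x * f2 x).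
    by apply/funext => x; rewrite mulrDr.
  exact: gauss_span_add.
have [a [z az]] := gauss_mul y y' t0 t'0.
have -> : (fun x => c * gauss t y x * (c' * gauss t' y' x)) = (fun x => (c * c' * a) * gauss (t + t') z x).
  by apply/funext => x; rewrite mulrACA az !mulrA.
by apply: gauss_span_gauss; rewrite addr_gt0.
Qed.

Lemma gauss_span_eq L1 L2 : poslin (@Cb R n) L1 -> poslin (@Cb R n) L2 ->
  (forall t y, 0 < t -> L1 (gauss t y) = L2 (gauss t y)) ->
  forall f, gauss_span f -> Cb f /\ L1 f = L2 f.
Proof.
move=> p1 p2 E f; elim=> [c t y t0|g h _ [cg Eg] _ [ch Eh]].
  have cg := Cb_gauss y t0.
  by split; [exact: Cb_scale|rewrite (poslinZ p1 _ cg) (poslinZ p2 _ cg) E].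
by split; [exact: Cb_add|rewrite (poslinD p1 cg ch) (poslinD p2 cg ch) Eg Eh].
Qed.

Lemma bernoulli_nat (a : R) k : 0 <= a <= 1 -> 1 - k%:R * a <= (1 - a) ^+ k.
Proof.
move=> /andP[a0 a1]; elim: k => [|k IH]; first by rewrite mul0r subr0 expr0.
rewrite exprS; have h : 0 <= 1 - a by lra.
apply: le_trans (ler_wpM2l h IH).
have : 0 <= k%:R * a * a by rewrite !mulr_ge0.
by rewrite -natr1; lra.
Qed.

(* polynomials [1 - (1 - g)^K] in a Gaussian [g] separate the balls of square radius [d] and [2 d] (Brosowski-Deutsch) *)
Lemma gauss_bump d (e : R) y : 0 < d -> 0 < e -> exists psi : V -> R, [/\ gauss_span psi,
  forall x, 0 <= psi x <= 1, forall x, dist2 y x <= d -> 1 - e <= psi x &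
  forall x, 2 * d <= dist2 y x -> psi x <= e].
Proof.
move=> d0 e0; have [N0 hN0] := nat_large e^-1.
pose N := N0.+2; have N1 : 1 < N%:R :> R by rewrite ltr1n.
have Np : 0 < N%:R :> R by lra.
have Ne : N%:R^-1 <= e.
  by rewrite -[e]invrK lef_pV2 ?posrE ?invr_gt0 //; apply: hN0; rewrite /N !leqW.
(* The Gaussian is then at least [N^-2] on the inner ball and at most [N^-4] off the outer one; the
   power [K = N^3] lies between, so [K * ga] is at least [N] inside and at most [1 / N] outside. *)
pose T := 2 * ln N%:R / d.
have T0 : 0 < T by rewrite divr_gt0 // mulr_gt0 // ln_gt0.
pose K := (N ^ 3)%N; pose ga x := gauss T y x.
have ga01 x : 0 <= ga x <= 1.
  rewrite expR_ge0 /= /ga /gaussian -[leRHS](@expR0 R) ler_expR oppr_le0.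
  by rewrite mulr_ge0 ?dist2_ge0 // ltW.
have TdE : expR (T * d) = N%:R ^+ 2.
  have -> : T * d = 2%:R * ln N%:R by rewrite /T divfK // lt0r_neq0.
  by rewrite expRM_natl lnK // posrE.
exists (fun x => 1 - (1 - ga x) ^+ K); split.
- elim: K => [|k IH].
    have -> : (fun x => 1 - (1 - ga x) ^+ 0) = (fun=> 0) by apply/funext => x; rewrite expr0 subrr.
    exact: gauss_span0.
  have sga : gauss_span ga.
    have -> : ga = (fun x => 1 * gauss T y x) by apply/funext => x; rewrite mul1r.
    exact: gauss_span_gauss.
  have -> : (fun x => 1 - (1 - ga x) ^+ k.+1) =
     (fun x => (1 - (1 - ga x) ^+ k) + (ga x - ga x * (1 - (1 - ga x) ^+ k))).
    by apply/funext => x; rewrite exprS; ring.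
  by apply: gauss_span_add => //; apply: gauss_span_sub => //; exact: gauss_span_mul.
- move=> x; have /andP[g0 g1] := ga01 x.
  have h0 : 0 <= 1 - ga x by lra.
  have h1 : 1 - ga x <= 1 by lra.
  have := exprn_ge0 K h0; have := exprn_ile1 K h0 h1; lra.
- move=> x xd; have /andP[g0 g1] := ga01 x.
  have gl : (N%:R ^+ 2)^-1 <= ga x.
    rewrite /ga /gaussian -TdE -expRN ler_expR lerN2 ler_pM2l //.
  have h0 : 0 <= 1 - ga x by lra.
  have h1 : 1 - ga x <= expR (- ga x) by have := expR_ge1Dx (- ga x).
  have h2 : (1 - ga x) ^+ K <= expR (- ga x) ^+ K by rewrite lerXn2r ?nnegrE ?expR_ge0.
  rewrite -expRM_natl in h2.
  have h3 : N%:R <= K%:R * ga x.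
    apply: (@le_trans _ _ (K%:R * (N%:R ^+ 2)^-1)); last by apply: ler_wpM2l.
    by rewrite /K natrX ler_pdivlMr ?exprn_gt0 // -exprS.
  have h4 : expR (K%:R * - ga x) <= expR (- N%:R) by rewrite ler_expR mulrN lerN2.
  have h5 : expR (- N%:R) <= N%:R^-1 :> R.
    by rewrite expRN lef_pV2 ?posrE ?expR_gt0 //; have := expR_ge1Dx (N%:R : R); lra.
  lra.
- move=> x xd; have /andP[g0 g1] := ga01 x.
  have gu : ga x <= (N%:R ^+ 4)^-1.
    have -> : N%:R ^+ 4 = expR (T * (2 * d)).
      by rewrite (_ : T * (2 * d) = T * d + T * d); [rewrite expRD TdE -exprD|ring].
    by rewrite /ga /gaussian -expRN ler_expR lerN2 ler_pM2l.
  have := bernoulli_nat K (ga01 x).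
  have : K%:R * ga x <= N%:R^-1.
    apply: (@le_trans _ _ (K%:R * (N%:R ^+ 4)^-1)); first exact: ler_wpM2l.
    rewrite /K natrX ler_pdivrMr ?exprn_gt0 // le_eqVlt; apply/orP; left; apply/eqP.
    by rewrite [_ ^+ 4]exprS mulKf // lt0r_neq0.
  by lra.
Qed.

Lemma gauss_span_prod f (psi : nat -> V -> R) k : gauss_span f -> (forall i, gauss_span (psi i)) ->
  gauss_span (fun x => f x * \prod_(j < k) (1 - psi j x)).
Proof.
move=> sf sp; elim: k => [|k IH].
  by have -> : (fun x => f x * \prod_(j < 0) (1 - psi j x)) = f by apply/funext => x; rewrite big_ord0 mulr1.
have -> : (fun x => f x * \prod_(j < k.+1) (1 - psi j x)) =
  (fun x => f x * \prod_(j < k) (1 - psi j x) - f x * \prod_(j < k) (1 - psi j x) * psi k x).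
  by apply/funext => x; rewrite big_ord_recr /=; ring.
by apply: gauss_span_sub => //; exact: gauss_span_mul.
Qed.

Lemma gauss_span_sum (F : nat -> V -> R) k : (forall i, gauss_span (F i)) ->
  gauss_span (fun x => \sum_(i < k) F i x).
Proof.
move=> sF; elim: k => [|k IH].
  have -> : (fun x => \sum_(i < 0) F i x) = (fun=> 0) by apply/funext => x; rewrite big_ord0.
  exact: gauss_span0.
have -> : (fun x => \sum_(i < k.+1) F i x) = (fun x => \sum_(i < k) F i x + F k x).
  by apply/funext => x; rewrite big_ord_recr.
exact: gauss_span_add.
Qed.

Lemma Cc_uniform f (e : R) : Cc f -> 0 < e -> exists2 d : R, 0 < d & forall x y, dist2 x y < d -> `|f x - f y| <= e.
Proof.
move=> cf e0; have [r [r0 hr]] := Cc_cutoff_eq cf.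
have out x : r + 1 < dist2 0 x -> f x = 0.
  by move=> h; rewrite (hr r) // cutoff0 ?mul0r // ltW.
have e20 : 0 < e / 2 by rewrite divr_gt0.
pose P (j : nat) (x : V) := forall y, dist2 x y < tr R j -> `|f x - f y| <= e.
have /compact_near_coveringP cov := @compact_dist2 R n 0 (2 * (r + 1) + 4).
have [J _ hJ] : \forall j \near \oo, [set x | dist2 0 x <= 2 * (r + 1) + 4] `<=` P j.
  apply: (cov nat \oo P) => x _.
  have [d d0 hd] := dist2_nbhs (near_continuous x (cf.1) e20).
  have d40 : 0 < d / 4 by rewrite divr_gt0.
  have [j0 hj0] := tr_small d40.
  exists ([set y | dist2 x y < d / 4], [set j | (j0 <= j)%N]) => /=.
    by split; [exact: near_dist2|exists j0].
  move=> [y j] /= [xy jj] z yz.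
  have h1 := hj0 j jj; have h2 := dist2_split2 y x z.
  have a1 : `|f x - f y| <= e / 2 by apply: hd; lra.
  have a2 : `|f x - f z| <= e / 2 by apply: hd; lra.
  have -> : f y - f z = (f x - f z) - (f x - f y) by ring.
  by have := ler_normB (f x - f z) (f x - f y); lra.
exists (tr R J); first exact: tr_gt0.
have t1 : tr R J <= 1 by rewrite /tr invf_le1 // ler1n.
move=> x y xy; have [xr|xr] := leP (dist2 0 x) (2 * (r + 1) + 4); first exact: (hJ J (leqnn J)).
have := dist2_split2 y 0 x; rewrite (dist2C y x) => h.
by rewrite (out x) ?(out y) ?subrr ?normr0 ?(ltW e0) //; lra.
Qed.

(** An explicit approximation in place of Stone-Weierstrass: [f] is replaced by the sum of
    [f (c i) * phi i], with [phi] peeled from Gaussian bumps. The error is estimated on the whole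
    space, since the functionals need not have compact support. *)
Lemma Cc_eq_of_gauss L1 L2 : poslin (@Cb R n) L1 -> poslin (@Cb R n) L2 ->
  (forall t y, 0 < t -> L1 (gauss t y) = L2 (gauss t y)) -> forall f, Cc f -> L1 f = L2 f.
Proof.
move=> p1 p2 E f cf; pose m := L1 (fun=> 1) + L2 (fun=> 1).
have c1 : Cb (fun _ : V => 1 : R) by exact: Cb_cst.
have m0 : 0 <= m by rewrite addr_ge0 // (poslin_ge0 p1, poslin_ge0 p2).
have [r [r0 hr]] := Cc_cutoff_eq cf.
have out x : r + 1 < dist2 0 x -> f x = 0.
  by move=> h; rewrite (hr r) // cutoff0 ?mul0r // ltW.
have [M [M0 hM]] := Cc_bounded cf.
suff key (e : R) : 0 < e -> `|L1 f - L2 f| <= 2 * e * m.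
  apply/eqP; rewrite -subr_eq0 -normr_eq0 eq_le normr_ge0 andbT.
  apply/ler_addgt0Pr => e e0; rewrite add0r.
  have mm : 0 < 2 * (m + 1) by rewrite mulr_gt0 // ltr_wpDl.
  have e1 : 0 < e / (2 * (m + 1)) by rewrite divr_gt0.
  apply: le_trans (key _ e1) _.
  have -> : 2 * (e / (2 * (m + 1))) * m = e * (m / (m + 1)) by field; rewrite lt0r_neq0 // ltr_wpDl.
  by rewrite -[leRHS]mulr1 ler_pM2l // ler_pdivrMr ?ltr_wpDl // mul1r lerDl.
move=> e0; have [d d0 hd] := Cc_uniform cf e0.
have d20 : 0 < d / 2 by rewrite divr_gt0.
have [N [c hc]] := finite_net n (r + 1) d20.
(* The defect of the partition costs [M * eta], and each of the [N] far centres at most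
   [2 * M * eta], together [e]. *)
pose eta := e / (M * (2 * N%:R + 1)).
have NM : 0 < M * (2 * N%:R + 1) by rewrite mulr_gt0 // ltr_wpDl // mulr_ge0.
have eta0 : 0 < eta by rewrite divr_gt0.
have etaE : eta * (M * (2 * N%:R + 1)) = e by rewrite /eta divfK // lt0r_neq0.
have /choice[psi hpsi] : forall i, exists p : V -> R, [/\ gauss_span p,
  forall x, 0 <= p x <= 1, forall x, dist2 (c i) x <= d / 2 -> 1 - eta <= p x &
  forall x, 2 * (d / 2) <= dist2 (c i) x -> p x <= eta].
  by move=> i; exact: gauss_bump.
pose phi i x := peel (psi^~ x) i.
have psi01 i x : 0 <= psi i x <= 1 by case: (hpsi i) => _ + _ _; apply.
have sphi i : gauss_span (phi i).
  by apply: gauss_span_prod => [|j]; [case: (hpsi i)|case: (hpsi j)].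
have phi0 i x : 0 <= phi i x by apply: peel_ge0.
pose g x := \sum_(i < N) f (c i) * phi i x.
have sg : gauss_span g.
  by apply: (@gauss_span_sum (fun i x => f (c i) * phi i x)) => i; exact: gauss_span_scale.
have fg x : `|f x - g x| <= 2 * e.
  pose S := \sum_(i < N) phi i x.
  have SE : S = 1 - \prod_(j < N) (1 - psi j x) by exact: sum_peel.
  have pr0 : 0 <= \prod_(j < N) (1 - psi j x).
    by apply: prodr_ge0 => j _; rewrite subr_ge0; case/andP: (psi01 j x).
  have S1 : S <= 1 by rewrite SE; lra.
  have h1 : `|f x * (1 - S)| <= M * eta.
    have [xr|xr] := leP (dist2 0 x) (r + 1); last first.
      by rewrite (out x xr) mul0r normr0 mulr_ge0 // ltW.
    have [i iN ix] := hc x xr.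
    rewrite normrM; apply: ler_pM => //; rewrite ger0_norm ?subr_ge0 // SE.
    have -> : 1 - (1 - \prod_(j < N) (1 - psi j x)) = \prod_(j < N) (1 - psi j x) by ring.
    rewrite (bigD1 (Ordinal iN)) //= -[leRHS]mulr1; apply: ler_pM.
    - by rewrite subr_ge0; case/andP: (psi01 i x).
    - by apply: prodr_ge0 => j _; rewrite subr_ge0; case/andP: (psi01 j x).
    - by case: (hpsi i) => _ _ /(_ x (ltW ix)) + _; lra.
    - apply: prodr_ile1 => j _; case/andP: (psi01 j x) => u0 u1.
      by rewrite subr_ge0 u1 lerBlDr lerDl.
  have h2 : `|\sum_(i < N) (f x - f (c i)) * phi i x| <= e * S + N%:R * (2 * M * eta).
    apply: le_trans (ler_norm_sum _ _ _) _.
    have -> : e * S + N%:R * (2 * M * eta) = \sum_(i < N) (e * phi i x + 2 * M * eta).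
      by rewrite big_split /= mulr_sumr sumr_const card_ord mulr_natl.
    apply: ler_sum => i _; rewrite normrM (ger0_norm (phi0 i x)).
    have Me : 0 <= 2 * M * eta by apply: mulr_ge0; [apply: mulr_ge0; [lra|exact: ltW]|exact: ltW].
    have ep : 0 <= e * phi i x by apply: mulr_ge0; [exact: ltW|exact: phi0].
    have [xd|xd] := leP d (dist2 (c i) x); last first.
      have h0 : `|f x - f (c i)| <= e by rewrite distrC; exact: (hd _ _ xd).
      by apply: (le_trans (ler_wpM2r (phi0 i x) h0)); rewrite lerDl.
    have pe : phi i x <= eta.
      apply: le_trans (peel_le i (psi01^~ x)) _.
      by case: (hpsi i) => _ _ _; apply; rewrite mulrC divfK.
    have fM : `|f x - f (c i)| <= 2 * M.
      by have := ler_normB (f x) (f (c i)); have := hM x; have := hM (c i); lra.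
    rewrite -[leLHS]add0r; apply: lerD => //; exact: ler_pM.
  have -> : f x - g x = f x * (1 - S) + \sum_(i < N) (f x - f (c i)) * phi i x.
    have -> : \sum_(i < N) (f x - f (c i)) * phi i x = f x * S - g x.
      by rewrite /S mulr_sumr /g -sumrB; apply: eq_bigr => i _; rewrite mulrBl.
    by ring.
  apply: le_trans (ler_normD _ _) _.
  have : e * S <= e * 1 by rewrite ler_pM2l.
  by move: h1 h2 etaE; lra.
have [cg Eg] := gauss_span_eq p1 p2 E sg.
have h1 := poslin_dist p1 (Cc_Cb cf) cg fg; have h2 := poslin_dist p2 (Cc_Cb cf) cg fg.
rewrite /m mulrDr; apply: le_trans (lerD h1 h2).
have -> : L1 f - L2 f = (L1 f - L1 g) - (L2 f - L2 g) by rewrite Eg; ring.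
exact: ler_normB.
Qed.

End Density.

(** * Smoothing and uniqueness *)

Section Smoothing.
Variables (R : realType) (n : nat).
Notation V := 'rV[R]_n.
Implicit Types (x y z v : V) (theta L : (V -> R) -> R) (f g : V -> R) (e r s : R).

Lemma dist2_scale e x u v : dist2 (x + e *: u) (x + e *: v) = e ^+ 2 * dist2 u v.
Proof. by rewrite /dist2 mulr_sumr; apply: eq_bigr => i _; rewrite !mxE; ring. Qed.

Lemma dist2_opp_scale e x y v : dist2 y (x - e *: v) = dist2 x (y + e *: v).
Proof. by rewrite /dist2; apply: eq_bigr => i _; rewrite !mxE; ring. Qed.

Lemma dist2_translate v x y : dist2 (x + v) (y + v) = dist2 x y.
Proof. by rewrite /dist2; apply: eq_bigr => i _; rewrite !mxE; ring. Qed.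

Lemma continuous_lipschitz (h : V -> V) (c : R) :
  (forall u v, dist2 (h u) (h v) <= c * dist2 u v) -> continuous h.
Proof.
move=> H u P /dist2_nbhs[d d0 hd].
have c0 : 0 < `|c| + 1 by rewrite ltr_wpDl.
suff : \forall v \near u, P (h v) by [].
apply: (filterS _ (near_dist2 u (divr_gt0 d0 c0))) => v hv; apply: hd; apply: le_lt_trans (H u v) _.
apply: (@le_lt_trans _ _ ((`|c| + 1) * dist2 u v)).
  apply: ler_wpM2r; first exact: dist2_ge0.
  by apply: le_trans (ler_norm _) _; rewrite lerDl.
by rewrite mulrC -ltr_pdivlMr.
Qed.

Lemma Cont_affine f x e : Cont f -> Cont (fun v => f (x + e *: v)).
Proof.
move=> cf u; apply: (@continuous_comp _ _ _ (fun v => x + e *: v) f); last exact: cf.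
by apply: (@continuous_lipschitz _ (e ^+ 2)) => a b; rewrite dist2_scale.
Qed.

Lemma Cont_cst (c : R) : Cont (fun _ : V => c).
Proof. exact: continuous_cst. Qed.

Lemma supported_dist theta r f g e : poslin (@Cont R n) theta -> supported r theta -> Cont f -> Cont g ->
  (forall v, dist2 0 v <= r -> `|f v - g v| <= e) -> `|theta f - theta g| <= e * theta (fun=> 1).
Proof.
move=> pt st cf cg fg; have lK := @linclass_Cont R n.
have ce : Cont (fun _ : V => e * 1) by exact: Cont_cst.
have cN : Cont (fun _ : V => (- e) * 1) by exact: Cont_cst.
have cB := linclassB lK cf cg.
rewrite -(poslinB lK pt cf cg) ler_norml -mulNr.
rewrite -(poslinZ pt (- e) (@Cont_cst 1)) -(poslinZ pt e (@Cont_cst 1)); apply/andP; split.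
  by apply: st => // v vr; have := fg v vr; rewrite ler_norml mulr1 => /andP[].
by apply: st => // v vr; have := fg v vr; rewrite ler_norml mulr1 => /andP[].
Qed.

(** Convolution with the image of [theta] under dilation by [e], left unnormalized: it tends to
    [theta (fun=> 1)] times [f]. *)
Definition smooth theta e f x : R := theta (fun v => f (x - e *: v)).

Lemma Cont_smooth_arg f x e : Cont f -> Cont (fun v => f (x - e *: v)).
Proof. by move=> cf; under eq_fun do rewrite -scaleNr; exact: Cont_affine. Qed.

Lemma Cb_smooth theta r e f : poslin (@Cont R n) theta -> 0 <= r -> supported r theta -> Cb f -> Cb (smooth theta e f).
Proof.
move=> pt r0 st [cf [M hM]]; have lK := @linclass_Cont R n.
pose m := theta (fun=> 1); have m0 : 0 <= m by apply: (poslin_ge0 pt) => //; exact: Cont_cst.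
split; last first.
  exists (M * m) => x; rewrite -[smooth _ _ _ _]subr0.
  have t0 : theta (fun=> 0) = 0.
    have -> : (fun _ : V => 0 : R) = (fun=> 0 * 1) by apply/funext => v; rewrite mulr1.
    by rewrite (poslinZ pt) ?mul0r //; exact: Cont_cst.
  rewrite -t0; apply: (supported_dist pt st); [exact: Cont_smooth_arg|exact: Cont_cst|].
  by move=> v _; rewrite subr0.
apply/continuous_near => x0 e0 e00.
have m1 : 0 < m + 1 by rewrite ltr_wpDl.
have e1 : 0 < e0 / (m + 1) by rewrite divr_gt0.
pose rho := 2 * (2 * dist2 0 x0 + 2) + 2 * (e ^+ 2 * r).
have [d d0 hd] := Cc_uniform (Cc_mull (@Cc_cutoff R n rho) cf) e1.
near=> x.
have xd : dist2 x0 x < Num.min 1 d by near: x; apply: near_dist2; rewrite lt_min ltr01.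
have {xd} [x1 xd] : dist2 x0 x < 1 /\ dist2 x0 x < d by move: xd; rewrite lt_min => /andP[].
have in_rho y v : dist2 x0 y <= 1 -> dist2 0 v <= r -> dist2 0 (y - e *: v) <= rho.
  move=> h1 h2; have := dist2_split2 y 0 (y - e *: v).
  have := dist2_scale (- e) y 0 v; rewrite scaler0 addr0 sqrrN scaleNr => ->.
  have := dist2_split2 x0 0 y; have : e ^+ 2 * dist2 0 v <= e ^+ 2 * r by rewrite ler_wpM2l ?sqr_ge0.
  by rewrite /rho; lra.
apply: (@le_trans _ _ (e0 / (m + 1) * m)).
  apply: (supported_dist pt st); [exact: Cont_smooth_arg|exact: Cont_smooth_arg|].
  move=> v vr; have := hd (x0 - e *: v) (x - e *: v).
  rewrite !cutoff1 ?mul1r ?in_rho ?dist2xx ?ler01 ?(ltW x1) //; apply.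
  by rewrite dist2_translate.
by rewrite mulrAC ler_pdivrMr // ler_pM2l // lerDl.
Unshelve. all: end_near. Qed.

Lemma poslin_smooth theta r e L : poslin (@Cont R n) theta -> 0 <= r -> supported r theta ->
  poslin (@Cb R n) L -> poslin (@Cb R n) (fun f => L (smooth theta e f)).
Proof.
move=> pt r0 st pL; have cS f : Cb f -> Cb (smooth theta e f) := Cb_smooth e pt r0 st.
split=> [f g cf cg|c f cf|f cf f0].
- rewrite -(poslinD pL (cS f cf) (cS g cg)); congr L; apply/funext => x.
  by rewrite /smooth -(poslinD pt) //; apply: Cont_smooth_arg; exact: Cb_Cont.
- rewrite -(poslinZ pL c (cS f cf)); congr L; apply/funext => x.
  by rewrite /smooth -(poslinZ pt) //; apply: Cont_smooth_arg; exact: Cb_Cont.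
- apply: (poslin_ge0 pL (cS f cf)) => x; apply: (poslin_ge0 pt) => //.
  by apply: Cont_smooth_arg; exact: Cb_Cont.
Qed.

Lemma tight_smooth theta r e L : poslin (@Cont R n) theta -> 0 <= r -> supported r theta ->
  poslin (@Cb R n) L -> tight L -> tight (fun f => L (smooth theta e f)).
Proof.
move=> pt r0 st pL tL d d0; have lB := @linclass_Cb R n.
pose m := theta (fun=> 1); have m0 : 0 <= m by apply: (poslin_ge0 pt) => //; exact: Cont_cst.
have m1 : 0 < m + 1 by rewrite ltr_wpDl.
have [rho rho0 hrho] := tL _ (divr_gt0 d0 m1).
pose rho' := 2 * (rho + 1) + 2 * (e ^+ 2 * r).
have er : 0 <= e ^+ 2 * r by rewrite mulr_ge0 // sqr_ge0.
exists rho'; first by rewrite /rho'; lra.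
apply: (@le_trans _ _ (L (fun x => m * (1 - cutoff rho x)))); last first.
  rewrite (poslinZ pL); last exact: Cb_cut1.
  apply: (le_trans (ler_wpM2l m0 hrho)).
  by rewrite mulrCA ger_pMr // ler_pdivrMr // mul1r lerDl.
apply: (poslin_le lB pL); [apply: (Cb_smooth e pt r0 st); exact: Cb_cut1|by apply: Cb_scale; exact: Cb_cut1|].
move=> x; rewrite mulrC /smooth -(poslinZ pt); last exact: Cont_cst.
have cc : Cont (fun u : V => 1 - cutoff rho' u) by case: (@Cb_cut1 R n rho').
apply: st; [exact: (Cont_smooth_arg cc)|exact: Cont_cst|].
move=> v vr; have [xr|xr] := leP (dist2 0 x) (rho + 1); last first.
  by rewrite [cutoff rho x]cutoff0 ?(ltW xr) // subr0 mulr1 lerBlDr lerDl cutoff_ge0.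
rewrite cutoff1 ?subrr ?mulr1 ?subr_ge0 ?cutoff_le1 //.
have := dist2_split2 x 0 (x - e *: v).
have := dist2_scale (- e) x 0 v; rewrite scaler0 addr0 sqrrN scaleNr => ->.
have : e ^+ 2 * dist2 0 v <= e ^+ 2 * r by rewrite ler_wpM2l ?sqr_ge0.
by rewrite /rho'; lra.
Qed.

Lemma smooth_approx theta r L f (d : R) : poslin (@Cont R n) theta -> 0 <= r -> supported r theta ->
  poslin (@Cb R n) L -> Cc f -> 0 < d -> exists2 e0 : R, 0 < e0 & forall e, 0 < e <= e0 ->
  `|L (smooth theta e f) - theta (fun=> 1) * L f| <= d * theta (fun=> 1) * L (fun=> 1).
Proof.
move=> pt r0 st pL cf d0; have [t t0 ht] := Cc_uniform cf d0.
have r1 : 0 < r + 1 by rewrite ltr_wpDl.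
have a0 : 0 < t / (r + 1) by rewrite divr_gt0.
exists (Num.min 1 (t / (r + 1))); first by rewrite lt_min ltr01.
move=> e /andP[e0]; rewrite le_min => /andP[e1 et].
have cS := Cb_smooth e pt r0 st (Cc_Cb cf).
rewrite -(poslinZ pL); last exact: Cc_Cb.
apply: (poslin_dist pL cS); first by apply: Cb_scale; exact: Cc_Cb.
move=> x; rewrite [theta _ * f x]mulrC /smooth -(poslinZ pt (f x)); last exact: Cont_cst.
apply: (supported_dist pt st); [apply: Cont_smooth_arg; exact: Cc_Cont|exact: Cont_cst|].
move=> v vr; rewrite mulr1 distrC; apply: ht.
have := dist2_scale (- e) x 0 v; rewrite scaler0 addr0 sqrrN scaleNr => ->.
have h1 : e ^+ 2 <= e by rewrite expr2 ger_pMr.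
have h2 : e ^+ 2 * dist2 0 v <= e * r by apply: ler_pM => //; rewrite ?sqr_ge0 ?dist2_ge0.
have h3 : e * (r + 1) <= t by rewrite -ler_pdivlMr.
by move: h2 h3 e0; clear; lra.
Qed.

Lemma poslin_affine theta y e : poslin (@Cont R n) theta ->
  poslin (@Cont R n) (fun f => theta (fun v => f (y + e *: v))).
Proof.
move=> pt; split=> [f g cf cg|c f cf|f cf f0].
- by rewrite (poslinD pt) //; exact: Cont_affine.
- by rewrite (poslinZ pt) //; exact: Cont_affine.
- by apply: (poslin_ge0 pt) => //; exact: Cont_affine.
Qed.

Lemma supported_affine theta y e r : supported r theta ->
  supported (2 * dist2 0 y + 2 * (e ^+ 2 * r)) (fun f => theta (fun v => f (y + e *: v))).
Proof.
move=> st f g cf cg fg; apply: st => [||v vr]; [exact: Cont_affine|exact: Cont_affine|].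
apply: fg; have := dist2_split2 y 0 (y + e *: v).
have := dist2_scale e y 0 v; rewrite scaler0 addr0 => ->.
have : e ^+ 2 * dist2 0 v <= e ^+ 2 * r by rewrite ler_wpM2l ?sqr_ge0.
by lra.
Qed.

End Smoothing.

(** * Uniqueness from integrals of continuous potentials *)

Section FunctionalUniqueness.
Variables (R : realType) (n : nat) (alpha q : R).
Hypotheses (n0 : (0 < n)%N) (qE : q = (n%:R - alpha) / 2) (q0 : 0 < q) (al : 0 < alpha <= 2).
Notation V := 'rV[R]_n.
Notation ker := (rker q).
Implicit Types (x y z v : V) (theta L : (V -> R) -> R) (f g : V -> R) (e r s : R).

Lemma ker_affine s e x y v : 0 < e -> 0 < s ->
  ker s x (y + e *: v) = (e ^+ 2) `^ (- q) * ker (s / e ^+ 2) (e^-1 *: (x - y)) v.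
Proof.
move=> e0 s0; have e2 : 0 < e ^+ 2 by rewrite exprn_gt0.
rewrite /rker -powRM ?(ltW e2) ?(ltW (dist2D_gt0 _ _ _)) ?divr_gt0 //.
rewrite mulrDr -(dist2_scale e y) [e ^+ 2 * (s / _)]mulrC divfK ?lt0r_neq0 //.
by rewrite scalerA divff ?lt0r_neq0 // scale1r [y + (x - y)]addrC subrK.
Qed.

Lemma theta_affine theta s e x y : poslin (@Cont R n) theta -> 0 < e -> 0 < s ->
  theta (fun v => ker s x (y + e *: v)) = (e ^+ 2) `^ (- q) * theta (ker (s / e ^+ 2) (e^-1 *: (x - y))).
Proof.
move=> pt e0 s0; have e2 : 0 < e ^+ 2 by rewrite exprn_gt0.
rewrite -(poslinZ pt); last by apply: (Cont_ker q0); exact: divr_gt0.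
by congr theta; apply/funext => v; exact: ker_affine.
Qed.

(** The threshold [s0 * e^2] does not depend on the translation [y]; this is the source of
    uniformity at the boundary [s = 0]. *)
Lemma tail_affine theta s0 d e y : poslin (@Cont R n) theta -> 0 < e -> 0 < s0 ->
  (forall s x, 0 < s -> s <= s0 -> theta (ker s x) <= theta (ker s0 x) + d) ->
  forall s x, 0 < s -> s <= s0 * e ^+ 2 ->
  theta (fun v => ker s x (y + e *: v)) <= theta (fun v => ker (s0 * e ^+ 2) x (y + e *: v)) + (e ^+ 2) `^ (- q) * d.
Proof.
move=> pt e0 s00 H s x sp ss; have e2 : 0 < e ^+ 2 by rewrite exprn_gt0.
have se : 0 < s0 * e ^+ 2 by rewrite mulr_gt0.
rewrite (theta_affine x y pt e0 sp) (theta_affine x y pt e0 se) -mulrDr mulfK ?lt0r_neq0 //.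
apply: ler_wpM2l; first exact: powR_ge0.
by apply: H; rewrite ?divr_gt0 // ler_pdivrMr.
Qed.

Lemma uniform_tail_affine theta e y : poslin (@Cont R n) theta -> 0 < e -> uniform_tail q theta ->
  uniform_tail q (fun f => theta (fun v => f (y + e *: v))).
Proof.
move=> pt e0 ut d d0; have e2 : 0 < e ^+ 2 by rewrite exprn_gt0.
have c0 : 0 < (e ^+ 2) `^ (- q) by rewrite powR_gt0.
have [s0 s00 H] := ut _ (divr_gt0 d0 c0).
exists (s0 * e ^+ 2); first exact: mulr_gt0.
move=> s x sp ss; apply: le_trans (tail_affine y pt e0 s00 H x sp ss) _.
by rewrite [_ `^ _ * (d / _)]mulrC divfK // lt0r_neq0.
Qed.

(** The smoothed functionals evaluate a kernel centred at [y] as the regularized potential of a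
    translated and dilated [theta], to which the hypothesis applies with constants independent of
    [y]. The maximum principle is used in both directions, and the dilation then tends to 0. *)
Lemma functional_unique L1 L2 theta r (M : R) : poslin (@Cb R n) L1 -> poslin (@Cb R n) L2 -> tight L1 -> tight L2 ->
  poslin (@Cont R n) theta -> 0 <= r -> supported r theta -> 0 < theta (fun=> 1) -> uniform_tail q theta -> 0 < M ->
  (forall th r' s0 d, poslin (@Cont R n) th -> 0 <= r' -> supported r' th -> uniform_tail q th -> 0 < s0 -> 0 < d ->
     (forall s x, 0 < s -> s <= s0 -> th (ker s x) <= th (ker s0 x) + d) ->
     forall s, 0 < s -> s <= s0 -> `|L1 (fun x => th (ker s x)) - L2 (fun x => th (ker s x))| <= d * M) ->
  forall f, Cc f -> L1 f = L2 f.
Proof.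
move=> p1 p2 t1 t2 pt r0 st th0 ut M0 H f cf.
pose S e L g := L (smooth theta e g).
have eqS e : 0 < e -> S e L1 f = S e L2 f.
  move=> e0; have e2 : 0 < e ^+ 2 by rewrite exprn_gt0.
  have c0 : 0 < (e ^+ 2) `^ (- q) by rewrite powR_gt0.
  have pS1 := poslin_smooth e pt r0 st p1; have pS2 := poslin_smooth e pt r0 st p2.
  have tS1 := tight_smooth e pt r0 st p1 t1; have tS2 := tight_smooth e pt r0 st p2 t2.
  have bd d : 0 < d -> exists2 s0, 0 < s0 & forall s y, 0 < s <= s0 -> `|S e L1 (ker s y) - S e L2 (ker s y)| <= d.
    (* The dilation multiplies the tail by [(e^2)^(-q)] and the hypothesis multiplies it by [M];
       both factors are divided out beforehand. *)
    move=> d0; pose d' := d / M / (e ^+ 2) `^ (- q).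
    have d'0 : 0 < d' by rewrite !divr_gt0.
    have [s0 s00 Hs] := ut _ d'0.
    exists (s0 * e ^+ 2); first exact: mulr_gt0.
    move=> s y /andP[sp ss].
    have KE : smooth theta e (ker s y) = fun x => theta (fun v => ker s x (y + e *: v)).
      apply/funext => x; congr (theta _); apply/funext => v; rewrite /rker dist2_opp_scale; exact: erefl.
    have dM : 0 < d / M by exact: divr_gt0.
    have rr : 0 <= 2 * dist2 0 y + 2 * (e ^+ 2 * r).
      by apply: addr_ge0; apply: mulr_ge0; [exact: ler0n|exact: dist2_ge0|exact: ler0n|exact: (mulr_ge0 (sqr_ge0 e) r0)].
    have tl s' x : 0 < s' -> s' <= s0 * e ^+ 2 ->
        theta (fun v => ker s' x (y + e *: v)) <= theta (fun v => ker (s0 * e ^+ 2) x (y + e *: v)) + d / M.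
      move=> sp' ss'; apply: le_trans (tail_affine y pt e0 s00 Hs x sp' ss') _.
      rewrite [_ `^ _ * d']mulrC (divfK (lt0r_neq0 c0)); exact: lexx.
    have h := H _ _ _ _ (poslin_affine y e pt) rr (@supported_affine R n theta y e r st)
      (@uniform_tail_affine theta e y pt e0 ut) (mulr_gt0 s00 e2) dM tl s sp ss.
    by move: h; rewrite (divfK (lt0r_neq0 M0)) /S -KE.
  have E : forall s y, 0 < s -> S e L1 (ker s y) = S e L2 (ker s y).
    move=> s y sp; apply/eqP; rewrite eq_le; apply/andP; split.
      apply: (maximum_principle n0 qE q0 al pS1 pS2 tS1) => // d d0.
      have [s0 s00 hs] := bd d d0; exists s0 => // s' y' h'.
      by have := hs s' y' h'; rewrite ler_norml lerBlDl => /andP[].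
    apply: (maximum_principle n0 qE q0 al pS2 pS1 tS2) => // d d0.
    have [s0 s00 hs] := bd d d0; exists s0 => // s' y' h'.
    by have := hs s' y' h'; rewrite distrC ler_norml lerBlDl => /andP[].
  exact: (Cc_eq_of_gauss pS1 pS2 (gauss_eq q0 pS1 pS2 E) cf).
pose m := theta (fun=> 1).
have c1 : Cb (fun _ : V => 1 : R) by exact: Cb_cst.
pose B := L1 (fun=> 1) + L2 (fun=> 1).
have B0 : 0 <= B by apply: addr_ge0; [apply: (poslin_ge0 p1 c1)|apply: (poslin_ge0 p2 c1)].
suff key (d : R) : 0 < d -> `|L1 f - L2 f| <= d * B.
  apply/eqP; rewrite -subr_eq0 -normr_eq0 eq_le normr_ge0 andbT.
  apply/ler_addgt0Pr => d d0; rewrite add0r.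
  have B1 : 0 < B + 1 by rewrite ltr_wpDl.
  apply: le_trans (key _ (divr_gt0 d0 B1)) _.
  by rewrite mulrAC ler_pdivrMr // ler_pM2l // lerDl.
move=> d0.
have [e1 e10 h1] := smooth_approx pt r0 st p1 cf d0.
have [e2 e20 h2] := smooth_approx pt r0 st p2 cf d0.
pose e := Num.min e1 e2; have e0 : 0 < e by rewrite lt_min e10.
have /h1 a1 : 0 < e <= e1 by rewrite e0 ge_min lexx.
have /h2 a2 : 0 < e <= e2 by rewrite e0 ge_min lexx orbT.
have := eqS e e0; rewrite /S => E; rewrite E in a1.
rewrite -(ler_pM2l th0) -[X in X * `|_|](ger0_norm (ltW th0)) -normrM.
have -> : theta (fun=> 1) * (L1 f - L2 f) = (L2 (smooth theta e f) - theta (fun=> 1) * L2 f)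
   - (L2 (smooth theta e f) - theta (fun=> 1) * L1 f) by ring.
apply: le_trans (ler_normB _ _) _; apply: le_trans (lerD a2 a1) _.
by rewrite /B -mulrDr [L2 _ + _]addrC mulrCA mulrA.
Qed.

End FunctionalUniqueness.

Lemma le_cvg_to (R : realType) (I : Type) (U : set_system I) (a b : I -> R) (l m : R) : ProperFilter U ->
  a i @[i --> U] --> l -> b i @[i --> U] --> m -> (\forall i \near U, a i <= b i) -> l <= m.
Proof.
move=> PU al bm h; rewrite -subr_ge0; apply: (cvgr_to_ge (cvgB bm al)).
by apply: filterS h => i; rewrite /= subr_ge0.
Qed.

(** * Vague limits with bounded masses *)

Section RadonUniqueness.
Variables (R : realType) (n : nat) (alpha q : R).
Hypotheses (n0 : (0 < n)%N) (qE : q = (n%:R - alpha) / 2) (q0 : 0 < q) (al : 0 < alpha <= 2).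
Notation V := 'rV[R]_n.
Notation ker := (rker q).
Implicit Types (x y z v : V) (theta L mu nu : (V -> R) -> R) (f g : V -> R) (e d r s : R).

Definition mass_le nu (C : R) := forall f, Cc f -> (forall x, 0 <= f x <= 1) -> nu f <= C.

Lemma mass_le_scale nu (C M : R) f : pos_radon nu -> mass_le nu C -> 0 < M -> Cc f ->
  (forall x, 0 <= f x <= M) -> nu f <= M * C.
Proof.
move=> pn hC M0 cf hf; rewrite -ler_pdivrMl // -(poslinZ pn) //; apply: hC; first exact: Cc_scale.
by move=> x; have /andP[h0 h1] := hf x; rewrite ler_pdivrMl // mulr1 h1 mulr_ge0 // invr_ge0 ltW.
Qed.

Lemma Cb_max0 f : Cb f -> Cb (fun x => Num.max 0 (f x)).
Proof.
move=> [cf [M hM]]; split; first by apply: continuous_maxr => //; exact: continuous_cst.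
exists M => x; apply: le_trans (hM x); rewrite ger0_norm ?le_max ?lexx //.
by rewrite ge_max normr_ge0 ler_norm.
Qed.

Lemma Cc_cut f (j : R) : continuous f -> Cc (fun x => f x * cutoff j x).
Proof. by move=> cf; apply: Cc_mulr cf; exact: Cc_cutoff. Qed.

(** The extension is the limit over growing cutoffs. It has no mass at infinity by construction,
    which gives tightness and reduces upper bounds to cut functions. *)
Lemma radon_extension nu (C : R) : pos_radon nu -> mass_le nu C ->
  exists L, [/\ poslin (@Cb R n) L, forall f, Cc f -> L f = nu f, tight L &
    forall g (M : R), Cb g -> (forall j : nat, nu (fun x => g x * cutoff j%:R x) <= M) -> L g <= M].
Proof.
move=> pn hC; have lC := @linclass_Cc R n; have lB := @linclass_Cb R n.
have cw f j : Cb f -> Cc (fun x => f x * cutoff (j%:R : R) x) by move=> [cf _]; exact: Cc_cut.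
have mono f : Cb f -> (forall x, 0 <= f x) ->
    nondecreasing_seq (fun j : nat => nu (fun x => f x * cutoff (j%:R : R) x)).
  move=> cf f0 i j ij; apply: (poslin_le lC pn) => [||x]; [exact: cw|exact: cw|].
  by apply: ler_wpM2l => //; apply: le_cutoff; rewrite ler_nat.
have [|||L [pL hL]] := @density_lim R n (@Cc R n) (@Cb R n) nu (fun j => cutoff j%:R) lC lB pn Cb_max0.
- by move=> j x; exact: cutoff_ge0.
- by move=> f j cf; exact: cw.
- move=> f cf f0; apply: nondecreasing_is_cvgn; first exact: mono.
  have [_ [M hM]] := cf; exists ((`|M| + 1) * C) => _ [j _ <-].
  apply: (mass_le_scale pn hC); [by rewrite ltr_wpDl|exact: cw|].
  move=> x; rewrite mulr_ge0 ?cutoff_ge0 //= -[leRHS]mulr1; apply: ler_pM => //; rewrite ?cutoff_ge0 ?cutoff_le1 //.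
  apply: le_trans (ler_norm _) _; apply: le_trans (hM x) _; apply: le_trans (ler_norm _) _.
  by rewrite lerDl.
have EL f : Cc f -> L f = nu f.
  move=> cf; apply: (@cvg_unique _ _ (nu (fun x => f x * cutoff j%:R x) @[j --> \oo])) => //.
    by apply: hL; exact: Cc_Cb.
  have [r [r0 hr]] := Cc_cutoff_eq cf; have [j0 hj0] := nat_large r.
  apply: cvg_near_cst; exists j0 => // j /= jj; congr nu; apply/funext => x.
  by rewrite mulrC -(hr _ (hj0 j jj)).
exists L; split=> //; last first.
  by move=> g M cg h; apply: (cvgr_to_le (hL g cg)); near=> j; exact: h.
move=> d d0; have c1 : Cb (fun _ : V => 1 : R) by exact: Cb_cst.
have /cvgrPdist_le/(_ d d0)[j0 _ /(_ j0 (leqnn j0)) h] := hL _ c1.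
exists j0%:R => //; rewrite (poslinB lB pL c1); last by apply: Cc_Cb; exact: Cc_cutoff.
rewrite (EL _ (@Cc_cutoff R n j0%:R)); apply: le_trans h; apply: le_trans (ler_norm _).
have -> // : (fun x => 1 * cutoff j0%:R x) = cutoff (j0%:R : R) :> (V -> R).
by apply/funext => x; rewrite mul1r.
Unshelve. all: end_near. Qed.

Lemma Cb_theta_ker theta s : poslin (@Cont R n) theta -> 0 < s -> Cb (fun x => theta (ker s x)).
Proof.
move=> pt s0; have lK := @linclass_Cont R n.
have t0 x : 0 <= theta (ker s x).
  by apply: (poslin_ge0 pt) => [|y]; [exact: Cont_ker|exact: ker_ge0].
split; last first.
  exists (s `^ (- q) * theta (fun=> 1)) => x; rewrite ger0_norm // -(poslinZ pt); last exact: Cont_cst.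
  apply: (poslin_le lK pt) => [||y]; [exact: Cont_ker|exact: Cont_cst|].
  by rewrite mulr1; exact: ker_le.
apply: (@harnack_continuous _ _ q q0 s) => //.
have := @harnack_poslin R n q q0 (@Cont R n) theta (fun=> 1) s lK pt s0.
under eq_fun do under eq_fun do rewrite mul1r.
by apply => // x; under eq_fun do rewrite mul1r; exact: Cont_ker.
Qed.

Lemma theta_ker_decay theta r s d : poslin (@Cont R n) theta -> 0 <= r -> supported r theta -> 0 < s -> 0 < d ->
  exists rho : R, forall x, rho <= dist2 0 x -> theta (ker s x) <= d.
Proof.
move=> pt r0 st s0 d0; pose m := theta (fun=> 1).
have m0 : 0 <= m by apply: (poslin_ge0 pt) => //; exact: Cont_cst.
have m1 : 0 < m + 1 by rewrite ltr_wpDl.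
have [M M0 hM] := powRN_small q0 (divr_gt0 d0 m1).
exists (2 * M + 2 * r) => x xr.
apply: (@le_trans _ _ (d / (m + 1) * m)); last by rewrite mulrAC ler_pdivrMr // ler_pM2l // lerDl.
rewrite -(poslinZ pt); last exact: Cont_cst.
apply: st; [exact: Cont_ker|exact: Cont_cst|move=> v vr].
rewrite mulr1; apply: hM; have := dist2_split2 v 0 x; rewrite (dist2C v x); lra.
Qed.

(** Mass escaping to infinity is bounded by [C] and the regularized potential of [theta] vanishes
    there, so it leaves no trace in the limit. Of the error [2 * d * C], one [d] pays for the
    regularization and the other for cutting off at [rho]. *)
Lemma potential_limit (I : Type) (U : set_system I) (lam_ : I -> (V -> R) -> R) nu L theta (C r s0 d J : R) (J_ : I -> R) :
  ProperFilter U -> (forall i, pos_radon (lam_ i)) -> (forall i, mass_le (lam_ i) C) ->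
  (forall f, Cc f -> lam_ i f @[i --> U] --> (nu f : R)) ->
  poslin (@Cb R n) L -> (forall f, Cc f -> L f = nu f) ->
  (forall g (M : R), Cb g -> (forall j : nat, nu (fun x => g x * cutoff j%:R x) <= M) -> L g <= M) ->
  poslin (@Cont R n) theta -> 0 <= r -> supported r theta -> 0 < s0 -> 0 < d ->
  (forall s x, 0 < s -> s <= s0 -> theta (ker s x) <= theta (ker s0 x) + d) ->
  (\forall i \near U, uint (lam_ i) (potential alpha theta) = (J_ i)%:E) -> J_ i @[i --> U] --> J ->
  forall s, 0 < s -> s <= s0 -> L (fun x => theta (ker s x)) <= J /\ J <= L (fun x => theta (ker s x)) + 2 * d * C.
Proof.
move=> PU pl hC hl pL EL hL pt r0 st s00 d0 tl hJ cJ s sp ss.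
have lC := @linclass_Cc R n; have lB := @linclass_Cb R n.
have cK t : 0 < t -> Cb (fun x => theta (ker t x)) by exact: Cb_theta_ker.
have K0 t x : 0 < t -> 0 <= theta (ker t x).
  by move=> t0; apply: (poslin_ge0 pt) => [|y]; [exact: Cont_ker|exact: ker_ge0].
have cKc t (j : R) : 0 < t -> Cc (fun x => theta (ker t x) * cutoff j x).
  by move=> t0; apply: Cc_cut; case: (cK t t0).
have Kc t (j : R) x : 0 < t -> theta (ker t x) * cutoff j x <= theta (ker t x).
  by move=> t0; rewrite -[leRHS]mulr1; apply: ler_wpM2l; [exact: K0|exact: cutoff_le1].
split.
  apply: (hL _ _ (cK s sp)) => j.
  have cc := cKc s j%:R sp.
  suff h : \forall i \near U, lam_ i (fun x => theta (ker s x) * cutoff j%:R x) <= J_ i.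
    exact: (le_cvg_to PU (hl _ cc) cJ h).
  apply: filterS hJ => i Ji; rewrite -lee_fin -Ji; apply: uint_ge; first exact: cKc.
    by move=> x; apply: mulr_ge0; [exact: K0|exact: cutoff_ge0].
  move=> x; apply: le_trans (le_ker_potential qE q0 x pt st sp).
  by rewrite lee_fin; exact: Kc.
have [rho hrho] := theta_ker_decay pt r0 st s00 d0.
pose g x := theta (ker s0 x) * cutoff rho x.
have cg : Cc g by exact: cKc.
have g0 x : 0 <= g x by apply: mulr_ge0; [exact: K0|exact: cutoff_ge0].
have J1 : J <= nu g + 2 * d * C.
  suff h : \forall i \near U, J_ i <= lam_ i g + 2 * d * C.
    have h1 : (lam_ i g + 2 * d * C) @[i --> U] --> nu g + 2 * d * C.
      by apply: cvgD; [exact: hl|exact: cvg_cst].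
    exact: (le_cvg_to PU cJ h1 h).
  apply: filterS hJ => i Ji; rewrite -lee_fin -Ji; apply: uint_le => f cf f0 fp.
  rewrite lee_fin; pose k x := Num.max 0 (f x - g x).
  have ck : Cc k by apply: Cc_max_sub => //; case: cg.
  have kd x : 0 <= k x <= 2 * d.
    have fx : f x <= theta (ker s0 x) + d.
      by rewrite -lee_fin; apply: le_trans (fp x) _; apply: (potential_le_tail qE q0 x pt s00 tl); exact: ltW.
    have gx : theta (ker s0 x) <= g x + d.
      have [xr|xr] := leP (dist2 0 x) rho; last by apply: le_trans (hrho x (ltW xr)) _; rewrite lerDr.
      by rewrite /g cutoff1 // mulr1 lerDl ltW.
    rewrite /k le_max lexx /= ge_max; apply/andP; split; lra.
  apply: (@le_trans _ _ (lam_ i (fun x => g x + k x))).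
    apply: (poslin_le lC (pl i)) => // [|x]; first exact: Cc_add.
    by rewrite -lerBlDl le_max lexx orbT.
  rewrite (poslinD (pl i)) //; apply: lerD => //.
  by apply: (mass_le_scale (pl i) (hC i)) => //; rewrite mulr_gt0.
apply: (le_trans J1); apply: lerD => //; rewrite -(EL _ cg).
apply: (@le_trans _ _ (L (fun x => theta (ker s0 x)))).
  by apply: (poslin_le lB pL) => [||x]; [exact: Cc_Cb|exact: cK|exact: Kc].
apply: (poslin_le lB pL) => [||x]; [exact: cK|exact: cK|].
apply: (poslin_le (@linclass_Cont R n) pt) => [||y]; [exact: Cont_ker|exact: Cont_ker|exact: ker_decr].
Qed.

(** [potential_limit] is applied to the given family and to the constant family [mu]; both enclose
    the same number [J], so the extensions differ by at most [2 * d * C] on regularized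
    potentials. *)
Lemma limit_unique (I : Type) (U : set_system I) (lam_ : I -> (V -> R) -> R) nu mu theta (C r : R) :
  ProperFilter U -> (forall i, pos_radon (lam_ i)) -> (forall i, mass_le (lam_ i) C) ->
  pos_radon nu -> (forall f, Cc f -> lam_ i f @[i --> U] --> (nu f : R)) ->
  pos_radon mu -> mass_le mu C -> 0 < C ->
  poslin (@Cont R n) theta -> 0 <= r -> supported r theta -> 0 < theta (fun=> 1) -> uniform_tail q theta ->
  (forall th r', poslin (@Cont R n) th -> 0 <= r' -> supported r' th -> uniform_tail q th ->
     exists (J_ : I -> R) (J : R), [/\ \forall i \near U, uint (lam_ i) (potential alpha th) = (J_ i)%:E,
       J_ i @[i --> U] --> J & uint mu (potential alpha th) = J%:E]) ->
  forall f, Cc f -> nu f = mu f.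
Proof.
move=> PU pl hC pn hl pm mC C0 pt r0 st th0 ut H.
have nC : mass_le nu C.
  move=> f cf f01; apply: (cvgr_to_le (hl f cf)); near=> i; exact: hC.
have [L1 [p1 E1 t1 h1]] := radon_extension pn nC.
have [L2 [p2 E2 t2 h2]] := radon_extension pm mC.
have C20 : 0 < 2 * C by rewrite mulr_gt0.
move=> f cf; rewrite -E1 // -E2 //; move: f cf.
apply: (functional_unique n0 qE q0 al p1 p2 t1 t2 pt r0 st th0 ut C20).
move=> th r' s0 d pth r'0 sth uth s00 d0 tl s sp ss.
have [J_ [J [hJ cJ mJ]]] := H th r' pth r'0 sth uth.
have [a1 a2] := potential_limit PU pl hC hl p1 E1 h1 pth r'0 sth s00 d0 tl hJ cJ sp ss.
have hm f : Cc f -> (fun _ : I => mu f) i @[i --> U] --> (mu f : R) by move=> _; exact: cvg_cst.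
have hmJ : \forall i \near U, uint ((fun _ : I => mu) i) (potential alpha th) = ((fun _ : I => J) i)%:E by near=> i.
have [b1 b2] := @potential_limit I U (fun=> mu) mu L2 th C r' s0 d J (fun=> J) PU (fun=> pm) (fun=> mC) hm p2 E2 h2
  pth r'0 sth s00 d0 tl hmJ (cvg_cst J) s sp ss.
rewrite ler_norml; apply/andP; split; lra.
Unshelve. all: end_near. Qed.

End RadonUniqueness.

(** * Balayage *)

Section Balayage.
Variables (R : realType) (n : nat) (alpha q : R).
Hypotheses (n0 : (0 < n)%N) (qE : q = (n%:R - alpha) / 2) (q0 : 0 < q).
Notation V := 'rV[R]_n.
Notation ker := (rker q).
Implicit Types (x y z w v : V) (mu nu lam theta : (V -> R) -> R) (f : V -> R) (A E : set V) (r s d : R).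

Lemma inner_cap_set0 : inner_cap alpha (@set0 V) = 0%E.
Proof.
apply: contrapT => /inner_cap_neq0[mu [pm cE _ m1]].
have h0 : 0 < 2^-1 :> R by rewrite invr_gt0.
have [U [_ UE hU]] := concentrated_open cE h0.
have : (total_mass mu <= (2^-1)%:E)%E.
  apply: uint_le => f cf f0 f1; rewrite lee_fin; apply: hU => // x.
    by rewrite f0 /= -lee_fin f1.
  by move=> nU; case: nU; apply: UE.
by rewrite m1 lee_fin; lra.
Qed.

(** The exceptional set is empty; this is why the capacity of [set0] had to be computed. *)
Lemma ne_on_all A (P : V -> Prop) : (forall x, A x -> P x) -> ne_on alpha A P.
Proof. by move=> h; exists set0; split=> //; split=> [|x Ax _]; [exact: inner_cap_set0|exact: h]. Qed.

Lemma ne_on_imply A (P Q : V -> Prop) : (forall x, A x -> P x -> Q x) -> ne_on alpha A P -> ne_on alpha A Q.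
Proof. by move=> PQ [E [EA [E0 h]]]; exists E; split=> //; split=> // x Ax nE; apply: PQ => //; exact: h. Qed.

Lemma exists_neq w : exists v, v != w.
Proof.
have [v hv] := exists_dist2 n0 (@ler01 R); exists (w + v).
apply/eqP => e; have : dist2 0 v = 0 by rewrite -(dist2_translate w) add0r [v + w]addrC e dist2xx.
by rewrite hv => /eqP; rewrite oner_eq0.
Qed.

Lemma riesz_kernel_fin x y : x != y -> riesz_kernel alpha x y = (dist2 x y `^ (- q))%:E.
Proof. by move=> xy; rewrite (riesz_kernelE qE) (negbTE xy). Qed.

Lemma Mplus_dirac w : Mplus alpha (@dirac_m R n w).
Proof.
split; first exact: pos_radon_dirac.
have [v vw] := exists_neq w; exists v.
by rewrite (potential_dirac qE q0) riesz_kernel_fin.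
Qed.

(* [T] is so large that the support of [f] lies within square distance [4 T] of [X]. *)
Lemma far_bound nu f w : pos_radon nu -> Cc f -> (forall x, 0 <= f x <= 1) -> exists T X, [/\ 0 < T, dist2 X w = T &
  (((4 * T) `^ (- q) * nu f)%:E <= potential alpha nu X)%E].
Proof.
move=> pn cf f01; have [r [r0 hr]] := Cc_cutoff_eq cf.
pose T := 2 * dist2 0 w + 2 * (r + 1) + 1.
have w0 : 0 <= dist2 0 w := dist2_ge0 _ _.
have T0 : 0 < T by rewrite /T; lra.
have [v hv] := exists_dist2 n0 (ltW T0).
have XT : dist2 (w + v) w = T by rewrite -hv -(dist2_translate w 0 v) add0r [v + w]addrC dist2C.
exists T, (w + v); split=> //; rewrite -(poslinZ pn) //.
apply: potential_ge => // [|y|y]; first exact: Cc_scale.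
  by rewrite mulr_ge0 ?powR_ge0 //; case/andP: (f01 y).
have [->|Xy] := eqVneq (w + v) y; first by rewrite (riesz_kernelE qE) eqxx leey.
rewrite riesz_kernel_fin // lee_fin.
have [yr|yr] := leP (dist2 0 y) (r + 1); last first.
  by rewrite (hr r) // (cutoff0 (ltW yr)) mul0r mulr0 powR_ge0.
rewrite -[leRHS]mulr1; apply: ler_pM; rewrite ?powR_ge0 //; [by case/andP: (f01 y)| |by case/andP: (f01 y)].
apply: powRN_le => //; first exact: dist2_gt0.
have h1 := dist2_split2 w (w + v) y; have h2 := dist2_split2 0 w y.
by rewrite XT in h1; rewrite (dist2C w 0) in h2; rewrite /T in h1 *; lra.
Qed.

Lemma mass_le0_eq0 nu f : pos_radon nu -> mass_le nu 0 -> Cc f -> nu f = 0.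
Proof.
move=> pn m0 cf; have lC := @linclass_Cc R n.
have P0 g : Cc g -> (forall x, 0 <= g x) -> nu g = 0.
  move=> cg g0; have [M [M0 hM]] := Cc_bounded cg.
  apply/eqP; rewrite eq_le (poslin_ge0 pn) // andbT.
  have := @mass_le_scale R n nu 0 M g pn m0 M0 cg; rewrite mulr0; apply.
  by move=> x; rewrite g0 /=; apply: le_trans (ler_norm _) (hM x).
have cm := Cc_max0 cf.
have h1 := P0 _ cm (fun x => ltac:(by rewrite le_max lexx)).
have h2 := P0 _ (Cc_sub cm cf) (fun x => ltac:(by rewrite subr_ge0 le_max lexx orbT)).
by move: h2; rewrite (poslinB lC pn cm cf) h1 sub0r => /eqP; rewrite oppr_eq0 => /eqP.
Qed.

Variables (A : set V) (bal : V -> (V -> R) -> R).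
Hypothesis hb : forall y, is_balayage alpha (dirac_m y) A (bal y).

Lemma balayage_radon w : pos_radon (bal w).
Proof. by case: (hb w) => -[]. Qed.

Lemma balayage_le w lam x : Mplus alpha lam ->
  ne_on alpha A (fun y => (potential alpha (dirac_m w) y <= potential alpha lam y)%E) ->
  (potential alpha (bal w) x <= potential alpha lam x)%E.
Proof. by move=> Ml ne; case: (hb w) => _ ->; apply: ereal_inf_lbound; exists lam. Qed.

Lemma balayage_ge w x (M : \bar R) : (forall lam, Mplus alpha lam ->
  ne_on alpha A (fun y => (potential alpha (dirac_m w) y <= potential alpha lam y)%E) ->
  (M <= potential alpha lam x)%E) -> (M <= potential alpha (bal w) x)%E.
Proof. by move=> h; case: (hb w) => _ ->; apply: le_ereal_inf_tmp => _ [lam [Ml ne] <-]; exact: h. Qed.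

Lemma balayage_le_kernel w x : (potential alpha (bal w) x <= riesz_kernel alpha x w)%E.
Proof.
rewrite -(potential_dirac qE q0); apply: balayage_le; first exact: Mplus_dirac.
by apply: ne_on_all.
Qed.

(** The swept potential lies below the kernel of [w]. At the point [X], [w] has squared distance [T]
    and the support of [f] at most [4 * T], whence the factor [4 ^ q]. What counts is that the bound
    is independent of [w]. *)
Lemma balayage_mass w : mass_le (bal w) (4 `^ q).
Proof.
move=> f cf f01; have [T [X [T0 XT h]]] := far_bound w (balayage_radon w) cf f01.
have Xw : X != w by rewrite -dist2_eq0 XT lt0r_neq0.
have := le_trans h (balayage_le_kernel w X).
rewrite riesz_kernel_fin // XT lee_fin powRM ?(ltW T0) // -mulrA mulrCA.
rewrite -[X in _ <= X -> _]mulr1 ler_pM2l ?powR_gt0 // powRN -ler_pdivlMl ?invr_gt0 ?powR_gt0 //.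
by rewrite invrK mulr1.
Qed.

(** The whole of [A] is then an admissible exceptional set, so the zero functional is a
    competitor. *)
Lemma balayage_cap0 w f : inner_cap alpha A = 0%E -> Cc f -> bal w f = 0.
Proof.
move=> A0 cf; have pb := balayage_radon w; apply: mass_le0_eq0 => // g cg g01.
have [T [X [T0 XT h]]] := far_bound w pb cg g01.
pose zero (_ : V -> R) : R := 0.
have pz : pos_radon zero by split=> // *; rewrite ?addr0 ?mulr0.
have pot0 x : potential alpha zero x = 0%E.
  apply/eqP; rewrite eq_le (potential_ge0 qE q0) // andbT.
  by apply: uint_le => f' _ _ _; rewrite lee_fin.
have : (potential alpha (bal w) X <= potential alpha zero X)%E.
  apply: balayage_le; first by split=> //; exists 0; rewrite pot0.
  by exists A; split=> //; split.
rewrite pot0 => h'; have := le_trans h h'; rewrite lee_fin pmulr_rle0 //.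
by rewrite powR_gt0 // mulr_gt0.
Qed.

(** A competitor for [w'] multiplied by [c] is a competitor for [w]; only the kernels on [A] have to
    be compared. *)
Lemma balayage_scale w w' (c : R) x : 0 < c ->
  (forall y, A y -> (riesz_kernel alpha y w <= c%:E * riesz_kernel alpha y w')%E) ->
  (potential alpha (bal w) x <= c%:E * potential alpha (bal w') x)%E.
Proof.
move=> c0 h; rewrite -lee_pdivrMl //; apply: balayage_ge => lam [pl [x1 lx1]] ne.
rewrite lee_pdivrMl // -uint_scale //; apply: balayage_le.
  split; first by apply: pos_radon_scale => //; exact: ltW.
  exists x1; rewrite /potential uint_scale //; apply/eqP => e.
  have := potential_ge0 qE q0 x1 pl; move: lx1 e; rewrite /potential.
  by case: uint => [u| |] //=.
apply: ne_on_imply ne => y Ay; rewrite !(potential_dirac qE q0) => hy.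
rewrite /potential uint_scale //; apply: le_trans (h y Ay) _.
by apply: lee_wpmul2l => //; rewrite lee_fin ltW.
Qed.

End Balayage.

Lemma cvg_at_near (R : realType) (T : topologicalType) (f : T -> R) x :
  (forall e, 0 < e -> \forall y \near x, `|f x - f y| <= e) -> f @ x --> f x.
Proof. by move=> h; apply/cvgrPdist_le => e; exact: h. Qed.

(** * Continuity of the swept measures *)

Section BalayageLimit.
Variables (R : realType) (n : nat) (alpha q : R).
Hypotheses (n0 : (0 < n)%N) (qE : q = (n%:R - alpha) / 2) (q0 : 0 < q) (al : 0 < alpha <= 2).
Notation V := 'rV[R]_n.
Notation ker := (rker q).
Implicit Types (x y z w v : V) (mu nu lam theta : (V -> R) -> R) (f : V -> R) (r s d e : R).
Variables (A : set V) (bal : V -> (V -> R) -> R).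
Hypothesis hb : forall y, is_balayage alpha (dirac_m y) A (bal y).

Lemma uint_balayage_le theta s0 e w : poslin (@Cont R n) theta -> 0 < s0 -> 0 <= e ->
  (forall s x, 0 < s -> s <= s0 -> theta (ker s x) <= theta (ker s0 x) + e) ->
  (uint theta (potential alpha (bal w)) <= (theta (ker s0 w) + e)%:E)%E.
Proof.
move=> pt s00 e0 tl; apply: le_trans (potential_le_tail qE q0 w pt s00 tl e0).
apply: le_uint => x; apply: le_trans (balayage_le_kernel n0 qE q0 hb w x) _.
by rewrite (riesz_kernelC qE).
Qed.

Definition balayage_energy theta w := fine (uint theta (potential alpha (bal w))).

Lemma balayage_energyE theta w : poslin (@Cont R n) theta -> uniform_tail q theta ->
  uint theta (potential alpha (bal w)) = (balayage_energy theta w)%:E.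
Proof.
move=> pt ut; have [s0 s00 tl] := ut 1 ltr01.
have le := uint_balayage_le w pt s00 ler01 tl.
rewrite /balayage_energy fineK // ge0_fin_numE; first by apply: le_lt_trans le _; exact: ltey.
apply: (uint_ge0 (poslin_Cont_radon pt)) => x.
exact: (potential_ge0 qE q0 x (balayage_radon hb w)).
Qed.

(** At a regular point the swept potential is the kernel itself, so the limit is the potential of
    [theta] at [z]. The upper bound comes from the kernel of [w] and the continuity of that
    potential, the lower bound from [regular_lower]. *)
Lemma energy_cvg_regular theta r z : regular_pts bal z -> poslin (@Cont R n) theta -> 0 <= r -> supported r theta ->
  uniform_tail q theta -> balayage_energy theta @ z --> balayage_energy theta z.
Proof.
move=> rz pt r0 st ut; have pr := poslin_Cont_radon pt.
have PZ x : potential alpha (bal z) x = riesz_kernel alpha z x.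
  by rewrite (potential_meq alpha x rz) (potential_dirac qE q0) (riesz_kernelC qE).
have Hz sg : Mplus alpha sg -> ne_on alpha A (fun y => (potential alpha (dirac_m z) y <= potential alpha sg y)%E) ->
    forall x, (potential alpha (dirac_m z) x <= potential alpha sg x)%E.
  move=> Ms ne x; rewrite -(potential_meq alpha x rz); exact: (balayage_le hb).
have JZ : potential alpha theta z = (balayage_energy theta z)%:E.
  by rewrite -balayage_energyE //; congr uint; apply/funext => x; rewrite PZ.
apply: cvg_at_near => d d0; pose m := theta (fun=> 1).
have m0 : 0 <= m by apply: (poslin_ge0 pt) => //; exact: Cont_cst.
have d2 : 0 < d / 2 by rewrite divr_gt0.
have [s0 s00 tl] := ut _ d2.
have cK : continuous (fun x => theta (ker s0 x)) by case: (Cb_theta_ker q0 pt s00).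
(* A function of [Cc] below the kernel of [z] that agrees with the regularized kernel on the support
   of [theta]. *)
pose f x := cutoff r x * ker s0 z x.
have cf : Cc f by exact: Cc_cutker.
have f0 x : 0 <= f x by rewrite mulr_ge0 ?cutoff_ge0 ?ker_ge0.
have fz x : ((f x)%:E <= riesz_kernel alpha z x)%E.
  apply: le_trans (ker_le_riesz qE q0 z x s00); rewrite lee_fin -[leRHS]mul1r.
  by apply: ler_wpM2r; [exact: ker_ge0|exact: cutoff_le1].
have m1 : 0 < 2 * (m + 1) by rewrite mulr_gt0 // ltr_wpDl.
pose b := d / (2 * (m + 1)); have b0 : 0 < b by exact: divr_gt0.
have bm : b * m <= d / 2.
  have -> : b * m = d / 2 * (m / (m + 1)) by rewrite /b; field; rewrite lt0r_neq0 // ltr_wpDl.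
  by rewrite -[leRHS]mulr1 ler_pM2l // ler_pdivrMr ?ltr_wpDl // mul1r lerDl.
have Kz : theta (ker s0 z) <= theta f.
  apply: st => [||x xr]; [exact: Cont_ker|exact: Cc_Cont|by rewrite /f cutoff1 // mul1r].
have up0 : balayage_energy theta z <= theta (ker s0 z) + d / 2.
  by rewrite -lee_fin -JZ; apply: (potential_le_tail qE q0 z pt s00 tl); exact: ltW.
have lo0 : theta (ker s0 z) <= balayage_energy theta z.
  by rewrite -lee_fin -JZ; exact: (le_ker_potential qE q0 z pt st s00).
near=> w.
have wK : `|theta (ker s0 z) - theta (ker s0 w)| <= d / 2 by near: w; exact: (near_continuous z cK d2).
have up : balayage_energy theta w <= theta (ker s0 w) + d / 2.
  by rewrite -lee_fin -balayage_energyE //; apply: (uint_balayage_le w pt s00 _ tl); exact: ltW.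
have low : forall lam x, Mplus alpha lam ->
    ne_on alpha A (fun y => (potential alpha (dirac_m w) y <= potential alpha lam y)%E) ->
    ((f x - b)%:E <= potential alpha lam x)%E.
  by near: w; exact: (regular_lower n0 qE q0 Hz cf f0 fz b0).
pose k x := Num.max 0 (f x - b).
have ck : Cc k.
  by apply: (Cc_max_sub cf); [exact: continuous_cst|move=> _; exact: ltW].
have kP : theta k <= balayage_energy theta w.
  rewrite -lee_fin -balayage_energyE //; apply: uint_ge => // [x|x]; first by rewrite le_max lexx.
  rewrite EFin_max ge_max; apply/andP; split; first exact: (potential_ge0 qE q0 x (balayage_radon hb w)).
  by apply: (balayage_ge hb) => lam Ml ne; exact: low.
have fk : theta f <= theta k + b * m.
  have cb : Cont (fun _ : V => b * 1) by exact: Cont_cst.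
  have ckk := Cc_Cont ck.
  rewrite -(poslinZ pt b (@Cont_cst R n 1)) -(poslinD pt ckk cb).
  apply: st => [||x _]; [exact: Cc_Cont|exact: (@linclass_Cont R n).1|].
  by rewrite mulr1 -lerBlDr le_max lexx orbT.
have {wK} /andP[wK1 wK2] : - (d / 2) <= theta (ker s0 z) - theta (ker s0 w) <= d / 2 by rewrite -ler_norml.
by rewrite ler_norml; apply/andP; split; lra.
Unshelve. all: end_near. Qed.

Lemma riesz_kernel_ratio x z w (eta c rho : R) : 0 < eta -> (1 + eta) `^ q <= c -> 0 < rho ->
  rho <= dist2 x w -> rho <= dist2 x z -> (1 + 2 / eta) * dist2 w z <= eta / 2 * rho ->
  (riesz_kernel alpha x w <= c%:E * riesz_kernel alpha x z)%E.
Proof.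
move=> eta0 hc rho0 xw xz wz; have e20 : 0 < eta / 2 by rewrite divr_gt0.
have ne y : rho <= dist2 x y -> x != y.
  by move=> h; rewrite -dist2_eq0 lt0r_neq0 // (lt_le_trans rho0).
rewrite !(riesz_kernel_fin qE) ?ne // -EFinM lee_fin.
apply: le_trans (ler_wpM2r (powR_ge0 _ _) hc).
apply: (powRN_scale q0 (lt_le_trans rho0 xw) (lt_le_trans rho0 xz)); first by rewrite addr_gt0.
have := dist2_split w x z e20; rewrite invf_div.
have : eta / 2 * rho <= eta / 2 * dist2 x w by rewrite ler_pM2l.
by move: wz; set P := (1 + 2 / eta) * _; set Q := eta / 2 * rho; lra.
Qed.

(** All points of [A] keep a positive distance from [z], so the kernels of [w] and [z] on [A] have
    ratio near 1 in both directions, and [balayage_scale] carries this over to the swept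
    potentials. *)
Lemma energy_cvg_off theta z : ~ closure A z -> poslin (@Cont R n) theta ->
  uniform_tail q theta -> balayage_energy theta @ z --> balayage_energy theta z.
Proof.
move=> nA pt ut; have pr := poslin_Cont_radon pt.
have E0 w : 0 <= balayage_energy theta w.
  rewrite -lee_fin -balayage_energyE //; apply: (uint_ge0 pr) => x.
  exact: (potential_ge0 qE q0 x (balayage_radon hb w)).
have [rho rho0 far] : exists2 rho, 0 < rho & forall x, A x -> rho <= dist2 z x.
  have /dist2_nbhs[rho rho0 h] : nbhs z (~` A).
    apply: contrapT => h; apply: nA => B zB; apply: contrapT => h'; apply: h.
    by apply: filterS zB => x Bx Ax; apply: h'; exists x.
  by exists rho => // x Ax; rewrite leNgt; apply/negP => /h.
have sc (c : R) w w' : 0 < c -> (forall y, A y -> (riesz_kernel alpha y w <= c%:E * riesz_kernel alpha y w')%E) ->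
    balayage_energy theta w <= c * balayage_energy theta w'.
  move=> c0 h; rewrite -lee_fin EFinM -!balayage_energyE // -uint_scaler //.
  by apply: le_uint => x; exact: (balayage_scale qE q0 hb x c0 h).
apply: cvg_at_near => d d0.
pose J := balayage_energy theta z; have J1 : 0 < J + 1 by rewrite ltr_wpDl // E0.
pose e := d / (J + 1); have e0 : 0 < e by exact: divr_gt0.
have eJ : e * J <= d by rewrite /e mulrAC ler_pdivrMr // ler_pM2l // lerDl.
have [eta eta0 he] := powR_1D_le q0 e0.
have hc : (1 + eta) `^ q <= 1 + e by apply: he; rewrite lexx ltW.
have g0 : 0 < 1 + 2 / eta by rewrite addr_gt0 // divr_gt0.
pose t := Num.min (rho / 4) (eta / 2 * (rho / 4) / (1 + 2 / eta)).
have t0 : 0 < t by rewrite lt_min !divr_gt0 ?mulr_gt0 ?divr_gt0.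
near=> w.
have /andP[w1 w2] : (dist2 z w <= rho / 4) && (dist2 z w <= eta / 2 * (rho / 4) / (1 + 2 / eta)).
  by rewrite -le_min; apply: ltW; near: w; exact: near_dist2.
have {}w2 : (1 + 2 / eta) * dist2 z w <= eta / 2 * (rho / 4) by rewrite mulrC -ler_pdivlMr.
have r4 : 0 < rho / 4 by rewrite divr_gt0.
have Aw x : A x -> rho / 4 <= dist2 x w /\ rho / 4 <= dist2 x z.
  move=> /far; have := dist2_split2 w z x; rewrite (dist2C w x) (dist2C x z); lra.
apply: (ler_dist_mul e0 eJ); apply: sc; rewrite ?addr_gt0 // => y /Aw[yw yz].
  by apply: (riesz_kernel_ratio eta0 hc r4) => //; rewrite dist2C.
exact: (riesz_kernel_ratio eta0 hc r4).
Unshelve. all: end_near. Qed.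

Lemma balayage_continuous z f :
  (forall theta r, poslin (@Cont R n) theta -> 0 <= r -> supported r theta -> uniform_tail q theta ->
     balayage_energy theta @ z --> balayage_energy theta z) ->
  Cc f -> (fun y => bal y f) @ z --> bal z f.
Proof.
move=> H cf; have pb w := balayage_radon hb w; have mb w := balayage_mass n0 qE q0 hb w.
(* In the first case [A] carries no measure from which to build [theta], but all the swept measures
   vanish. *)
have [A0|/inner_cap_neq0[mu [pm cA em mm]]] := pselect (inner_cap alpha A = 0%E).
  apply: (@cvg_at_near R V (fun y => bal y f) z) => e e0; near=> y.
  by rewrite !(balayage_cap0 n0 qE q0 hb _ A0 cf) subrr normr0 ltW.
have [phi [cphi phi0 phi1 mphi]] : exists phi, [/\ Cc phi, forall x, 0 <= phi x,
    forall x, ((phi x)%:E <= cst 1%E x)%E & 0 < mu phi].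
  by apply: uint_gt; rewrite -/(total_mass mu) mm lte_fin.
have phi01 x : 0 <= phi x <= 1 by rewrite phi0 -lee_fin phi1.
have [theta [pt dt t1 ut]] := continuous_energy_part qE q0 pm em cphi phi01 mphi.
have [r r0 st] := supported_density pm cphi phi0 pt dt.
apply: (@cvg_at_near R V (fun y => bal y f) z) => e e0; apply: contrapT => nB.
(* An ultrafilter finer than the neighbourhoods of [z] that stays in [B] exists if continuity fails;
   since the vague limit along it agrees with [bal z] on [f], it must leave [B]. *)
pose B := [set w | ~ `|bal z f - bal w f| <= e].
have PF : ProperFilter (within B (nbhs z)).
  split; last exact: within_filter.
  move=> h; have {}h : \forall w \near z, B w -> False by exact: h.
  by apply: nB; apply: filterS h => w Bw; apply: contrapT => /Bw.
have [U [UU FU]] := ultraFilterLemma PF.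
have PU := @ultra_proper _ _ UU.
have UB : \forall w \near U, B w by apply: FU; exact: withinT.
have Unear (P : set V) : nbhs z P -> U P.
  by move=> zP; apply: FU; apply: filterS zP => w Pw _.
have [nu [pn hn]] : exists nu, pos_radon nu /\ forall g, Cc g -> bal w g @[w --> U] --> (nu g : R).
  apply: (bounded_ultralimit UU pb) => j j0; exists (4 `^ q); near=> w; apply: mb; first exact: Cc_cutoff.
  by move=> x; rewrite cutoff_ge0 cutoff_le1.
have q4 : 0 < 4 `^ q :> R by rewrite powR_gt0.
have E : nu f = bal z f.
  apply: (limit_unique n0 qE q0 al PU pb mb pn hn (pb z) (mb z) q4 pt r0 st t1 ut) cf.
  move=> th r' pth r'0 sth uth.
  have ptr := poslin_Cont_radon pth.
  exists (balayage_energy th), (balayage_energy th z); split.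
  - by near=> w; rewrite (fubini_potential qE q0 ptr (pb w)) balayage_energyE.
  - by move=> P /(H th r' pth r'0 sth uth) hP; exact: Unear.
  - by rewrite (fubini_potential qE q0 ptr (pb z)) balayage_energyE.
have /cvgrPdist_le/(_ e e0) h := hn f cf; rewrite E in h.
have : \forall w \near U, False by apply: filterS2 h UB => w.
by move=> /filter_ex[].
Unshelve. all: end_near. Qed.

End BalayageLimit.

Theorem mainTheorem8 (R : realType) (n : nat) (alpha : R) (A : set 'rV[R]_n)
    (bal : 'rV[R]_n -> ('rV[R]_n -> R) -> R) :
  (3 <= n)%N -> 0 < alpha <= 2 ->
  (forall y, is_balayage alpha (dirac_m y) A (bal y)) ->
  (forall z, ~ irregular_pts A bal z ->
     forall f, Cc f -> (fun y => bal y f) @ z --> bal z f) /\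
  (forall z, regular_pts bal z ->
     forall f, Cc f -> (fun y => bal y f) @ z --> f z).
Proof.
move=> n3 al hb; pose q := (n%:R - alpha) / 2.
have n0 : (0 < n)%N by exact: leq_trans n3.
have q0 : 0 < q.
  rewrite divr_gt0 // subr_gt0; case/andP: al => _ a2; apply: le_lt_trans a2 _.
  by rewrite ltr_nat.
have reg z f : regular_pts bal z -> Cc f -> (fun y => bal y f) @ z --> bal z f.
  move=> rz; apply: (balayage_continuous n0 (erefl q) q0 al hb) => theta r.
  exact: (energy_cvg_regular n0 (erefl q) q0 hb rz).
split=> [z nz f cf|z rz f cf]; last by have := reg z f rz cf; rewrite (rz f cf).
have [rz|rz] := pselect (regular_pts bal z); first exact: reg.
have nA : ~ closure A z by move=> cz; apply: nz.
apply: (balayage_continuous n0 (erefl q) q0 al hb) cf => theta r pt _ _ ut.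
exact: (energy_cvg_off n0 (erefl q) q0 hb nA pt ut).
Qed.
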